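(* Let $\alpha>0$, let $1\le p\le 2\le q\le\infty$ with $p<q$, and let $\mu$ be a positive Borel measure on $(0,\infty)$. (i) If $\int_1^\infty t^{\frac{2}{q}-1}\,d\mu(t)<\infty$ and $\sum_{n=0}^\infty \mu_{n}(n+1)^{\frac{q-p}{pq}-1}<\infty$, then $\mathcal{H}_\mu:F^q_\alpha\to F^p_\alpha$ is bounded. (ii) If $\mathcal{H}_\mu:F^q_\alpha\to F^p_\alpha$ is bounded, then $\sum_{n=0}^\infty \mu_n^{\frac{pq}{q-p}}(n+1)^{-1/2}<\infty$.
   Context: For $\alpha>0$, $F^p_\alpha$ is the space of entire functions $f$ with $\|f\|_{p,\alpha}<\infty$, where $\|f\|_{p,\alpha}=\left(\frac{\alpha p}{2\pi}\int_{\mathbb C}|f(z)e^{-\frac{\alpha}{2}|z|^2}|^p\,dA(z)\right)^{1/p}$ for $0<p<\infty$ ($dA$ is area measure) and $\|f\|_{\infty,\alpha}=\sup_{z\in\mathbb C}|f(z)|e^{-\frac{\alpha}{2}|z|^2}$. The Hausdorff operator is $\mathcal{H}_\mu(f)(z)=\int_0^\infty f\left(\frac{z}{t}\right)\frac{d\mu(t)}{t}$ for entire $f$, and $\mu_n=\int_0^\infty\frac{d\mu(t)}{t^{n+1}}$ for $n=0,1,2,\dots$. ''$\mathcal{H}_\mu:X\to Y$ is bounded'' means it is well defined on $X$ with values in $Y$ and there is $C>0$ with $\|\mathcal{H}_\mu f\|_Y\le C\|f\|_X$ for all $f\in X$. For $q=\infty$, $\frac{2}{q}=0$, $\frac{q-p}{pq}$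 is read as $\frac1p-\frac1q=\frac1p$, and $\frac{pq}{q-p}$ as $p$. *)

(* Defs.v *)
From HB Require Import structures.
From mathcomp Require Import all_boot all_order all_algebra.
From mathcomp Require Import complex.
From mathcomp Require Import all_classical all_reals all_analysis.

Set Implicit Arguments.
Unset Strict Implicit.
Unset Printing Implicit Defensive.

Import Order.TTheory GRing.Theory Num.Theory numFieldNormedType.Exports.

Local Open Scope classical_set_scope.
Local Open Scope complex_scope.
Local Open Scope ring_scope.

(* R[i] is a normed space over itself, so this is complex differentiability. *)
Definition entire (R : realType) (f : R[i] -> R[i]) : Prop :=
  forall z : R[i], derivable (f : R[i]^o -> R[i]^o) z 1.

(* The library's norm `|z| has values in R[i]; this is the same modulus with
   values in R. *)
Definition modulus (R : realType) (z : R[i]) : R := ComplexField.Normc.normc z.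

Definition area_integral (R : realType) (g : R[i] -> \bar R) : \bar R :=
  (\int[lebesgue_measure \x lebesgue_measure]_(xy in [set: R * R])
     g (xy.1 +i* xy.2))%E.

Definition fock_weight (R : realType) (alpha : R) (f : R[i] -> R[i])
    (z : R[i]) : R :=
  modulus (f z) * expR (- (alpha / 2 * modulus z ^+ 2)).

(* The value at p = -oo is junk. *)
Definition fock_norm (R : realType) (alpha : R) (p : \bar R)
    (f : R[i] -> R[i]) : \bar R :=
  match p with
  | EFin r => (((alpha * r / (2 * pi))%:E *
      area_integral (fun z => ((fock_weight alpha f z) `^ r)%:E)) `^ r^-1)%E
  | +oo%E => ereal_sup [set (fock_weight alpha f z)%:E | z in [set: R[i]]]
  | -oo%E => 0%E
  end.

Definition fock (R : realType) (alpha : R) (p : \bar R) : set (R[i] -> R[i]) :=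
  [set f | entire f /\ (fock_norm alpha p f < +oo)%E].

(* Complex-valued Lebesgue integrals, taken componentwise. *)
Definition cintegrable d (T : measurableType d) (R : realType)
    (mu : {measure set T -> \bar R}) (D : set T) (f : T -> R[i]) : Prop :=
  mu.-integrable D (EFin \o (fun t => complex.Re (f t))) /\
  mu.-integrable D (EFin \o (fun t => complex.Im (f t))).

Definition cintegral d (T : measurableType d) (R : realType)
    (mu : {measure set T -> \bar R}) (D : set T) (f : T -> R[i]) : R[i] :=
  Rintegral mu D (fun t => complex.Re (f t)) +i*
  Rintegral mu D (fun t => complex.Im (f t)).

(* A Borel measure on (0, oo) is represented by a Borel measure on R of which
   only the restriction to `]0, +oo[ is ever used. *)
Definition hausdorff_integrand (R : realType) (f : R[i] -> R[i]) (z : R[i])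
    (t : measurableTypeR R) : R[i] :=
  f (z / (t : R)%:C) / (t : R)%:C.

Definition hausdorff (R : realType)
    (mu : {measure set (measurableTypeR R) -> \bar R})
    (f : R[i] -> R[i]) (z : R[i]) : R[i] :=
  cintegral mu `]0, +oo[ (hausdorff_integrand f z).

Definition hausdorff_moment (R : realType)
    (mu : {measure set (measurableTypeR R) -> \bar R}) (n : nat) : \bar R :=
  (\int[mu]_(t in `]0%R, +oo[) (((t : R) ^+ n.+1)^-1)%:E)%E.

(* Boundedness of the operator from F^q_alpha to F^p_alpha; being well defined
   on F^q_alpha includes (absolute) convergence of the defining integral at
   every point z. *)
Definition hausdorff_bounded (R : realType) (alpha : R)
    (mu : {measure set (measurableTypeR R) -> \bar R}) (q p : \bar R) : Prop :=
  (forall f, fock alpha q f ->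
     (forall z, cintegrable mu `]0, +oo[ (hausdorff_integrand f z)) /\
     fock alpha p (hausdorff mu f)) /\
  exists C : R, 0 < C /\
    forall f, fock alpha q f ->
      (fock_norm alpha p (hausdorff mu f) <= C%:E * fock_norm alpha q f)%E.

(* 2 / q, (q - p) / (p q) and p q / (q - p), with their readings 0, 1 / p and
   p at q = +oo. *)
Definition two_over (R : realType) (q : \bar R) : R :=
  match q with EFin r => 2 / r | _ => 0 end.

Definition exponent_gap (R : realType) (p : R) (q : \bar R) : R :=
  match q with EFin r => (r - p) / (p * r) | _ => p^-1 end.

Definition gap_exponent (R : realType) (p : R) (q : \bar R) : R :=
  match q with EFin r => p * r / (r - p) | _ => p end.

(* Main.v *)
From HB Require Import structures.
Require Import Defs.
From mathcomp Require Import all_boot all_order all_algebra.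
From mathcomp Require Import complex.
From mathcomp Require Import all_classical all_reals all_analysis.
From mathcomp Require Import measurable_realfun.
From mathcomp Require Import ring lra.

(** Part (i).  With c = exponent_gap p q and e = two_over q - 1, summability of
    mu_n (n+1)^(c-1) forces mu(]0,1]) = 0, because the sum of
    t^-(n+1) (n+1)^(c-1) over n diverges for t <= 1; since that sum is of order
    (1 - t^-2)^(-c) near t = 1, the two hypotheses together make the weight
    t^e (1 - t^-2)^(-c) integrable on ]1,oo[.  Up to a constant this weight
    bounds the norm of the operator f |-> f(./t)/t from F^q to F^p: the Gaussian
    left over by the rescaling is absorbed by Hoelder's inequality.  Minkowski's
    integral inequality then sums the dilations.

    Part (ii).  The monomials E_k proportional to z^(k^2), normalized so that
    their weighted modulus is at most 1, are orthogonal and concentrated near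
    the annuli k <= sqrt(alpha) |z| < k+1.  So f = E_0 + ... + E_(K-1) has
    bounded weight F, and S = |F|_2^2 is, by orthogonality, the integral of the
    sum of the squared weights of the E_k, which is at least exp(-3) where
    sqrt(alpha) |z| < K.  Thus S >= c K^2 while |f|_q <= C S^(1/q).  The
    operator is diagonal on monomials.  If mu_(k^2) >= m for all k < K and G is
    the weight of H f, then m S <= <H f, f> <= |G F|_1, and
    G F <= (m/2) F^2 + C m^(1-p) G^p turns boundedness into m^s K^2 <= C with
    s = gap_exponent p q.  Taking m <= mu(]0,1[), which bounds every moment from
    below, shows mu(]0,1[) = 0; hence the moments decrease, the estimate applies
    to m = mu_n with K - 1 the integer square root of n, and mu_n^s <= C / (n+1). *)

Set Implicit Arguments.
Unset Strict Implicit.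
Unset Printing Implicit Defensive.

Import Order.TTheory GRing.Theory Num.Theory numFieldNormedType.Exports.

Local Open Scope classical_set_scope.
Local Open Scope complex_scope.
Local Open Scope ring_scope.

(** * Complex differentiability in epsilon-delta form *)

(** [entire] means differentiability at each point, with no uniformity. To differentiate
    [hausdorff mu f] under the integral sign, the remainder of f at z / t must be quadratic in the
    increment with one constant for all t > 1; Goursat's theorem and the Cauchy estimate serve to
    provide this. In part (i) the exponent c is fixed by 1 / p = 1 / q + c, so that Hoelder's
    inequality places the leftover Gaussian in L^(1/c). As mu is arbitrary, Tonelli's theorem
    becomes available only once the finiteness of mu_0 has made mu sigma-finite on ]1, oo[. In part
    (ii) the degrees are squares because r^n exp(-alpha r^2 / 2) peaks at r = sqrt(n / alpha): for n
    = k^2 the peaks are equally spaced and of fixed width, so they cover the plane while their sum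
    stays bounded. The exponent s arises because the p-th power of the norm of H f costs only
    S^(p/q) against the S of the pairing, and p < q. The final series is dominated by a multiple of
    the sum of (n + 1)^(-3/2). *)

Section modulus.
Variable R : realType.
Implicit Types (x y : R) (z w : R[i]).

Lemma normr_modulus z : `|z| = (modulus z)%:C.
Proof. by []. Qed.

Lemma modulusE z : modulus z = Num.sqrt (complex.Re z ^+ 2 + complex.Im z ^+ 2).
Proof. by case: z. Qed.

Lemma sqr_modulus z : modulus z ^+ 2 = complex.Re z ^+ 2 + complex.Im z ^+ 2.
Proof. by rewrite modulusE sqr_sqrtr// addr_ge0 ?sqr_ge0. Qed.

Lemma modulus_ge0 z : 0 <= modulus z.
Proof. by rewrite modulusE sqrtr_ge0. Qed.

Lemma modulus0 : modulus (0 : R[i]) = 0.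
Proof. exact: ComplexField.Normc.normc0. Qed.

Lemma modulus1 : modulus (1 : R[i]) = 1.
Proof. exact: ComplexField.Normc.normc1. Qed.

Lemma modulus_eq0 z : (modulus z == 0) = (z == 0).
Proof.
apply/eqP/eqP => [|->]; last exact: modulus0.
exact: ComplexField.Normc.eq0_normc.
Qed.

Lemma modulusM z w : modulus (z * w) = modulus z * modulus w.
Proof. exact: ComplexField.Normc.normcM. Qed.

Lemma modulusV z : modulus z^-1 = (modulus z)^-1.
Proof. exact: ComplexField.Normc.normcV. Qed.

Lemma modulusX z n : modulus (z ^+ n) = modulus z ^+ n.
Proof.
by elim: n => [|n IH]; rewrite ?expr0 ?modulus1// !exprS modulusM IH.
Qed.

Lemma modulusN z : modulus (- z) = modulus z.
Proof. exact: normcN. Qed.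

Lemma ler_modulusD z w : modulus (z + w) <= modulus z + modulus w.
Proof. exact: le_normcD. Qed.

Lemma ler_modulusB z w : modulus (z - w) <= modulus z + modulus w.
Proof. by rewrite -(modulusN w) ler_modulusD. Qed.

Lemma modulusBC z w : modulus (z - w) = modulus (w - z).
Proof. by rewrite -modulusN opprB. Qed.

Lemma modulus_real x : modulus x%:C = `|x|.
Proof. by rewrite modulusE /= expr0n addr0 sqrtr_sqr. Qed.

Lemma modulus_i : modulus ('i : R[i]) = 1.
Proof. by rewrite modulusE /= expr0n add0r expr1n sqrtr1. Qed.

Lemma modulus_conj z : modulus z^* = modulus z.
Proof. by case: z => a b; rewrite !modulusE /= sqrrN. Qed.

Lemma normr_Re_le z : `|complex.Re z| <= modulus z.
Proof.
by rewrite -(@ler_pXn2r _ 2)// ?nnegrE ?modulus_ge0// sqr_modulus real_normK ?num_real// lerDl sqr_ge0.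
Qed.

Lemma normr_Im_le z : `|complex.Im z| <= modulus z.
Proof.
by rewrite -(@ler_pXn2r _ 2)// ?nnegrE ?modulus_ge0// sqr_modulus real_normK ?num_real// lerDr sqr_ge0.
Qed.

Lemma modulus_le_ReIm z : modulus z <= `|complex.Re z| + `|complex.Im z|.
Proof.
rewrite -(@ler_pXn2r _ 2)// ?nnegrE ?modulus_ge0 ?addr_ge0//.
rewrite sqr_modulus sqrrD !real_normK ?num_real// lerD2r lerDl.
by rewrite mulrn_wge0// mulr_ge0.
Qed.

Lemma ReD z w : complex.Re (z + w) = complex.Re z + complex.Re w.
Proof. by case: z w => ? ? []. Qed.

Lemma ImD z w : complex.Im (z + w) = complex.Im z + complex.Im w.
Proof. by case: z w => ? ? []. Qed.

Lemma ReN z : complex.Re (- z) = - complex.Re z.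
Proof. by case: z. Qed.

Lemma ImN z : complex.Im (- z) = - complex.Im z.
Proof. by case: z. Qed.

Lemma ReM z w : complex.Re (z * w)
  = complex.Re z * complex.Re w - complex.Im z * complex.Im w.
Proof. by case: z w => ? ? []. Qed.

Lemma ImM z w : complex.Im (z * w)
  = complex.Re z * complex.Im w + complex.Im z * complex.Re w.
Proof. by case: z w => ? ? []. Qed.

Lemma complexP z w :
  complex.Re z = complex.Re w -> complex.Im z = complex.Im w -> z = w.
Proof. by case: z w => ? ? [? ?] /= -> ->. Qed.

End modulus.

Section cdiff.
Variable R : realType.
Implicit Types (f g : R[i] -> R[i]) (z w D : R[i]).

(** The remainder is multiplied out and measured by real moduli, so that remainders can be added and
    integrated; h = 0 is harmless, as both sides vanish there. *)
Definition cdiff f z D := forall e : R, 0 < e -> exists2 d : R, 0 < d &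
  forall h, modulus h < d -> modulus (f (z + h) - f z - D * h) <= e * modulus h.

Lemma derivable_cdiffP f z :
  derivable (f : R[i]^o -> R[i]^o) z 1 <-> exists D, cdiff f z D.
Proof.
split.
  move=> /cvg_ex[/= D /cvgrPdist_le H]; exists D => e e0.
  have e0' : 0 < e%:C by rewrite ltcR.
  have := H _ e0'; rewrite /dnbhs /within/= => /nbhs_ballP[/= d d0 Hd].
  (* In the order of [R[i]] a number above 0 is real, so the radius given by the filter comes from
     [R]. *)
  have [d' dE] : exists d', d = d'%:C.
    by exists (complex.Re d); rewrite RRe_real// gtr0_real.
  exists d'; first by move: d0; rewrite dE ltcR.
  move=> h hd; have [->|h0] := eqVneq h 0.
    by rewrite addr0 subrr mulr0 subr0 modulus0 mulr0.
  have := Hd h; rewrite /= sub0r normrN dE normr_modulus ltcR.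
  move=> /(_ hd h0); rewrite normr_modulus lecR => H2.
  rewrite -[leRHS](mulrC) -ler_pdivrMl; last first.
    by rewrite lt_neqAle eq_sym modulus_eq0 h0 modulus_ge0.
  rewrite -modulusV -modulusM -modulusN.
  apply: le_trans H2; rewrite le_eqVlt; apply/orP; left; apply/eqP; congr modulus.
  rewrite /GRing.scale/= mulr1 (addrC z h).
  rewrite mulrBr [D * h]mulrC mulKf//; by rewrite opprB.
move=> [D H]; apply/cvg_ex; exists D => /=; apply/cvgrPdist_le => e e0.
have [e' eE] : exists e', e = e'%:C.
  by exists (complex.Re e); rewrite RRe_real// gtr0_real.
have e0' : 0 < e' by rewrite -ltcR -eE.
have [d d0 Hd] := H _ e0'.
rewrite /dnbhs /within/=; apply/nbhs_ballP; exists d%:C => /=; first by rewrite ltcR.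
move=> h; rewrite /= sub0r normrN normr_modulus ltcR => hd h0.
rewrite normr_modulus eE lecR.
have h0' : 0 < modulus h by rewrite lt_neqAle eq_sym modulus_eq0 h0 modulus_ge0.
rewrite -(ler_pM2r h0'); apply: le_trans (Hd _ hd).
rewrite -modulusM -modulusN le_eqVlt; apply/orP; left; apply/eqP; congr modulus.
rewrite /GRing.scale/= mulr1 (addrC z h).
by rewrite mulrBl mulrAC mulVf// mul1r opprB.
Qed.

Lemma entire_cdiff f : entire f -> exists df, forall z, cdiff f z (df z).
Proof.
move=> ef; suff [df dfP] : {df & forall z, cdiff f z (df z)} by exists df.
by apply: boolp.choice => z; apply/derivable_cdiffP/ef.
Qed.

Lemma cdiff_entire f df : (forall z, cdiff f z (df z)) -> entire f.
Proof. by move=> H z; apply/derivable_cdiffP; exists (df z). Qed.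

Definition ccont f := forall z (e : R), 0 < e -> exists2 d : R, 0 < d &
  forall w, modulus (w - z) < d -> modulus (f w - f z) <= e.

Lemma cdiff_cont f df : (forall z, cdiff f z (df z)) -> ccont f.
Proof.
move=> H z e e0; have [d d0 Hd] := H z 1 ltr01.
set M := modulus (df z) + 1.
have M0 : 0 < M by rewrite ltr_wpDl// modulus_ge0.
exists (Num.min d (e / M)); first by rewrite lt_min d0 divr_gt0.
move=> w; rewrite lt_min => /andP[wd we].
have := Hd _ wd; rewrite [z + _]addrC subrK mul1r => H1.
have -> : f w - f z = (f w - f z - df z * (w - z)) + df z * (w - z) by rewrite subrK.
apply: le_trans (ler_modulusD _ _) _; rewrite modulusM.
apply: le_trans (lerD H1 (lexx _)) _.
rewrite -{1}[modulus (w - z)]mul1r -mulrDl addrC -/M mulrC -ler_pdivlMr//.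
exact: ltW.
Qed.

End cdiff.

Section rdiff.
Variable R : realType.

(** Brings the derivatives of [expR], [cos] and [sin] into the form needed for [cexp], and later
    restricts complex derivatives to real segments. *)
Lemma is_derive_epsP (f : R -> R) (x D : R) :
  is_derive x 1 f D <-> forall e : R, 0 < e -> exists2 d : R, 0 < d &
  forall h, `|h| < d -> `|f (x + h) - f x - D * h| <= e * `|h|.
Proof.
split.
  move=> [fx fD] e e0.
  have /cvgrPdist_le/(_ _ e0) : h^-1 *: (f (h *: 1 + x) - f x) @[h --> 0^'] --> D.
    by rewrite -fD; exact: fx.
  rewrite /dnbhs /within/= => /nbhs_ballP[/= d d0 Hd]; exists d => // h hd.
  have [->|h0] := eqVneq h 0; first by rewrite addr0 subrr mulr0 subr0 normr0 mulr0.
  have := Hd h; rewrite -ball_normE /= sub0r normrN => /(_ hd h0) H2.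
  rewrite [leRHS]mulrC -ler_pdivrMl ?normr_gt0// -normfV -normrM -normrN.
  apply: le_trans H2; rewrite le_eqVlt; apply/orP; left; apply/eqP; congr (`|_|).
  rewrite /GRing.scale/= mulr1 (addrC x h).
  by rewrite mulrBr [D * h]mulrC mulKf//; rewrite opprB.
move=> H.
have cv : h^-1 *: (f (h *: 1 + x) - f x) @[h --> 0^'] --> D.
  apply/cvgrPdist_le => e e0.
  have [d d0 Hd] := H _ e0.
  rewrite /dnbhs /within/=; apply/nbhs_ballP; exists d => //=.
  move=> h; rewrite -ball_normE /= sub0r normrN => hd h0.
  have h0' : 0 < `|h| by rewrite normr_gt0.
  rewrite -(ler_pM2r h0'); apply: le_trans (Hd _ hd).
  rewrite -normrM -normrN le_eqVlt; apply/orP; left; apply/eqP; congr (`|_|).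
  rewrite /GRing.scale/= mulr1 (addrC x h).
  by rewrite mulrBl mulrAC mulVf// mul1r opprB.
split; first by apply/cvg_ex; exists D.
by apply/cvg_lim.
Qed.

End rdiff.

(** * The complex exponential and closure properties of entire functions *)

Section cexp.
Variable R : realType.
Implicit Types (z w : R[i]).

Definition cexp z : R[i] :=
  (expR (complex.Re z) * cos (complex.Im z)) +i* (expR (complex.Re z) * sin (complex.Im z)).

Lemma cexpD z w : cexp (z + w) = cexp z * cexp w.
Proof.
by apply: complexP; rewrite ?ReM ?ImM /= ReD ImD expRD ?cosD ?sinD; ring.
Qed.

Lemma cexp0 : cexp 0 = 1.
Proof. by rewrite /cexp /= cos0 sin0 expR0 mulr1 mulr0. Qed.

Lemma cexpN z : cexp (- z) = (cexp z)^-1.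
Proof.
have H : cexp (- z) * cexp z = 1 by rewrite -cexpD addNr cexp0.
have z0 : cexp z != 0 by apply: contra_eq_neq H => ->; rewrite mulr0 eq_sym oner_neq0.
by apply: (mulIf z0); rewrite H mulVf.
Qed.

Lemma modulus_cexp z : modulus (cexp z) = expR (complex.Re z).
Proof.
rewrite modulusE /= !exprMn -mulrDr cos2Dsin2 mulr1 sqrtr_sqr ger0_norm//.
Qed.

Lemma cexp_2pi z : cexp (z + (0 +i* (pi *+ 2))) = cexp z.
Proof.
by rewrite cexpD /cexp /= expR0 !mul1r cos2pi sin2pi; apply: complexP => /=; ring.
Qed.

(** Only the derivative at 0 is computed by hand; the functional equation carries it to every other
    point. *)
Lemma cdiff_cexp0 : cdiff cexp 0 1.
Proof.
move=> e' e'0.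
(* The real part will cost 3 e |h| and the imaginary part 5 e |h|, hence the 8; [e <= 1] keeps
   [1 + x] below 2 in absolute value. *)
have [e [e0 e1 ee']] : exists e : R, [/\ 0 < e, e <= 1 & 8 * e <= e'].
  exists (Num.min 1 (e' / 8)); split.
  - by rewrite lt_min ltr01/= divr_gt0.
  - by rewrite ge_min lexx.
  - by rewrite -ler_pdivlMl// mulrC ge_min lexx orbT.
have [d1 d10 H1] := (is_derive_epsP expR 0 1).1
  (is_derive_eq (is_derive_expR _) (expR0 R)) _ e0.
have [d2 d20 H2] := (is_derive_epsP cos 0 0).1
  (is_derive_eq (is_derive_cos _) (etrans (congr1 -%R (sin0 R)) (oppr0 _))) _ e0.
have [d3 d30 H3] := (is_derive_epsP sin 0 1).1
  (is_derive_eq (is_derive_sin _) (cos0 R)) _ e0.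
exists (Num.min (Num.min d1 d2) (Num.min d3 e)).
  by rewrite !lt_min d10 d20 d30 e0.
move=> h; rewrite !lt_min => /andP[/andP[h1 h2]] /andP[h3 h4].
set m := modulus h in h1 h2 h3 h4 *.
have m0 : 0 <= m := modulus_ge0 h.
have xm : `|complex.Re h| <= m := normr_Re_le h.
have ym : `|complex.Im h| <= m := normr_Im_le h.
set x := complex.Re h in xm *; set y := complex.Im h in ym *.
have {}H1 : `|expR x - 1 - x| <= e * `|x|.
  by have := H1 x (le_lt_trans xm h1); rewrite add0r expR0 mul1r.
have {}H2 : `|cos y - 1| <= e * `|y|.
  by have := H2 y (le_lt_trans ym h2); rewrite add0r cos0 mul0r subr0.
have {}H3 : `|sin y - y| <= e * `|y|.
  by have := H3 y (le_lt_trans ym h3); rewrite add0r sin0 mul1r subr0.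
rewrite add0r cexp0 mul1r.
apply: le_trans (modulus_le_ReIm _) _.
rewrite !(ReD, ImD, ReN, ImN) /= -/x -/y subr0.
have A1 : `|expR x * cos y - 1 - x| <= e * m + 2 * (e * m).
  have -> : expR x * cos y - 1 - x = (expR x - 1 - x) * cos y + (1 + x) * (cos y - 1) by ring.
  apply: le_trans (ler_normD _ _) _; rewrite !normrM; apply: lerD.
    rewrite -[leRHS]mulr1; apply: ler_pM => //; last exact: cos_max.
    by apply: le_trans H1 _; rewrite ler_pM2l.
  apply: ler_pM => //.
    apply: le_trans (ler_normD _ _) _; rewrite normr1 -[leRHS]/(1 + 1) lerD2l.
    by apply: le_trans xm _; apply: le_trans e1; exact: ltW.
  by apply: le_trans H2 _; rewrite ler_pM2l.
have A2 : `|expR x * sin y - y| <= 4 * (e * m) + (e * m).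
  have -> : expR x * sin y - y = (expR x - 1) * sin y + (sin y - y) by ring.
  apply: le_trans (ler_normD _ _) _; rewrite !normrM; apply: lerD; last first.
    by apply: le_trans H3 _; rewrite ler_pM2l.
  have B1 : `|expR x - 1| <= 2 * e.
    have -> : expR x - 1 = (expR x - 1 - x) + x by ring.
    apply: le_trans (ler_normD _ _) _.
    have : e * `|x| <= 1 * m by apply: ler_pM => //; exact: ltW.
    rewrite mul1r => B; lra.
  have B2 : `|sin y| <= 2 * m.
    have -> : sin y = (sin y - y) + y by ring.
    apply: le_trans (ler_normD _ _) _.
    have : e * `|y| <= 1 * m by apply: ler_pM => //; exact: ltW.
    rewrite mul1r => B; lra.
  have -> : 4 * (e * m) = (2 * e) * (2 * m) by ring.
  exact: ler_pM.
rewrite -/m; apply: le_trans (lerD A1 A2) _.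
have : 8 * e * m <= e' * m by rewrite ler_wpM2r.
lra.
Qed.


Lemma cdiff_cexp z : cdiff cexp z (cexp z).
Proof.
move=> e e0; have M0 : 0 < modulus (cexp z) by rewrite modulus_cexp expR_gt0.
have [d d0 H] := cdiff_cexp0 (divr_gt0 e0 M0); exists d => // h hd.
have := H h hd; rewrite add0r cexp0 mul1r => H1.
have -> : cexp (z + h) - cexp z - cexp z * h = cexp z * (cexp h - 1 - h).
  by rewrite cexpD; ring.
rewrite modulusM; apply: le_trans (ler_wpM2l (modulus_ge0 _) H1) _.
by rewrite mulrA mulrCA mulfV ?mulr1// gt_eqF.
Qed.

Lemma entire_comp (f g : R[i] -> R[i]) : entire f -> entire g -> entire (f \o g).
Proof.
move=> ef eg z; apply/derivable1_diffP.
apply: (@differentiable_comp R[i] R[i]^o R[i]^o R[i]^o g f z).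
  exact/derivable1_diffP/eg.
exact/derivable1_diffP/ef.
Qed.

Lemma entireM (f g : R[i] -> R[i]) : entire f -> entire g -> entire (fun z => f z * g z).
Proof. by move=> ef eg z; exact: (@derivableM R[i] R[i]^o f g z 1 (ef z) (eg z)). Qed.

Lemma entireD (f g : R[i] -> R[i]) : entire f -> entire g -> entire (fun z => f z + g z).
Proof. by move=> ef eg z; exact: (@derivableD R[i] R[i]^o R[i]^o f g z 1 (ef z) (eg z)). Qed.

Lemma entireN (f : R[i] -> R[i]) : entire f -> entire (fun z => - f z).
Proof. by move=> ef z; exact: (@derivableN R[i] R[i]^o R[i]^o f z 1 (ef z)). Qed.

Lemma entire_id : entire (@id R[i]).
Proof. by move=> z; exact: derivable_id. Qed.

Lemma entire_cst (c : R[i]) : entire (fun=> c).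
Proof. by move=> z; exact: derivable_cst. Qed.

Lemma entireX n : entire (fun z : R[i] => z ^+ n).
Proof.
elim: n => [|n IH]; first exact: entire_cst.
rewrite (_ : (fun z => _) = fun z => z * z ^+ n).
  exact: (entireM entire_id IH).
by apply/funext => z; rewrite exprS.
Qed.

Lemma entire_sum (I : Type) (s : seq I) (F : I -> R[i] -> R[i]) :
  (forall i, entire (F i)) -> entire (fun z => \sum_(i <- s) F i z).
Proof.
move=> H; elim: s => [|i s IH].
  rewrite (_ : (fun z => _) = fun=> 0); first exact: entire_cst.
  by apply/funext => z; rewrite big_nil.
rewrite (_ : (fun z => _) = fun z => F i z + \sum_(j <- s) F j z).
  exact: (entireD (H i) IH).
by apply/funext => z; rewrite big_cons.
Qed.

Lemma entire_cexp : entire cexp.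
Proof. exact: cdiff_entire cdiff_cexp. Qed.

End cexp.

(** * Componentwise complex Lebesgue integrals *)

Section cintegral.
Context d (T : measurableType d) (R : realType).
Variables (mu : {measure set T -> \bar R}) (D : set T).
Hypothesis mD : measurable D.
Implicit Types (f g : T -> R[i]) (c : R[i]).

Lemma cintegrableD f g : cintegrable mu D f -> cintegrable mu D g ->
  cintegrable mu D (fun t => f t + g t).
Proof.
move=> [f1 f2] [g1 g2]; split.
- by apply: eq_integrable (integrableD mD f1 g1) => // x _ /=; rewrite ReD.
- by apply: eq_integrable (integrableD mD f2 g2) => // x _ /=; rewrite ImD.
Qed.

Lemma cintegrableZ c f : cintegrable mu D f -> cintegrable mu D (fun t => c * f t).
Proof.
move=> [f1 f2]; split.
- apply: eq_integrable (integrableB mD (integrableZl mD (complex.Re c) f1)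
    (integrableZl mD (complex.Im c) f2)) => // x _ /=.
  by rewrite ReM.
- apply: eq_integrable (integrableD mD (integrableZl mD (complex.Re c) f2)
    (integrableZl mD (complex.Im c) f1)) => // x _ /=.
  by rewrite ImM.
Qed.

Lemma cintegralD f g : cintegrable mu D f -> cintegrable mu D g ->
  cintegral mu D (fun t => f t + g t) = cintegral mu D f + cintegral mu D g.
Proof.
move=> [f1 f2] [g1 g2]; apply: complexP => /=.
- by rewrite -RintegralD//; apply: eq_Rintegral => x _; rewrite ReD.
- by rewrite -RintegralD//; apply: eq_Rintegral => x _; rewrite ImD.
Qed.

Lemma cintegralZ c f : cintegrable mu D f ->
  cintegral mu D (fun t => c * f t) = c * cintegral mu D f.
Proof.
move=> [f1 f2]; apply: complexP; rewrite ?ReM ?ImM /=.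
- rewrite -!RintegralZl// -RintegralB//.
  + by apply: eq_Rintegral => x _; rewrite ReM.
  + exact: (integrableZl mD (complex.Re c) f1).
  + exact: (integrableZl mD (complex.Im c) f2).
- rewrite -!RintegralZl// -RintegralD//.
  + by apply: eq_Rintegral => x _; rewrite ImM.
  + exact: (integrableZl mD (complex.Re c) f2).
  + exact: (integrableZl mD (complex.Im c) f1).
Qed.

Lemma cintegralB f g : cintegrable mu D f -> cintegrable mu D g ->
  cintegral mu D (fun t => f t - g t) = cintegral mu D f - cintegral mu D g.
Proof.
move=> fi gi; have := cintegralD fi (cintegrableZ (-1) gi).
rewrite (cintegralZ (-1) gi) mulN1r => <-; congr (cintegral _ _ _).
by apply/funext => t; rewrite mulN1r.
Qed.

Lemma cintegrableB f g : cintegrable mu D f -> cintegrable mu D g ->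
  cintegrable mu D (fun t => f t - g t).
Proof.
move=> fi gi; have := cintegrableD fi (cintegrableZ (-1) gi).
by congr (cintegrable _ _ _); apply/funext => t; rewrite mulN1r.
Qed.

Lemma eq_cintegral f g : {in D, f =1 g} -> cintegral mu D f = cintegral mu D g.
Proof.
move=> fg; apply: complexP; apply: eq_Rintegral => x xD; by rewrite fg.
Qed.

Lemma measurable_modulus f : measurable_fun D (fun t => complex.Re (f t)) ->
  measurable_fun D (fun t => complex.Im (f t)) ->
  measurable_fun D (fun t => modulus (f t)).
Proof.
move=> mr mi.
rewrite (_ : (fun t => _) = fun t => Num.sqrt (complex.Re (f t) ^+ 2 + complex.Im (f t) ^+ 2)).
  apply: measurableT_comp; first by apply: continuous_measurable_fun; exact: sqrt_continuous.
  by apply: measurable_funD; apply: measurable_funX.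
by apply/funext => t; rewrite modulusE.
Qed.

Lemma le_cintegrable f (g : T -> \bar R) :
  measurable_fun D (fun t => complex.Re (f t)) ->
  measurable_fun D (fun t => complex.Im (f t)) ->
  measurable_fun D g ->
  (forall t, D t -> ((modulus (f t))%:E <= g t)%E) ->
  (\int[mu]_(t in D) g t < +oo)%E ->
  cintegrable mu D f.
Proof.
move=> mr mi mg fg gi.
have g0 t : D t -> (0 <= g t)%E by move=> Dt; apply: le_trans (fg t Dt); rewrite lee_fin modulus_ge0.
have gI : mu.-integrable D g.
  apply/integrableP; split => //.
  by rewrite (eq_integral g)// => t /set_mem Dt; rewrite gee0_abs// g0.
split; apply: le_integrable gI => //; try exact/measurable_EFinP.
- move=> t Dt /=; rewrite [leRHS]gee0_abs ?g0//; apply: le_trans (fg t Dt).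
  by rewrite lee_fin normr_Re_le.
- move=> t Dt /=; rewrite [leRHS]gee0_abs ?g0//; apply: le_trans (fg t Dt).
  by rewrite lee_fin normr_Im_le.
Qed.

(** The factor 2 is the price of bounding the real and imaginary parts separately; it recurs in the
    later estimates and affects constants only. *)
Lemma le_modulus_cintegral f (g : T -> \bar R) : cintegrable mu D f ->
  measurable_fun D g ->
  (forall t, D t -> ((modulus (f t))%:E <= g t)%E) ->
  ((modulus (cintegral mu D f))%:E <= 2%:E * \int[mu]_(t in D) g t)%E.
Proof.
move=> [fr fi] mg fg.
have mr := measurable_int _ fr; have mi := measurable_int _ fi.
have A (h : T -> R) : mu.-integrable D (EFin \o h) ->
    (forall t, D t -> (`|h t|%:E <= g t)%E) ->
    (`|Rintegral mu D h|%:E <= \int[mu]_(t in D) g t)%E.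
  move=> hi hg; rewrite EFin_normr_Rintegral//.
  apply: le_trans (le_abse_integral mu mD (measurable_int _ hi)) _.
  apply: ge0_le_integral => //.
  by apply: measurableT_comp => //; exact: measurable_int hi.
apply: le_trans (_ : (`|Rintegral mu D (fun t => complex.Re (f t))|%:E +
  `|Rintegral mu D (fun t => complex.Im (f t))|%:E <= _)%E).
  by rewrite -EFinD lee_fin; exact: (modulus_le_ReIm (cintegral mu D f)).
rewrite (_ : 2%:E = 1 + 1)%E// ge0_muleDl// !mul1e; apply: leeD.
- by apply: A => // t Dt; apply: le_trans (fg t Dt); rewrite lee_fin normr_Re_le.
- by apply: A => // t Dt; apply: le_trans (fg t Dt); rewrite lee_fin normr_Im_le.
Qed.

End cintegral.

(** * Goursat's theorem and the Cauchy estimate *)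

Section segment_integral.
Variable R : realType.
Local Notation leb := (@lebesgue_measure R).
Implicit Types (h : R -> R[i]) (a b c : R).

Definition rcont h := continuous (fun x => complex.Re (h x)) /\
                      continuous (fun x => complex.Im (h x)).

Lemma ccont_rcont (g : R[i] -> R[i]) (s : R -> R[i]) : ccont g ->
  (forall x x', modulus (s x - s x') <= `|x - x'|) -> rcont (g \o s).
Proof.
move=> cg ls; split=> x; apply/cvgrPdist_le => e e0.
- have [d d0 Hd] := cg (s x) e e0.
  apply/nbhs_ballP; exists d => //= y /= xy.
  rewrite distrC -ReN -ReD; apply: le_trans (normr_Re_le _) _; apply: Hd.
  by apply: le_lt_trans (ls _ _) _; rewrite distrC.
- have [d d0 Hd] := cg (s x) e e0.
  apply/nbhs_ballP; exists d => //= y /= xy.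
  rewrite distrC -ImN -ImD; apply: le_trans (normr_Im_le _) _; apply: Hd.
  by apply: le_lt_trans (ls _ _) _; rewrite distrC.
Qed.

Lemma rcont_cintegrable h a b : rcont h -> cintegrable leb `[a, b] h.
Proof.
move=> [hr hi]; split; apply: continuous_compact_integrable; try exact: segment_compact.
- exact: continuous_subspaceT.
- exact: continuous_subspaceT.
Qed.

Lemma cintegral_split h a c b : rcont h -> a <= c -> c <= b ->
  cintegral leb `[a, b] h = cintegral leb `[a, c] h + cintegral leb `[c, b] h.
Proof.
move=> hc ac cb; have [r i] := rcont_cintegrable a b hc.
have [r' i'] := rcont_cintegrable c b hc.
(* The closed halves share the point c; passing through []c, b]] removes it without changing the
   integral. *)
have sub : `]c, b] `<=` `[c, b] by apply: subset_itvr; rewrite bnd_simp.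
apply: complexP => /=.
- rewrite -[X in _ = _ + X]Rintegral_itv_obnd_cbnd; last first.
    by apply: integrableS r' => //; exact: measurable_itv.
  by rewrite -(Rintegral_itvB r) ?bnd_simp// addrC subrK.
- rewrite -[X in _ = _ + X]Rintegral_itv_obnd_cbnd; last first.
    by apply: integrableS i' => //; exact: measurable_itv.
  by rewrite -(Rintegral_itvB i) ?bnd_simp// addrC subrK.
Qed.

Lemma cintegral_bound h a b (M : R) : rcont h -> a <= b ->
  (forall x, a <= x <= b -> modulus (h x) <= M) ->
  modulus (cintegral leb `[a, b] h) <= 2 * (M * (b - a)).
Proof.
move=> hc ab hM; rewrite -lee_fin.
apply: le_trans (le_modulus_cintegral _ (rcont_cintegrable a b hc)
  (g := cst M%:E) _ _) _ => //.
- rewrite integral_cst//= lebesgue_measure_itv/= lte_fin.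
  move: ab; rewrite le_eqVlt => /orP[/eqP ->|ab]; first by rewrite ltxx subrr !mulr0 mule0 mule0.
  by rewrite ab -EFinD -!EFinM.
Qed.

Lemma cintegral_cst a b (k : R[i]) : a <= b ->
  cintegral leb `[a, b] (fun=> k) = k * (b - a)%:C.
Proof.
move=> ab; apply: complexP; rewrite ?ReM ?ImM /= !Rintegral_cst//= lebesgue_measure_itv/=.
- case: ifPn => [_|]; first by rewrite mulr0 subr0.
  by rewrite lte_fin -leNgt => ba; rewrite (@le_anti _ _ a b) ?ab// subrr !mulr0 subr0.
- case: ifPn => [_|]; first by rewrite mulr0 add0r.
  by rewrite lte_fin -leNgt => ba; rewrite (@le_anti _ _ a b) ?ab// subrr !mulr0 addr0.
Qed.

End segment_integral.

Section goursat.
Variable R : realType.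
Local Notation leb := (@lebesgue_measure R).
Implicit Types (g : R[i] -> R[i]) (a b c d : R).

Definition hseg g c a b := cintegral leb `[a, b] (fun x => g (x +i* c)).
Definition vseg g a c d := cintegral leb `[c, d] (fun y => g (a +i* y)).

(** The integral of g(z) dz counterclockwise around the rectangle [a, b] x [c, d]; ['i] is dz / dy
    on the vertical sides. *)
Definition bdry g a b c d :=
  hseg g c a b + 'i * vseg g b c d - hseg g d a b - 'i * vseg g a c d.

Lemma ccont_h g c : ccont g -> rcont (fun x => g (x +i* c)).
Proof.
move=> cg; apply: (ccont_rcont (s := fun x => x +i* c) cg) => x x'.
rewrite -modulus_real le_eqVlt; apply/orP; left; apply/eqP; congr modulus.
by apply: complexP => //=; rewrite subrr.
Qed.

Lemma ccont_v g a : ccont g -> rcont (fun y => g (a +i* y)).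
Proof.
move=> cg; apply: (ccont_rcont (s := fun y => a +i* y) cg) => x x'.
rewrite -modulus_real -[leRHS]mul1r -(modulus_i R) -modulusM le_eqVlt.
apply/orP; left; apply/eqP; congr modulus.
by apply: complexP => /=; ring.
Qed.

Lemma bdryD g1 g2 a b c d : ccont g1 -> ccont g2 ->
  bdry (fun z => g1 z + g2 z) a b c d = bdry g1 a b c d + bdry g2 a b c d.
Proof.
move=> c1 c2; rewrite /bdry /hseg /vseg.
rewrite !cintegralD//; try (by apply: rcont_cintegrable; apply: ccont_h);
  try (by apply: rcont_cintegrable; apply: ccont_v).
ring.
Qed.

Lemma bdryZ g k a b c d : ccont g ->
  bdry (fun z => k * g z) a b c d = k * bdry g a b c d.
Proof.
move=> c1; rewrite /bdry /hseg /vseg.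
rewrite !cintegralZ//; try (by apply: rcont_cintegrable; apply: ccont_h);
  try (by apply: rcont_cintegrable; apply: ccont_v).
ring.
Qed.

Lemma bdry1 a b c d : a <= b -> c <= d -> bdry (fun=> 1) a b c d = 0.
Proof. by move=> ab cd; rewrite /bdry /hseg /vseg !cintegral_cst//; ring. Qed.

Lemma ccont_id : ccont (@id R[i]).
Proof. by move=> z e e0; exists e => // w /ltW. Qed.

Lemma ccont_cst (k : R[i]) : ccont (fun=> k).
Proof. by move=> z e e0; exists 1 => // w _; rewrite subrr modulus0 ltW. Qed.

(** Moving a side parallel to itself changes the integrand by a constant; the changes over the two
    pairs of opposite sides cancel. *)
Lemma bdry_id a b c d : a <= b -> c <= d -> bdry id a b c d = 0.
Proof.
move=> ab cd; rewrite /bdry /hseg /vseg.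
have Hh y : cintegral leb `[a, b] (fun x => x +i* y) =
   cintegral leb `[a, b] (fun x => x +i* 0) + 'i * y%:C * (b - a)%:C.
  rewrite -(cintegral_cst ('i * y%:C) ab) -cintegralD//.
  - by apply: eq_cintegral => x _ /=; apply: complexP => /=; ring.
  - exact/rcont_cintegrable/(ccont_h 0 ccont_id).
  - exact/rcont_cintegrable/(ccont_h 0 (ccont_cst _)).
have Hv x : cintegral leb `[c, d] (fun y => x +i* y) =
   cintegral leb `[c, d] (fun y => 0 +i* y) + x%:C * (d - c)%:C.
  rewrite -(cintegral_cst x%:C cd) -cintegralD//.
  - by apply: eq_cintegral => y _ /=; apply: complexP => /=; ring.
  - exact/rcont_cintegrable/(ccont_v 0 ccont_id).
  - exact/rcont_cintegrable/(ccont_h 0 (ccont_cst _)).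
rewrite (Hh c) (Hh d) (Hv b) (Hv a) !rmorphB /=; ring.
Qed.

(** The perimeter contributes one factor 2 and the componentwise integral bound the other. *)
Lemma bdry_bound g a b c d (M : R) : ccont g -> a <= b -> c <= d -> 0 <= M ->
  (forall x y, a <= x <= b -> c <= y <= d -> modulus (g (x +i* y)) <= M) ->
  modulus (bdry g a b c d) <= 4 * (M * ((b - a) + (d - c))).
Proof.
move=> cg ab cd M0 gM.
have H y : c <= y <= d -> modulus (hseg g y a b) <= 2 * (M * (b - a)).
  by move=> yc; apply: cintegral_bound => //; [exact: ccont_h|move=> x xab; exact: gM].
have V x : a <= x <= b -> modulus ('i * vseg g x c d) <= 2 * (M * (d - c)).
  move=> xab; rewrite modulusM modulus_i mul1r.
  by apply: cintegral_bound => //; [exact: ccont_v|move=> y ycd; exact: gM].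
have H1 := H c; have H2 := H d; have V1 := V a; have V2 := V b.
rewrite !lexx ab cd in H1 H2 V1 V2.
apply: le_trans (ler_modulusB _ _) _; apply: le_trans (lerD (ler_modulusB _ _) (V1 isT)) _.
have := ler_modulusD (hseg g c a b) ('i * vseg g b c d).
have := H1 isT; have := H2 isT; have := V2 isT; lra.
Qed.

Lemma bdry_split g a m b c n d : ccont g -> a <= m -> m <= b -> c <= n -> n <= d ->
  bdry g a b c d = bdry g a m c n + bdry g m b c n + bdry g a m n d + bdry g m b n d.
Proof.
move=> cg am mb cn nd; rewrite /bdry /hseg /vseg.
rewrite (cintegral_split (ccont_h c cg) am mb) (cintegral_split (ccont_h d cg) am mb).
rewrite (cintegral_split (ccont_v a cg) cn nd) (cintegral_split (ccont_v b cg) cn nd).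
ring.
Qed.

(** Affine functions integrate to 0, so only the remainder counts: it is at most e times the
    half-perimeter, and the length of the path supplies a second factor of that size. *)
Lemma bdry_local g z D (e r : R) a b c d : ccont g -> 0 <= e ->
  a <= complex.Re z <= b -> c <= complex.Im z <= d -> (b - a) + (d - c) < r ->
  (forall h, modulus h < r -> modulus (g (z + h) - g z - D * h) <= e * modulus h) ->
  modulus (bdry g a b c d) <= 4 * e * ((b - a) + (d - c)) ^+ 2.
Proof.
move=> cg e0 za zc dr Hr.
have ab : a <= b by case/andP: za => *; lra.
have cd : c <= d by case/andP: zc => *; lra.
(* The affine approximation g z + D (w - z), arranged so that [bdry1] and [bdry_id] apply to its two
   terms. *)
pose lin w := (g z - D * z) * 1 + D * w.
have clin : ccont lin.
  have H : forall w, cdiff lin w D.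
    move=> w e' e'0; exists 1 => // h _.
    rewrite (_ : _ - _ = 0); last by rewrite /lin; ring.
    by rewrite modulus0 mulr_ge0 ?modulus_ge0// ltW.
  exact: cdiff_cont H.
pose rem w := g w + (-1) * lin w.
have gE : g = (fun w => rem w + lin w) by apply/funext => w; rewrite /rem; ring.
have cN : ccont (fun w => -1 * lin w).
  move=> w e' e'0; have [d' d'0 Hd] := clin w e' e'0; exists d' => // w' /Hd.
  by rewrite -mulrBr modulusM modulusN modulus1 mul1r.
have crem : ccont rem.
  move=> w e' e'0; have e20 : 0 < e' / 2 by lra.
  have [d1 d10 H1] := cg w _ e20; have [d2 d20 H2] := cN w _ e20.
  exists (Num.min d1 d2); first by rewrite lt_min d10.
  move=> w'; rewrite lt_min => /andP[/H1 A /H2 B].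
  rewrite (_ : rem w' - rem w = (g w' - g w) + (-1 * lin w' - -1 * lin w)); last first.
    by rewrite /rem; ring.
  apply: le_trans (ler_modulusD _ _) _; lra.
have -> : bdry g a b c d = bdry rem a b c d.
  rewrite [in LHS]gE bdryD// -[RHS]addr0; congr (_ + _); rewrite /lin.
  have ccst : ccont (fun=> (g z - D * z) * 1) by exact: ccont_cst.
  have cDid : ccont (fun w => D * w).
    apply: (@cdiff_cont _ _ (fun=> D)) => w e' e'0; exists 1 => // h _.
    by rewrite (_ : _ - _ = 0) ?modulus0 ?mulr_ge0 ?modulus_ge0 ?ltW//; ring.
  rewrite (bdryD _ _ _ _ ccst cDid) (bdryZ _ _ _ _ _ (ccont_cst 1)).
  by rewrite (bdryZ _ _ _ _ _ ccont_id) bdry1// bdry_id// !mulr0 addr0.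
rewrite (_ : 4 * e * _ = 4 * ((e * ((b - a) + (d - c))) * ((b - a) + (d - c)))); last by ring.
apply: bdry_bound => //; first by apply: mulr_ge0 => //; lra.
move=> x y xab ycd; set h := (x +i* y) - z.
have hm : modulus h <= (b - a) + (d - c).
  apply: le_trans (modulus_le_ReIm _) _; rewrite /h ReD ImD ReN ImN /=.
  move: xab ycd za zc => /andP[? ?] /andP[? ?] /andP[? ?] /andP[? ?].
  by apply: lerD; rewrite ler_norml; apply/andP; split; lra.
have zh : z + h = x +i* y by rewrite /h addrC subrK.
have := Hr h (le_lt_trans hm dr); rewrite zh => H.
rewrite (_ : rem _ = g (x +i* y) - g z - D * h); last by rewrite /rem /lin /h; ring.
by apply: le_trans H _; rewrite ler_wpM2l.
Qed.

End goursat.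

Section rectangle.
Variable R : realType.
Local Notation leb := (@lebesgue_measure R).
Variables (g dg : R[i] -> R[i]).
Hypothesis gdg : forall z, cdiff g z (dg z).
Let cg : ccont g := cdiff_cont gdg.

Section bisection.
Variables (w h : R) (w0 : 0 <= w) (h0 : 0 <= h).
Let Q n (x : R * R) := bdry g x.1 (x.1 + w / 2 ^+ n) x.2 (x.2 + h / 2 ^+ n).

Let half (v : R) n : v / 2 ^+ n = v / 2 ^+ n.+1 + v / 2 ^+ n.+1.
Proof.
have H : (2 : R) ^+ n != 0 by rewrite expf_neq0.
by rewrite exprS; field.
Qed.

(** If all four quarters fell below eta / 4^(n+1), the sum of their integrals, which is [Q n x],
    would have modulus below eta / 4^n. *)
Let bisect (eta : R) n (x : R * R) : eta / 4 ^+ n <= modulus (Q n x) ->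
  exists y : R * R, [/\ x.1 <= y.1, y.1 + w / 2 ^+ n.+1 <= x.1 + w / 2 ^+ n,
    x.2 <= y.2, y.2 + h / 2 ^+ n.+1 <= x.2 + h / 2 ^+ n &
    eta / 4 ^+ n.+1 <= modulus (Q n.+1 y)].
Proof.
move=> Hx; apply: contrapT => /forallNP HN.
set u := w / 2 ^+ n.+1; set v := h / 2 ^+ n.+1.
have u0 : 0 <= u by rewrite divr_ge0// exprn_ge0.
have v0 : 0 <= v by rewrite divr_ge0// exprn_ge0.
have N y : x.1 <= y.1 -> y.1 + u <= x.1 + (u + u) -> x.2 <= y.2 ->
    y.2 + v <= x.2 + (v + v) -> modulus (Q n.+1 y) < eta / 4 ^+ n.+1.
  move=> A B C E; rewrite ltNge; apply/negP => F; apply: (HN y).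
  by split => //; rewrite (half _ n).
move: Hx; apply/negP; rewrite -ltNge {1}/Q (half w n) (half h n) -/u -/v !addrA.
rewrite (@bdry_split _ _ _ (x.1 + u) _ _ (x.2 + v))//; try lra.
have lu : x.1 <= x.1 + u by rewrite lerDl.
have lv : x.2 <= x.2 + v by rewrite lerDl.
have ru : x.1 + u <= x.1 + (u + u) by rewrite lerD2l lerDl.
have rv : x.2 + v <= x.2 + (v + v) by rewrite lerD2l lerDl.
have ru' : x.1 + u + u <= x.1 + (u + u) by rewrite addrA.
have rv' : x.2 + v + v <= x.2 + (v + v) by rewrite addrA.
have N1 := N (x.1, x.2) (lexx _) ru (lexx _) rv.
have N2 := N (x.1 + u, x.2) lu ru' (lexx _) rv.
have N3 := N (x.1, x.2 + v) (lexx _) ru lv rv'.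
have N4 := N (x.1 + u, x.2 + v) lu ru' lv rv'.
rewrite /Q/= -/u -/v in N1 N2 N3 N4.
have -> : eta / 4 ^+ n = eta / 4 ^+ n.+1 + eta / 4 ^+ n.+1 + eta / 4 ^+ n.+1 + eta / 4 ^+ n.+1.
  have H : (4 : R) ^+ n != 0 by rewrite expf_neq0.
  by rewrite exprS; field.
apply: le_lt_trans (ler_modulusD _ _) _; apply: ltrD; last exact: N4.
apply: le_lt_trans (ler_modulusD _ _) _; apply: ltrD; last exact: N3.
apply: le_lt_trans (ler_modulusD _ _) _; apply: ltrD; last exact: N2.
exact: N1.
Qed.

(** The common point is the supremum of the left ends, since every right end bounds every left
    end. *)
Lemma nested_corner (s : R) (x : nat -> R) : 0 <= s -> (forall n, x n <= x n.+1) ->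
  (forall n, x n.+1 + s / 2 ^+ n.+1 <= x n + s / 2 ^+ n) ->
  exists l, forall n, x n <= l <= x n + s / 2 ^+ n.
Proof.
move=> s0 x1 x2.
have mx n k : x n <= x (n + k)%N.
  by elim: k => [|k IH]; rewrite ?addn0// addnS (le_trans IH).
have dx n k : x (n + k)%N + s / 2 ^+ (n + k)%N <= x n + s / 2 ^+ n.
  by elim: k => [|k IH]; rewrite ?addn0// addnS (le_trans (x2 _)).
have sn n : 0 <= s / 2 ^+ n by rewrite divr_ge0// exprn_ge0.
have ub m n : x m <= x n + s / 2 ^+ n.
  case: (leqP m n) => mn.
    by rewrite -(subnKC mn) (le_trans (mx m (n - m)%N))// lerDl.
  by rewrite -(subnKC (ltnW mn)) (le_trans _ (dx n (m - n)%N))// lerDl.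
exists (sup (range x)) => n; apply/andP; split.
  apply: ub_le_sup; last by exists n.
  by exists (x 0 + s / 2 ^+ 0) => _ [m _ <-]; exact: ub.
apply: ge_sup; first by exists (x 0); exists 0.
by move=> _ [m _ <-]; exact: ub.
Qed.

(** The bisected rectangles shrink to a point where g is differentiable. There [bdry_local] bounds
    the n-th integral by 4 e (w + h)^2 / 4^n, whereas it is at least eta / 4^n; the powers of 4
    cancel and e is arbitrary. *)
Lemma goursat_rect a c : bdry g a (a + w) c (c + h) = 0.
Proof.
apply/eqP; rewrite -modulus_eq0 eq_le modulus_ge0 andbT.
set eta := modulus _.
pose P (nx : nat * (R * R)) := eta / 4 ^+ nx.1 <= modulus (Q nx.1 nx.2).
have /boolp.choice[nxt nxtP] : forall nx : nat * (R * R), exists y, P nx ->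
   [/\ nx.2.1 <= y.1, y.1 + w / 2 ^+ nx.1.+1 <= nx.2.1 + w / 2 ^+ nx.1,
    nx.2.2 <= y.2, y.2 + h / 2 ^+ nx.1.+1 <= nx.2.2 + h / 2 ^+ nx.1 &
    eta / 4 ^+ nx.1.+1 <= modulus (Q nx.1.+1 y)].
  move=> [n x]; case: (pselect (P (n, x))) => [/bisect[y Hy]|NP]; first by exists y.
  by exists (0, 0).
pose x := fix x n := if n is m.+1 then nxt (m, x m) else (a, c).
have Px n : P (n, x n).
  elim: n => [|n IH]; last by case: (nxtP _ IH).
  by rewrite /P /Q /= !expr0 !divr1.
have xP n := nxtP _ (Px n).
have [l1 Hl1] : exists l, forall n, (x n).1 <= l <= (x n).1 + w / 2 ^+ n.
  by apply: nested_corner => // n; case: (xP n).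
have [l2 Hl2] : exists l, forall n, (x n).2 <= l <= (x n).2 + h / 2 ^+ n.
  by apply: nested_corner => // n; case: (xP n).
set T := w + h; have T0 : 0 <= T by rewrite addr_ge0.
suff H e : 0 < e -> eta <= 4 * e * T ^+ 2.
  apply/ler_addgt0Pr => e e0; rewrite add0r.
  have M0 : 0 < 4 * (T ^+ 2 + 1) by rewrite mulr_gt0// ltr_wpDl// sqr_ge0.
  apply: le_trans (H (e / (4 * (T ^+ 2 + 1))) (divr_gt0 e0 M0)) _.
  rewrite (_ : 4 * _ * _ = e * (4 * T ^+ 2 / (4 * (T ^+ 2 + 1)))); last first.
    by field; rewrite gt_eqF// ltr_wpDl// sqr_ge0.
  by rewrite ler_piMr ?(ltW e0)// ler_pdivrMr// mul1r ler_pM2l// lerDl.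
move=> e0; have [r r0 Hr] := gdg (l1 +i* l2) e0.
have [n Hn] : exists n, w / 2 ^+ n + h / 2 ^+ n < r.
  have [n Hn] : exists n : nat, T / r < n%:R.
    by exists (Num.truncn (T / r)).+1; exact: truncnS_gt.
  exists n; rewrite -mulrDl ltr_pdivrMr ?exprn_gt0// mulrC -ltr_pdivrMr//.
  apply: lt_le_trans Hn _; rewrite -natrX ler_nat; exact/ltnW/ltn_expl.
have := @bdry_local R g (l1 +i* l2) (dg (l1 +i* l2)) e r
  (x n).1 ((x n).1 + w / 2 ^+ n) (x n).2 ((x n).2 + h / 2 ^+ n) cg (ltW e0) (Hl1 n) (Hl2 n).
have -> : (x n).1 + w / 2 ^+ n - (x n).1 + ((x n).2 + h / 2 ^+ n - (x n).2) =
   T / 2 ^+ n by rewrite mulrDl; ring.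
rewrite {1}mulrDl => /(_ Hn Hr) HH.
have := le_trans (Px n) HH; rewrite /= expr_div_n -exprM mulnC exprM.
rewrite (_ : 2 ^+ 2 = 4 :> R); last by rewrite expr2; ring.
by rewrite mulrA ler_pM2r// invr_gt0 exprn_gt0.
Qed.

End bisection.

Lemma goursat a b c d : a <= b -> c <= d -> bdry g a b c d = 0.
Proof.
move=> ab cd; rewrite -(@goursat_rect (b - a) (d - c) _ _ a c) ?subr_ge0//.
by rewrite ![_ + (_ - _)]addrC !subrK.
Qed.

End rectangle.

Section cauchy.
Variable R : realType.
Local Notation leb := (@lebesgue_measure R).
Implicit Types (f g : R[i] -> R[i]) (z w : R[i]).

(* Circles around z are images of vertical segments under w |-> z + exp w, so
   Goursat's theorem for rectangles suffices for the Cauchy estimate. *)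
Let kern f z w := f (z + cexp w) * cexp (- w).

Lemma entire_cexpN : entire (fun w : R[i] => cexp (- w)).
Proof. exact: (entire_comp (@entire_cexp R) (entireN (@entire_id R))). Qed.

Lemma entire_kern f z : entire f -> entire (kern f z).
Proof.
move=> ef.
have e1 : entire (fun w => z + cexp w) := entireD (@entire_cst R z) (@entire_cexp R).
exact: (entireM (entire_comp ef e1) entire_cexpN).
Qed.

Lemma entire_ccont f : entire f -> ccont f.
Proof. by move=> /entire_cdiff[df /cdiff_cont]. Qed.

(** Moving the segment from abscissa 0 to u changes the radius of the circle from 1 to exp u. The
    horizontal sides of the Goursat rectangle cancel by the period 2 pi i of [cexp]. *)
Let kern_vseg f z u : entire f -> u <= 0 ->
  vseg (kern f z) 0 0 (pi *+ 2) = vseg (kern f z) u 0 (pi *+ 2).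
Proof.
move=> ef u0; have pi0 : 0 <= (pi *+ 2 : R) by rewrite mulrn_wge0// pi_ge0.
have [dk dkP] := entire_cdiff (@entire_kern f z ef).
have := goursat dkP u0 pi0; rewrite /bdry.
have -> : hseg (kern f z) (pi *+ 2) u 0 = hseg (kern f z) 0 u 0.
  rewrite /hseg; apply: eq_cintegral => x _; rewrite /kern !cexpN.
  have -> : x +i* (pi *+ 2) = (x +i* 0) + (0 +i* (pi *+ 2)).
    by apply: complexP => /=; rewrite ?addr0 ?add0r.
  by rewrite cexp_2pi.
set A := hseg _ _ _ _; move=> H; have : 'i * vseg (kern f z) 0 0 (pi *+ 2) = 'i * vseg (kern f z) u 0 (pi *+ 2).
  move: H; move: (vseg _ _ _ _) (vseg _ _ _ _) A => V V' A H.
  by apply/eqP; rewrite -subr_eq0 -[X in _ == X]H; apply/eqP; ring.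
apply: mulfI; rewrite -modulus_eq0 modulus_i; exact: oner_neq0.
Qed.

(** Moving the segment to abscissa v multiplies this integral by exp(-v), yet leaves it unchanged by
    Goursat's theorem when v <= 0; at v = -1 this forces it to vanish. *)
Let vseg_cexpN u : u <= 0 -> vseg (fun w => cexp (- w)) u 0 (pi *+ 2) = 0 :> R[i].
Proof.
have kE : kern (fun=> 1) 0 = (fun w : R[i] => cexp (- w)).
  by apply/funext => w; rewrite /kern mul1r.
have cc : ccont (fun w : R[i] => cexp (- w)).
  by rewrite -kE; apply/entire_ccont/entire_kern; exact: entire_cst.
have H v : v <= 0 -> vseg (fun w : R[i] => cexp (- w)) 0 0 (pi *+ 2) =
    vseg (fun w => cexp (- w)) v 0 (pi *+ 2).
  by move=> v0; have := @kern_vseg (fun=> 1) 0 v (@entire_cst R 1) v0; rewrite kE.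
have S v : vseg (fun w : R[i] => cexp (- w)) v 0 (pi *+ 2) =
    (expR (- v))%:C * vseg (fun w => cexp (- w)) 0 0 (pi *+ 2).
  rewrite /vseg -cintegralZ//; last exact/rcont_cintegrable/(ccont_v 0 cc).
  apply: eq_cintegral => y _ /=.
  have -> : - (v +i* y) = (- v)%:C + - (0 +i* y).
    by apply: complexP => /=; ring.
  rewrite cexpD; congr (_ * _); rewrite /cexp /= cos0 sin0; apply: complexP => /=; ring.
move=> u0; rewrite -H//.
have := H (- 1) (lerN10 _); rewrite (S (- 1)) opprK => /eqP.
rewrite -{1}[vseg _ _ _ _]mul1r -subr_eq0 -mulrBl mulf_eq0 => /orP[|/eqP//].
rewrite subr_eq0 => /eqP/complexI/esym/eqP.
by rewrite gt_eqF// expR_gt1.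
Qed.

(** Under zeta = z + exp w, the integral of [kern] is that of f(zeta) / (zeta - z)^2 over a circle,
    up to the factor ['i]. On a small circle it is close to 2 pi D, on the unit circle its modulus
    is at most 2 M times 2 pi, and both circles give the same value. *)
Lemma cauchy_bound f D z (M : R) : entire f -> cdiff f z D ->
  (forall h, modulus h <= 1 -> modulus (f (z + h)) <= M) -> modulus D <= 2 * M.
Proof.
move=> ef fD fM.
apply/ler_addgt0Pr => e' e'0; set e := e' / 2; have e0 : 0 < e by rewrite divr_gt0.
have [d d0 Hd] := fD e e0.
(* The radius exp u is below d, where the difference quotient is controlled; u <= 0 makes [u, 0] a
   genuine side for Goursat's theorem. *)
set u := Num.min 0 (ln (d / 2)).
have u0 : u <= 0 by rewrite ge_min lexx.
have ud : expR u < d.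
  apply: (@le_lt_trans _ _ (d / 2)); last by rewrite ltr_pdivrMr// mulr2n mulrDr mulr1 ltrDl.
  by rewrite -[leRHS]lnK ?posrE ?divr_gt0// ler_expR ge_min lexx orbT.
have pi0 : 0 < (pi *+ 2 : R) by rewrite mulrn_wgt0// pi_gt0.
have ck : ccont (kern f z) by exact/entire_ccont/entire_kern.
have H1 : modulus (vseg (kern f z) 0 0 (pi *+ 2)) <= 2 * (M * (pi *+ 2)).
  rewrite -[pi *+ 2 in leRHS]subr0; apply: cintegral_bound; [exact: ccont_v|exact: ltW|].
  move=> y _; rewrite /kern modulusM !modulus_cexp ReN /= oppr0 expR0 mulr1.
  by apply: fM; rewrite modulus_cexp /= expR0.
pose rem w := kern f z w - (f z * cexp (- w) + D).
have ccN : ccont (fun w : R[i] => cexp (- w)).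
  exact: (entire_ccont entire_cexpN).
have eB : entire (fun w => f z * cexp (- w) + D).
  exact: (entireD (entireM (@entire_cst R (f z)) entire_cexpN) (@entire_cst R D)).
have erem : entire rem by exact: (entireD (@entire_kern f z ef) (entireN eB)).
have H2 : modulus (vseg rem u 0 (pi *+ 2)) <= 2 * (e * (pi *+ 2)).
  rewrite -[pi *+ 2 in leRHS]subr0; apply: cintegral_bound.
  - exact/ccont_v/entire_ccont.
  - exact: ltW.
  move=> y _; rewrite /rem /kern; set c := u +i* y.
  have c0 : cexp c != 0 by rewrite -modulus_eq0 modulus_cexp gt_eqF ?expR_gt0.
  have -> : f (z + cexp c) * cexp (- c) - (f z * cexp (- c) + D) =
     (f (z + cexp c) - f z - D * cexp c) * cexp (- c).
    by rewrite cexpN; field.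
  rewrite modulusM; have := Hd (cexp c); rewrite [modulus (cexp c)]modulus_cexp => /(_ ud) H.
  apply: le_trans (ler_wpM2r (modulus_ge0 _) H) _.
  by rewrite modulus_cexp ReN /= -mulrA -expRD subrr expR0 mulr1.
have E : vseg (kern f z) u 0 (pi *+ 2) = D * (pi *+ 2)%:C + vseg rem u 0 (pi *+ 2).
  have -> : kern f z = fun w => (f z * cexp (- w) + D) + rem w.
    by apply/funext => w; rewrite /rem addrC subrK.
  have mI : measurable (`[0, pi *+ 2]%classic : set (measurableTypeR R)) by exact: measurable_itv.
  have I1 := rcont_cintegrable 0 (pi *+ 2) (ccont_v u ccN).
  have I2 := cintegrableZ mI (f z) I1.
  have I3 := rcont_cintegrable 0 (pi *+ 2) (ccont_v u (ccont_cst D)).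
  have I4 := rcont_cintegrable 0 (pi *+ 2) (ccont_v u (entire_ccont eB)).
  have I5 := rcont_cintegrable 0 (pi *+ 2) (ccont_v u (entire_ccont erem)).
  rewrite /vseg (cintegralD mI I4 I5).
  rewrite (cintegralD mI I2 I3) (cintegralZ mI (f z) I1).
  by rewrite [X in f z * X](vseg_cexpN u0) mulr0 add0r cintegral_cst ?subr0 ?(ltW pi0).
have : modulus (D * (pi *+ 2)%:C) <= 2 * (M * (pi *+ 2)) + 2 * (e * (pi *+ 2)).
  have -> : D * (pi *+ 2)%:C = vseg (kern f z) u 0 (pi *+ 2) - vseg rem u 0 (pi *+ 2).
    by rewrite E addrK.
  apply: le_trans (ler_modulusB _ _) _; apply: lerD; last exact: H2.
  by rewrite -(@kern_vseg f z u ef u0); exact: H1.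
rewrite modulusM modulus_real gtr0_norm// !mulrA -mulrDl ler_pM2r// /e.
lra.
Qed.

End cauchy.

(** * Bounds, Lipschitz and Taylor estimates that are uniform on discs *)

Section estimates.
Variable R : realType.
Implicit Types (f g : R[i] -> R[i]) (z w : R[i]).

Lemma ccont_modulus2 f : ccont f ->
  continuous (fun p : R * R => modulus (f (p.1 +i* p.2))).
Proof.
move=> cf [x y]; apply/cvgrPdist_le => e e0 /=.
have [d d0 Hd] := cf (x +i* y) e e0.
exists (ball x (d / 2), ball y (d / 2)).
  by split; apply: nbhsx_ballx; rewrite divr_gt0.
move=> [x' y'] [/= xx' yy'].
have {}Hd := Hd (x' +i* y').
have xx : `|x' - x| < d / 2 by rewrite distrC.
have yy : `|y' - y| < d / 2 by rewrite distrC.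
have H : modulus (x' +i* y' - x +i* y) < d.
  apply: le_lt_trans (modulus_le_ReIm _) _; rewrite ReD ImD ReN ImN /=.
  by rewrite (splitr d) ltrD.
apply: le_trans (Hd H); rewrite ler_norml; apply/andP; split.
  rewrite lerNl opprB lerBlDr; have := ler_modulusD (f (x' +i* y') - f (x +i* y)) (f (x +i* y)).
  by rewrite subrK.
rewrite lerBlDr modulusBC; have := ler_modulusD (f (x +i* y) - f (x' +i* y')) (f (x' +i* y')).
by rewrite subrK.
Qed.

Lemma ccont_bounded f (rho : R) : ccont f -> exists2 M : R, 0 <= M &
  forall z, modulus z <= rho -> modulus (f z) <= M.
Proof.
move=> cf; have [r0|r0] := ltP rho 0.
  by exists 0 => // z /le_lt_trans/(_ r0); rewrite ltNge modulus_ge0.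
have A0 : (`[- rho, rho] `*` `[- rho, rho] : set (R * R)) !=set0.
  by exists (0, 0); split; rewrite /= in_itv/= oppr_le0 r0.
have cA : compact (`[- rho, rho] `*` `[- rho, rho] : set (R * R)).
  by apply: compact_setX; exact: segment_compact.
have cc : {within (`[- rho, rho] `*` `[- rho, rho] : set (R * R)),
    continuous (fun p : R * R => modulus (f (p.1 +i* p.2)))}.
  exact/continuous_subspaceT/ccont_modulus2.
have [c _ Hc] := compact_EVT_max A0 cA cc.
exists (modulus (f (c.1 +i* c.2))); first exact: modulus_ge0.
move=> [x y] zr; apply: (Hc (x, y)); rewrite inE; split; rewrite /= in_itv/= -ler_norml.
  exact: le_trans (normr_Re_le _) zr.
exact: le_trans (normr_Im_le _) zr.
Qed.

Lemma is_derive_line f df z k (t : R) : cdiff f (z + t%:C * k) df ->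
  is_derive t 1 (fun s : R => complex.Re (f (z + s%:C * k))) (complex.Re (df * k)) /\
  is_derive t 1 (fun s : R => complex.Im (f (z + s%:C * k))) (complex.Im (df * k)).
Proof.
move=> H; set K := modulus k + 1.
have K0 : 0 < K by rewrite ltr_wpDl// modulus_ge0.
have main (e : R) : 0 < e -> exists2 d : R, 0 < d & forall h, `|h| < d ->
   modulus (f (z + (t + h)%:C * k) - f (z + t%:C * k) - df * k * h%:C) <= e * `|h|.
  move=> e0; have [d d0 Hd] := H _ (divr_gt0 e0 K0).
  exists (d / K); first exact: divr_gt0.
  move=> h hd; have := Hd (h%:C * k); rewrite modulusM modulus_real.
  have hk : `|h| * modulus k <= `|h| * K by rewrite ler_wpM2l// lerDl.
  move=> /(_ (le_lt_trans hk _)); rewrite -ltr_pdivlMr// => /(_ hd).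
  rewrite (_ : z + t%:C * k + h%:C * k = z + (t + h)%:C * k); last by rewrite rmorphD/=; ring.
  rewrite (_ : df * (h%:C * k) = df * k * h%:C); last by ring.
  move=> /le_trans; apply; apply: le_trans (ler_wpM2l _ hk) _; first by rewrite divr_ge0// ltW.
  by rewrite mulrCA -[_ * K]mulrA mulVf ?gt_eqF// mulr1 mulrC.
split; apply/is_derive_epsP => e e0; have [d d0 Hd] := main e e0; exists d => // h hd.
- apply: le_trans (Hd h hd); apply: le_trans (normr_Re_le _).
  by rewrite !ReD !ReN [in leRHS]ReM /= mulr0 subr0.
- apply: le_trans (Hd h hd); apply: le_trans (normr_Im_le _).
  by rewrite !ImD !ImN [in leRHS]ImM /= mulr0 add0r.
Qed.

(** The real mean value theorem is applied to the two components, with unrelated intermediate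
    points, whence the factor 2. *)
Lemma mean_value f df z k (M : R) : (forall w, cdiff f w (df w)) ->
  (forall t : R, 0 <= t <= 1 -> modulus (df (z + t%:C * k)) <= M) ->
  modulus (f (z + k) - f z) <= 2 * M * modulus k.
Proof.
move=> fdf dM.
have H t := is_derive_line (fdf (z + t%:C * k)).
have cR : continuous (fun s : R => complex.Re (f (z + s%:C * k))).
  move=> t; apply/differentiable_continuous/derivable1_diffP; by case: (H t).1.
have cI : continuous (fun s : R => complex.Im (f (z + s%:C * k))).
  move=> t; apply/differentiable_continuous/derivable1_diffP; by case: (H t).2.
have [c cI1 Ec] := MVT_segment ler01 (fun x _ => (H x).1) (continuous_subspaceT cR).
have [c' cI1' Ec'] := MVT_segment ler01 (fun x _ => (H x).2) (continuous_subspaceT cI).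
move: Ec Ec'; rewrite rmorph1 rmorph0 mul1r mul0r addr0 subr0 !mulr1 => Ec Ec'.
apply: le_trans (modulus_le_ReIm _) _; rewrite ReD ImD ReN ImN Ec Ec'.
rewrite mulrDl mul1r mulrDl; apply: lerD.
  apply: le_trans (normr_Re_le _) _; rewrite modulusM ler_wpM2r ?modulus_ge0//.
  by apply: dM; move: cI1; rewrite in_itv.
apply: le_trans (normr_Im_le _) _; rewrite modulusM ler_wpM2r ?modulus_ge0//.
by apply: dM; move: cI1'; rewrite in_itv.
Qed.

Lemma modulus_segment z k (t rho : R) : 0 <= t <= 1 -> modulus z <= rho ->
  modulus (z + k) <= rho -> modulus (z + t%:C * k) <= rho.
Proof.
move=> /andP[t0 t1] zr zkr.
have -> : z + t%:C * k = (1 - t)%:C * z + t%:C * (z + k).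
  by rewrite rmorphB rmorph1; ring.
apply: le_trans (ler_modulusD _ _) _; rewrite !modulusM !modulus_real.
rewrite !ger0_norm ?subr_ge0//.
have A : (1 - t) * modulus z <= (1 - t) * rho by rewrite ler_wpM2l// subr_ge0.
have B : t * modulus (z + k) <= t * rho by rewrite ler_wpM2l.
lra.
Qed.

Lemma deriv_bounded f df (rho : R) : (forall w, cdiff f w (df w)) ->
  exists2 M : R, 0 <= M & forall z, modulus z <= rho -> modulus (df z) <= M.
Proof.
move=> fdf; have [M M0 HM] := ccont_bounded (rho + 1) (cdiff_cont fdf).
exists (2 * M); first by rewrite mulr_ge0.
move=> z zr; apply: (cauchy_bound (cdiff_entire fdf) (fdf z)) => h h1.
by apply: HM; apply: le_trans (ler_modulusD _ _) _; rewrite lerD.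
Qed.

Lemma entire_lip f df (rho : R) : (forall w, cdiff f w (df w)) ->
  exists2 L : R, 0 <= L & forall z k, modulus z <= rho -> modulus (z + k) <= rho ->
  modulus (f (z + k) - f z) <= L * modulus k.
Proof.
move=> fdf; have [M M0 HM] := deriv_bounded rho fdf.
exists (2 * M); first by rewrite mulr_ge0.
move=> z k zr zkr; apply: (mean_value fdf) => t t01.
by apply: HM; exact: modulus_segment.
Qed.

(** The Cauchy estimate is applied to w |-> f(w + h) - f(w), which is at most L |h| on the unit disc
    about z. The radius rho + 2 leaves room for h and for that disc. *)
Lemma deriv_lip f df (rho : R) : (forall w, cdiff f w (df w)) ->
  exists2 L : R, 0 <= L & forall z h, modulus z <= rho -> modulus h <= 1 ->
  modulus (df (z + h) - df z) <= L * modulus h.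
Proof.
move=> fdf; have [L L0 HL] := entire_lip (rho + 2) fdf.
exists (2 * L); first by rewrite mulr_ge0.
move=> z h zr h1; rewrite -mulrA.
have fdfh w : cdiff (fun w => f (w + h) - f w) w (df (w + h) - df w).
  move=> e e0; have e20 : 0 < e / 2 by lra.
  have [d1 d10 H1] := fdf (w + h) _ e20; have [d2 d20 H2] := fdf w _ e20.
  exists (Num.min d1 d2); first by rewrite lt_min d10.
  move=> k; rewrite lt_min => /andP[/H1 A /H2 B].
  rewrite (_ : _ - _ = (f (w + h + k) - f (w + h) - df (w + h) * k) -
      (f (w + k) - f w - df w * k)); last by rewrite (addrAC w k h); ring.
  apply: le_trans (ler_modulusB _ _) _; lra.
apply: (cauchy_bound (cdiff_entire fdfh) (fdfh z)) => k k1.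
apply: HL.
  by apply: le_trans (ler_modulusD _ _) _; lra.
apply: le_trans (ler_modulusD _ _) _.
have := ler_modulusD z k; lra.
Qed.

Lemma deriv_ccont f df : (forall w, cdiff f w (df w)) -> ccont df.
Proof.
move=> fdf z e e0; have [L L0 HL] := deriv_lip (modulus z) fdf.
have L1 : 0 < L + 1 by lra.
exists (Num.min 1 (e / (L + 1))); first by rewrite lt_min ltr01 divr_gt0.
move=> w; rewrite lt_min => /andP[w1 w2].
have := HL z (w - z) (lexx _) (ltW w1); rewrite [z + _]addrC subrK => /le_trans; apply.
move: w2; rewrite ltr_pdivlMr// => /ltW; apply: le_trans.
by rewrite mulrC ler_wpM2l ?modulus_ge0// lerDl.
Qed.

(** The mean value inequality for w |-> f(w) - f'(z) w, whose derivative is at most a multiple of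
    |h| on the segment from z to z + h. One constant serves all z in the disc, as integration over t
    requires. *)
Lemma entire_taylor f df (rho : R) : (forall w, cdiff f w (df w)) ->
  exists2 L : R, 0 <= L & forall z h, modulus z <= rho -> modulus h <= 1 ->
  modulus (f (z + h) - f z - df z * h) <= L * modulus h ^+ 2.
Proof.
move=> fdf; have [L L0 HL] := deriv_lip rho fdf.
exists (2 * L); first by rewrite mulr_ge0.
move=> z h zr h1.
have dG w : cdiff (fun w => f w - df z * w) w (df w - df z).
  move=> e e0; have [d d0 Hd] := fdf w e e0; exists d => // k /Hd.
  by congr (modulus _ <= _); ring.
have := @mean_value _ _ z h (L * modulus h) dG.
rewrite (_ : f (z + h) - df z * (z + h) - (f z - df z * z) = f (z + h) - f z - df z * h); last by ring.
rewrite expr2 !mulrA; apply => t t01.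
have /andP[t0 t1] := t01.
have tm : modulus (t%:C * h) <= modulus h.
  by rewrite modulusM modulus_real ger0_norm// ler_piMl ?modulus_ge0.
apply: le_trans (HL z (t%:C * h) zr (le_trans tm h1)) _.
by rewrite ler_wpM2l.
Qed.

End estimates.

(** * Measurability and holomorphy of the operator *)

Section joint_measurability.
Variable R : realType.
Local Notation MR := (measurableTypeR R).

(** Inversion is continuous off 0; the point 0, where its value is a default, is split off as a
    measurable singleton. *)
Lemma measurable_inv_fun : measurable_fun [set: MR] (fun x : MR => (x : R)^-1 : MR).
Proof.
have -> : [set: MR] = [set~ 0] `|` [set 0] by rewrite setUC setUv.
apply/measurable_funU; rewrite ?setTU//; first exact: measurableC.
split; last exact: measurable_fun_set1.
apply: open_continuous_measurable_fun; first exact/closed_openC/closed_eq.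
by move=> x; rewrite inE => /eqP x0; exact: inv_continuous.
Qed.

(** Round the first coordinate down to a multiple of 1 / (n + 1). The rounded function is
    measurable, being glued from countably many strips, and continuity in the first variable gives
    pointwise convergence. *)
Lemma measurable_Caratheodory d (T : measurableType d) (f : MR * T -> MR) :
  (forall t, continuous (fun x : R => f (x, t) : R)) ->
  (forall x, measurable_fun [set: T] (fun t => f (x, t))) ->
  measurable_fun [set: MR * T] f.
Proof.
move=> cf mf.
pose fl n (x : R) : R := (Num.floor (x * n.+1%:R))%:~R / n.+1%:R.
have flP n x : fl n x <= x < fl n x + n.+1%:R^-1.
  have /andP[h1 h2] := floor_itv (x * n.+1%:R).
  rewrite /fl ler_pdivrMr// h1/= -ltr_pdivlMr// in h2 *.
  by move: h2; rewrite intrD mulrDl mul1r.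
apply: (measurable_fun_cvg (h := fun n p => f (fl n p.1, p.2))).
- move=> n _ B mB; rewrite setTI.
  have -> : (fun p => f (fl n p.1, p.2)) @^-1` B =
    \bigcup_(k : int) (`[k%:~R / n.+1%:R, (k + 1)%:~R / n.+1%:R[%classic `*`
       ((fun t => f (k%:~R / n.+1%:R, t)) @^-1` B)).
    apply/seteqP; split => [[x t] /= H|[x t] [k _ [/= xk H]]].
      exists (Num.floor (x * n.+1%:R)) => //; split => //=.
      rewrite in_itv/= ler_pdivrMr// ltr_pdivlMr//; exact: floor_itv.
    rewrite /fl (@floor_def _ _ k)//.
    by move: xk; rewrite in_itv/= ler_pdivrMr// ltr_pdivlMr.
  apply: countable_bigcupT_measurable => // k; apply: measurableX.
    exact: measurable_itv.
  by rewrite -[X in measurable X]setTI; exact: mf.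
- move=> [x t] _ /=.
  have cfl : fl n x @[n --> \oo] --> x.
    apply/cvgrPdist_lt => e e0; near=> n.
    have /andP[h1 h2] := flP n x.
    rewrite ger0_norm ?subr_ge0// ltrBlDl (lt_trans h2)// ltrD2l.
    near: n; exact: (near_infty_natSinv_lt (PosNum e0)).
  exact: (cvg_comp (fl ^~ x) (fun y : R => f (y, t) : R) cfl (cf t x)).
Unshelve. all: by end_near. Qed.

Lemma measurable_ccont (f : R[i] -> R[i]) : ccont f ->
  measurable_fun [set: MR * MR] (fun p : MR * MR => complex.Re (f (p.1 +i* p.2)) : MR) /\
  measurable_fun [set: MR * MR] (fun p : MR * MR => complex.Im (f (p.1 +i* p.2)) : MR).
Proof.
move=> cf; split; apply: measurable_Caratheodory => /=.
- by move=> t; case: (ccont_h t cf).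
- by move=> x; apply: continuous_measurable_fun; case: (ccont_v x cf).
- by move=> t; case: (ccont_h t cf).
- by move=> x; apply: continuous_measurable_fun; case: (ccont_v x cf).
Qed.

Lemma measurable_scale_comp (f : R[i] -> R[i]) : ccont f ->
  measurable_fun [set: (MR * MR) * MR]
    (fun p : (MR * MR) * MR => complex.Re (f ((p.1.1 +i* p.1.2) / (p.2 : R)%:C) / (p.2 : R)%:C) : MR) /\
  measurable_fun [set: (MR * MR) * MR]
    (fun p : (MR * MR) * MR => complex.Im (f ((p.1.1 +i* p.1.2) / (p.2 : R)%:C) / (p.2 : R)%:C) : MR).
Proof.
move=> cf; have [mr mi] := measurable_ccont cf.
have mv : measurable_fun [set: (MR * MR) * MR] (fun p : (MR * MR) * MR => (p.2 : R)^-1 : MR).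
  by apply: (measurableT_comp measurable_inv_fun); exact: measurable_snd.
have mx : measurable_fun [set: (MR * MR) * MR] (fun p : (MR * MR) * MR => p.1.1 : MR).
  by apply: measurableT_comp; [exact: measurable_fst|exact: measurable_fst].
have my : measurable_fun [set: (MR * MR) * MR] (fun p : (MR * MR) * MR => p.1.2 : MR).
  by apply: measurableT_comp; [exact: measurable_snd|exact: measurable_fst].
pose s (p : (MR * MR) * MR) : MR * MR := (p.1.1 * (p.2 : R)^-1, p.1.2 * (p.2 : R)^-1).
have ms : measurable_fun [set: (MR * MR) * MR] s.
  by apply: measurable_fun_pair; apply: measurable_funM.
have sE p : (p.1.1 +i* p.1.2) / (p.2 : R)%:C = (s p).1 +i* (s p).2.
  by rewrite -fmorphV; apply: complexP => /=; ring.
split.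
- rewrite (_ : (fun p => _) = fun p => complex.Re (f ((s p).1 +i* (s p).2)) * (p.2 : R)^-1).
    by apply: measurable_funM => //; exact: (measurableT_comp mr ms).
  by apply/funext => p; rewrite sE -fmorphV ReM /= mulr0 subr0.
- rewrite (_ : (fun p => _) = fun p => complex.Im (f ((s p).1 +i* (s p).2)) * (p.2 : R)^-1).
    by apply: measurable_funM => //; exact: (measurableT_comp mi ms).
  by apply/funext => p; rewrite sE -fmorphV ImM /= mulr0 add0r.
Qed.

Lemma measurable_hausdorff_integrand (f : R[i] -> R[i]) z : ccont f ->
  measurable_fun [set: MR] (fun t => complex.Re (hausdorff_integrand f z t) : MR) /\
  measurable_fun [set: MR] (fun t => complex.Im (hausdorff_integrand f z t) : MR).
Proof.
case: z => x y cf; have [mr mi] := measurable_scale_comp cf.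
by split; [exact: (measurableT_comp mr (pair1_measurable (x, y)))
          |exact: (measurableT_comp mi (pair1_measurable (x, y)))].
Qed.

End joint_measurability.

(** * Differentiation under the Hausdorff integral *)

Section hausdorff_entire.
Variable R : realType.
Local Notation MR := (measurableTypeR R).
Variable mu : {measure set MR -> \bar R}.
Local Notation D0 := (`]0%R, +oo[%classic : set MR).
Local Notation D1 := (`]1%R, +oo[%classic : set MR).

Hypothesis mu01 : mu (`]0%R, 1%R]%classic : set MR) = 0%E.
Hypothesis mu_inv : (\int[mu]_(t in D1) ((t : R)^-1)%:E < +oo)%E.

Let mD0 : measurable D0. Proof. exact: measurable_itv. Qed.
Let mD1 : measurable D1. Proof. exact: measurable_itv. Qed.
Let mN : measurable (`]0%R, 1%R]%classic : set MR). Proof. exact: measurable_itv. Qed.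

Let D0N : D0 `\` (`]0%R, 1%R]%classic : set MR) = D1.
Proof.
apply/seteqP; split => t /=; rewrite !in_itv/= !andbT.
  by move=> [t0]; rewrite t0/= ltNge => /negP.
by move=> t1; split; [exact: lt_trans t1|rewrite leNgt t1 andbF].
Qed.

Lemma cintegrable_D1 h : measurable_fun D0 (fun t => complex.Re (h t) : MR) ->
  measurable_fun D0 (fun t => complex.Im (h t) : MR) ->
  cintegrable mu D0 h <-> cintegrable mu D1 h.
Proof.
move=> mr mi; rewrite /cintegrable.
rewrite [X in X /\ _](negligible_integrable mN _ _ mu01)//; last exact/measurable_EFinP.
rewrite [X in _ /\ X](negligible_integrable mN _ _ mu01)//; last exact/measurable_EFinP.
by rewrite D0N.
Qed.

Lemma cintegral_D1 h : cintegrable mu D0 h -> cintegral mu D0 h = cintegral mu D1 h.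
Proof.
move=> [hr hi]; apply: complexP; rewrite /= /Rintegral.
  by rewrite (negligible_integral mN mD0 hr mu01) D0N.
by rewrite (negligible_integral mN mD0 hi mu01) D0N.
Qed.

Lemma measurable_integrand (f : R[i] -> R[i]) z (D : set MR) : ccont f ->
  measurable_fun D (fun t => complex.Re (hausdorff_integrand f z t) : MR) /\
  measurable_fun D (fun t => complex.Im (hausdorff_integrand f z t) : MR).
Proof.
move=> cf; have [mr mi] := measurable_hausdorff_integrand z cf.
by split; exact: measurable_funTS.
Qed.

Lemma measurable_inv (D : set MR) : measurable_fun D (fun t : MR => ((t : R)^-1)%:E).
Proof. by apply/measurable_EFinP/measurable_funTS; exact: measurable_inv_fun. Qed.

Lemma D1P (t : MR) : D1 t -> 1 < (t : R).
Proof. by rewrite /= in_itv/= andbT. Qed.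

Lemma modulus_scale (z : R[i]) (t : R) : 1 < t -> modulus (z / t%:C) <= modulus z.
Proof.
move=> t1; have t0 : 0 < t by apply: lt_trans t1.
rewrite modulusM modulusV modulus_real gtr0_norm// ler_piMr ?modulus_ge0//.
by rewrite invf_le1// ltW.
Qed.

(** For t > 1 the point z / t stays in the disc of radius |z|, where f is bounded, so a multiple of
    1 / t is an integrable majorant. *)
Lemma cintegrable_integrand1 (f : R[i] -> R[i]) z : ccont f ->
  cintegrable mu D1 (hausdorff_integrand f z).
Proof.
move=> cf; have [M M0 HM] := ccont_bounded (modulus z) cf.
have [mr mi] := measurable_integrand z D1 cf.
apply: (le_cintegrable mD1 mr mi (g := fun t => (M%:E * ((t : R)^-1)%:E)%E)).
- by apply: emeasurable_funM => //; exact: measurable_inv.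
- move=> t /D1P t1; have t0 : 0 < (t : R) by apply: lt_trans t1.
  rewrite /hausdorff_integrand modulusM modulusV modulus_real gtr0_norm// -EFinM lee_fin.
  by rewrite ler_wpM2r ?invr_ge0 ?(ltW t0)//; apply/HM/modulus_scale.
- rewrite ge0_integralZl//; first by rewrite lte_mul_pinfty ?lee_fin.
    exact: measurable_inv.
  by move=> t /D1P t1; rewrite lee_fin invr_ge0 ltW// (lt_trans _ t1).
Qed.

Lemma cintegrable_integrand (f : R[i] -> R[i]) z : ccont f ->
  cintegrable mu D0 (hausdorff_integrand f z).
Proof.
move=> cf; have [mr mi] := measurable_integrand z D0 cf.
by apply/cintegrable_D1 => //; exact: cintegrable_integrand1.
Qed.

Lemma hausdorffE (f : R[i] -> R[i]) z : ccont f ->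
  hausdorff mu f z = cintegral mu D1 (hausdorff_integrand f z).
Proof. by move=> cf; exact/cintegral_D1/cintegrable_integrand. Qed.

(** The derivative is the integral of f'(z / t) / t^2. For t > 1 the Taylor remainder at z / t with
    increment h / t is at most L |h|^2, so after division by t it is dominated by the integrable 1 /
    t. *)
Lemma hausdorff_entire (f : R[i] -> R[i]) : entire f -> entire (hausdorff mu f).
Proof.
move=> ef; have [df fdf] := entire_cdiff ef.
have cf := cdiff_cont fdf; have cdf := deriv_ccont fdf.
pose A := fine (\int[mu]_(t in D1) ((t : R)^-1)%:E)%E.
have inv0 t : D1 t -> (0 <= ((t : R)^-1)%:E)%E.
  by move=> /D1P t1; rewrite lee_fin invr_ge0 ltW// (lt_trans _ t1).
have AE : (\int[mu]_(t in D1) ((t : R)^-1)%:E)%E = A%:E.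
  rewrite /A fineK// ge0_fin_numE// integral_ge0//.
have A0 : 0 <= A by rewrite fine_ge0// integral_ge0.
pose dh z (t : MR) : R[i] := df (z / (t : R)%:C) / (t : R)%:C / (t : R)%:C.
have idh z : cintegrable mu D1 (dh z).
  have [M M0 HM] := ccont_bounded (modulus z) cdf.
  have [mr mi] := measurable_integrand z D1 cdf.
  apply: (@le_cintegrable _ _ _ mu _ mD1 _ (fun t => (M%:E * ((t : R)^-1)%:E)%E)).
  - rewrite (_ : (fun t => _) = fun t : MR => complex.Re (hausdorff_integrand df z t) * (t : R)^-1).
      by apply: measurable_funM => //; apply/measurable_funTS; exact: measurable_inv_fun.
    by apply/funext => t; rewrite /dh -!fmorphV [LHS]ReM /= mulr0 subr0 /hausdorff_integrand fmorphV.
  - rewrite (_ : (fun t => _) = fun t : MR => complex.Im (hausdorff_integrand df z t) * (t : R)^-1).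
      by apply: measurable_funM => //; apply/measurable_funTS; exact: measurable_inv_fun.
    by apply/funext => t; rewrite /dh -!fmorphV [LHS]ImM /= mulr0 add0r /hausdorff_integrand fmorphV.
  - by apply: emeasurable_funM => //; exact: measurable_inv.
  - move=> t /D1P t1; have t0 : 0 < (t : R) by apply: lt_trans t1.
    rewrite /dh modulusM modulusM modulusV modulus_real gtr0_norm// -EFinM lee_fin.
    rewrite -[leRHS]mulr1; apply: ler_pM; rewrite ?mulr_ge0 ?modulus_ge0 ?invr_ge0 ?(ltW t0)//.
      by rewrite ler_wpM2r ?invr_ge0 ?(ltW t0)//; apply/HM/modulus_scale.
    by rewrite invf_le1// ltW.
  - rewrite ge0_integralZl//; first by rewrite lte_mul_pinfty ?lee_fin.
    exact: measurable_inv.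
apply: (cdiff_entire (df := fun z => cintegral mu D1 (dh z))) => z e e0.
have [L L0 HL] := entire_taylor (modulus z) fdf.
(* The 2 comes from [le_modulus_cintegral], L from the Taylor estimate and A from the integral of 1
   / t; the 1 makes K positive. *)
pose K := 2 * (L * A) + 1.
have K0 : 0 < K by rewrite ltr_wpDl// !mulr_ge0.
exists (Num.min 1 (e / K)); first by rewrite lt_min ltr01 divr_gt0.
move=> h; rewrite lt_min => /andP[h1 hK].
rewrite !hausdorffE// mulrC -cintegralZ//.
have i1 := cintegrable_integrand1 (z + h) cf; have i2 := cintegrable_integrand1 z cf.
have i3 := cintegrableZ mD1 h (idh z).
rewrite -(cintegralB mD1 i1 i2).
have i12 := cintegrableB mD1 i1 i2.
rewrite -(cintegralB mD1 i12 i3).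
have i123 := cintegrableB mD1 i12 i3.
rewrite -lee_fin.
apply: le_trans (le_modulus_cintegral mD1 i123
  (g := fun t => ((L * modulus h ^+ 2)%:E * ((t : R)^-1)%:E)%E) _ _) _.
- by apply: emeasurable_funM => //; exact: measurable_inv.
- move=> t /D1P t1; have t0 : 0 < (t : R) by apply: lt_trans t1.
  rewrite /hausdorff_integrand /dh.
  rewrite (_ : _ - _ = (f (z / t%:C + h / t%:C) - f (z / t%:C) - df (z / t%:C) * (h / t%:C)) / t%:C); last first.
    by rewrite (mulrDl z); ring.
  rewrite modulusM modulusV modulus_real gtr0_norm// -EFinM lee_fin.
  rewrite ler_wpM2r ?invr_ge0 ?(ltW t0)//.
  apply: le_trans (HL _ _ (modulus_scale z t1) _) _.
    exact: le_trans (modulus_scale h t1) (ltW h1).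
  by rewrite ler_wpM2l// lerXn2r ?nnegrE ?modulus_ge0// modulus_scale.
- rewrite ge0_integralZl//; last 2 first.
    exact: measurable_inv.
    by rewrite lee_fin mulr_ge0 ?sqr_ge0.
  rewrite AE -!EFinM lee_fin.
  rewrite (_ : 2 * _ = (2 * (L * A) * modulus h) * modulus h); last by ring.
  rewrite ler_wpM2r ?modulus_ge0//.
  apply: (@le_trans _ _ (K * modulus h)).
    by rewrite ler_wpM2r ?modulus_ge0// lerDl.
  by rewrite mulrC -ler_pdivlMr// ltW.
Qed.

End hausdorff_entire.

(** * Gaussian integrals and dilations of the plane *)

Section scaling.
Variable R : realType.
Local Notation MR := (measurableTypeR R).
Local Notation leb := (@lebesgue_measure R).
Local Notation leb2 := (leb \x leb)%E.

(* Product measures do not carry a canonical sigma-finite structure here. *)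
Lemma sigma_finite_pack d (T : measurableType d) (m : {measure set T -> \bar R}) :
  sigma_finite setT m ->
  exists m' : {sigma_finite_measure set T -> \bar R}, forall A, m' A = m A.
Proof.
move=> sm.
pose H2 := isSFinite.Build _ _ _ m (sfinite_measure_sigma_finite sm).
pose H3 := isSigmaFinite.Build _ _ _ m sm.
pose m' := HB.pack_for {sigma_finite_measure set T -> \bar R} (Measure.sort m) H2 H3.
by exists m'.
Qed.

(** The squares of an increasing exhaustion cover the plane, since monotonicity puts both
    coordinates into a common member. *)
Lemma sigma_finite_prod : sigma_finite [set: MR * MR] leb2.
Proof.
have [F FT Ffin] := sigma_finiteT leb.
have Foo := Ffin.
have /sigma_finiteP[G [TG ndG Goo]] : sigma_finite setT (leb : set MR -> \bar R) by exists F.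
exists (fun n => G n `*` G n) => [|n]; last first.
  have [mG fG] := Goo n; split; first exact: measurableX.
  by rewrite product_measure1E// lte_mul_pinfty// ge0_fin_numE.
rewrite -setXTT {1 2}TG; apply/seteqP; split => [[x y] [[i _ /= xi] [j _ /= yj]]|[x y] [n _ [? ?]]].
  exists (maxn i j) => //; split => /=.
    by move: x xi; exact/subsetPset/ndG/leq_maxl.
  by move: y yj; exact/subsetPset/ndG/leq_maxr.
by split; exists n.
Qed.

(** The pushforward of Lebesgue measure under x |-> x / t, divided by t, agrees with Lebesgue
    measure on half-open intervals, hence everywhere. *)
Lemma lebesgue_scale (t : R) (G : MR -> \bar R) : 0 < t ->
  measurable_fun [set: MR] G -> (forall x, (0 <= G x)%E) ->
  (\int[leb]_x G ((x : R) / t)%R = t%:E * \int[leb]_x G x)%E.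
Proof.
move=> t0 mG G0.
pose phi0 : MR -> MR := fun x => (x : R) / t.
have mphi : measurable_fun [set: MR] phi0 by exact: mulrr_measurable.
have it0 : 0 <= t^-1 by rewrite invr_ge0 ltW.
pose pf : {measure set MR -> \bar R} := measure_function_pushforward__canonical__measure_function_Measure leb mphi.
pose nu : {measure set MR -> \bar R} := mscale (NngNum it0) pf.
have nuE A : measurable A -> leb A = nu A.
  apply: lebesgue_measure_unique => X [[a b] _ <-].
  rewrite /nu /= /mscale /= /pushforward /=.
  have -> : phi0 @^-1` `]a, b] = `]a * t, b * t]%classic.
    by apply/seteqP; split => x /=; rewrite !in_itv/= ltr_pdivlMr// ler_pdivrMr.
  rewrite !lebesgue_measure_itv/= !lte_fin ltr_pM2r//.
  case: ifPn => // ab; last by rewrite mule0.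
  by rewrite -!EFinB -EFinM -mulrBl mulrCA mulVf ?mulr1// gt_eqF.
have -> : (\int[leb]_x G x = \int[nu]_x G x)%E.
  by apply: eq_measure_integral => A mA _; exact: nuE.
rewrite ge0_integral_mscale//= ge0_integral_pushforward//.
by rewrite preimage_setT muleA -EFinM mulfV ?gt_eqF// mul1e.
Qed.

Lemma area_scale (t : R) (G : MR * MR -> \bar R) : 0 < t ->
  measurable_fun [set: MR * MR] G -> (forall x, (0 <= G x)%E) ->
  (\int[leb2]_p G (((p.1 : R) / t)%R, ((p.2 : R) / t)%R) =
   (t ^+ 2)%:E * \int[leb2]_p G p)%E.
Proof.
move=> t0 mG G0.
have mphi : measurable_fun [set: MR] (fun x : MR => (x : R) / t : MR).
  exact: mulrr_measurable.
have mphi1 : measurable_fun [set: MR * MR] (fun p : MR * MR => ((p.1 : R) / t : MR, (p.2 : R) / t : MR)).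
  by apply: measurable_fun_pair; apply: (measurableT_comp mphi).
rewrite fubini_tonelli1//; last exact: (measurableT_comp mG mphi1).
rewrite [in RHS]fubini_tonelli1// /fubini_F /=.
under eq_integral => x _.
  rewrite (@lebesgue_scale t (fun y => G ((x : R) / t, y)))//; last first.
    by apply: (measurableT_comp mG); exact: pair1_measurable.
  over.
have mF : measurable_fun [set: MR] (fun x => \int[leb]_y G (x, y))%E.
  exact: measurable_fun_fubini_tonelli_F.
have t0' : (0 <= t%:E)%E by rewrite lee_fin ltW.
have F0 (x : MR) : [set: MR] x -> (0 <= \int[leb]_y G (((x : R) / t)%R, y))%E.
  by move=> _; exact: integral_ge0.
rewrite (ge0_integralZl leb measurableT (measurableT_comp mF mphi) F0 t0').
rewrite (@lebesgue_scale t (fun x => \int[leb]_y G (x, y))%E)//.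
  by rewrite muleA -EFinM expr2.
by move=> x; exact: integral_ge0.
Qed.

Lemma area_gauss1 : (\int[leb2]_p (expR (- ((p.1 : R) ^+ 2 + (p.2 : R) ^+ 2)))%:E = pi%:E)%E.
Proof.
have mg : measurable_fun [set: MR] (fun x : MR => expR (- (x : R) ^+ 2) : MR).
  exact: measurable_gauss_fun.
have gi : (\int[leb]_y (expR (- (y : R) ^+ 2))%:E = (Num.sqrt pi)%:E)%E := @integralT_gauss R.
have E (x : R) : (\int[leb]_y (expR (- (x ^+ 2 + (y : R) ^+ 2)))%:E =
    (expR (- x ^+ 2))%:E * (Num.sqrt pi)%:E)%E.
  rewrite -gi -ge0_integralZl//.
  - by apply: eq_integral => y _; rewrite opprD expRD EFinM.
  - exact/measurable_EFinP.
rewrite fubini_tonelli1//.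
  rewrite /fubini_F /= (eq_integral (fun x : MR => (expR (- (x : R) ^+ 2))%:E * (Num.sqrt pi)%:E)%E) => [|x _].
    rewrite ge0_integralZr//.
    - by rewrite gi -EFinM -expr2 sqr_sqrtr// pi_ge0.
    - exact/measurable_EFinP.
  exact: E.
apply/measurable_EFinP; apply: measurableT_comp; first exact: measurable_expR.
apply: measurable_funN; apply: measurable_funD; apply: measurable_funX.
  exact: measurable_fst.
exact: measurable_snd.
Qed.

Lemma measurable_gauss2 (b : R) : measurable_fun [set: MR * MR]
  (fun p : MR * MR => (expR (- (b * modulus (p.1 +i* p.2) ^+ 2)))%:E).
Proof.
apply/measurable_EFinP; apply: measurableT_comp; first exact: measurable_expR.
apply: measurable_funN; apply: measurable_funM => //; apply: measurable_funX.
have [mr mi] := measurable_ccont (@ccont_id R).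
exact: (measurable_modulus mr mi).
Qed.

(** A dilation by b^(-1/2) reduces to b = 1, where the integral is the square of the one-dimensional
    Gaussian integral. *)
Lemma area_gauss (b : R) : 0 < b ->
  area_integral (fun z => (expR (- (b * modulus z ^+ 2)))%:E) = (pi / b)%:E.
Proof.
move=> b0; have s0 : 0 < (Num.sqrt b)^-1 by rewrite invr_gt0 sqrtr_gt0.
pose G (p : MR * MR) : \bar R := (expR (- (1 * modulus (p.1 +i* p.2) ^+ 2)))%:E.
have G0 p : (0 <= G p)%E by rewrite lee_fin expR_ge0.
have := area_scale s0 (measurable_gauss2 1) G0.
have -> : (\int[leb2]_p G p)%E = pi%:E.
  rewrite -area_gauss1; apply: eq_integral => p _.
  by rewrite /G mul1r sqr_modulus.
rewrite exprVn sqr_sqrtr ?(ltW b0)// -EFinM mulrC => <-.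
apply: eq_integral => p _; rewrite /G mul1r !sqr_modulus /= invrK !exprMn.
by rewrite sqr_sqrtr ?(ltW b0)// -mulrDl mulrC.
Qed.
End scaling.

(** * The operator bound *)

Section young.
Variable R : realType.
Implicit Types (a b p q s : R).

(** Young's inequality for X and m^(p - 1) with exponents p and p / (p - 1); p = 1 is separate
    because the second exponent degenerates. *)
Lemma young_mean (X m p : R) : 0 <= X -> 0 <= m -> 1 <= p ->
  X * m `^ (p - 1) <= X `^ p / p + (1 - p^-1) * m `^ p.
Proof.
move=> X0 m0; rewrite le_eqVlt => /orP[/eqP <-|p1].
  by rewrite subrr powRr0 !powRr1// invr1 subrr mul0r addr0 !mulr1.
have p0 : 0 < p by apply: lt_trans p1.
have pm : 0 < p - 1 by rewrite subr_gt0.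
have e : p^-1 + (p / (p - 1))^-1 = 1 by field; rewrite !gt_eqF.
have := conjugate_powR X0 (powR_ge0 m (p - 1)) p0 (divr_gt0 p0 pm) e.
rewrite -powRrM mulrCA mulfV ?gt_eqF// mulr1.
have -> : (1 - p^-1) * m `^ p = m `^ p / (p / (p - 1)); last by [].
by field; rewrite !gt_eqF.
Qed.

(** The pointwise form of Hoelder's inequality for 1 / p = 1 / q + 1 / s. *)
Lemma young3 a b p q s : 0 <= a -> 0 <= b -> 0 < p -> 0 < q -> 0 < s ->
  p / q + p / s = 1 -> (a * b) `^ p <= p / q * a `^ q + p / s * b `^ s.
Proof.
move=> a0 b0 p0 q0 s0 e.
have := @conjugate_powR R (a `^ p) (b `^ p) (q / p) (s / p) (powR_ge0 _ _)
  (powR_ge0 _ _) (divr_gt0 q0 p0) (divr_gt0 s0 p0).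
rewrite !invf_div => /(_ e); rewrite -!powRrM.
have ep c : p * (c / p) = c by field; rewrite gt_eqF.
rewrite !ep; by rewrite powRM// ![_ * (p / _)]mulrC.
Qed.

End young.

(** * Minkowski's integral inequality *)

Section minkowski.
Local Open Scope ereal_scope.
Context d1 d2 (T1 : measurableType d1) (T2 : measurableType d2) (R : realType).
Variables (m : {sigma_finite_measure set T1 -> \bar R})
          (nu : {sigma_finite_measure set T2 -> \bar R}).
Variables (p A K : R) (X Psi : T1 * T2 -> R) (rho : T2 -> R) (H : T1 -> R).
Hypotheses (p1 : (1 <= p)%R) (A0 : (0 < A)%R) (K0 : (0 < K)%R).
Hypotheses (mX : measurable_fun setT X) (mPsi : measurable_fun setT Psi)
  (mrho : measurable_fun setT rho) (mH : measurable_fun setT H).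
Hypotheses (X0 : forall z, (0 <= X z)%R) (Psi0 : forall z, (0 <= Psi z)%R)
  (rho0 : forall t, (0 <= rho t)%R) (H0 : forall z, (0 <= H z)%R).
Hypothesis rhoA : \int[nu]_t (rho t)%:E <= A%:E.
Hypothesis XPsi : forall z t, (0 < rho t)%R -> (X (z, t) `^ p <= K * Psi (z, t))%R.
Hypothesis Psi1 : forall t, (0 < rho t)%R -> \int[m]_z (Psi (z, t))%:E <= 1.
Hypothesis HX : forall z, (H z)%:E <= 2%:E * \int[nu]_t (X (z, t) * rho t)%:E.

Let p0 : (0 < p)%R. Proof. exact: lt_le_trans p1. Qed.

Let J z := \int[nu]_t (Psi (z, t) * rho t)%:E.

Let mPr : measurable_fun setT (fun q : T1 * T2 => (Psi q * rho q.2)%:E).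
Proof.
apply/measurable_EFinP/measurable_funM => //.
by apply: measurableT_comp => //; exact: measurable_snd.
Qed.

Let Pr0 z t : 0 <= (Psi (z, t) * rho t)%:E.
Proof. by rewrite lee_fin mulr_ge0. Qed.

Let mPrz z : measurable_fun setT (fun t => (Psi (z, t) * rho t)%:E).
Proof. by apply: (measurableT_comp mPr); exact: pair1_measurable. Qed.

Let mXz z : measurable_fun setT (fun t => (X (z, t) * rho t)%:E).
Proof.
apply/measurable_EFinP/measurable_funM => //.
by apply: (measurableT_comp mX); exact: pair1_measurable.
Qed.

Let J0 z : 0 <= J z. Proof. by apply: integral_ge0 => t _; exact: Pr0. Qed.

Let mJ : measurable_fun setT J.
Proof.
apply: (measurable_fun_fubini_tonelli_F (fun q : T1 * T2 => (Psi q * rho q.2)%:E)) => //.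
by move=> [z t]; exact: Pr0.
Qed.

(* Young's inequality with a free parameter c; c = i / A below optimizes it. *)
Let young_int z (c : R) : (0 <= c)%R ->
  (c `^ (p - 1))%:E * \int[nu]_t (X (z, t) * rho t)%:E <=
  (K / p)%:E * J z + ((1 - p^-1) * c `^ p)%:E * A%:E.
Proof.
move=> c0.
have q0 : (0 <= 1 - p^-1)%R by rewrite subr_ge0 invf_le1.
rewrite -ge0_integralZl//; last 2 first.
- by move=> t _; rewrite lee_fin mulr_ge0.
- by rewrite lee_fin powR_ge0.
apply: (@le_trans _ _ (\int[nu]_t ((K / p)%:E * (Psi (z, t) * rho t)%:E +
   ((1 - p^-1) * c `^ p)%:E * (rho t)%:E))).
  apply: ge0_le_integral => //.
  - by move=> t _; rewrite mule_ge0 ?lee_fin ?powR_ge0// mulr_ge0.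
  - by apply: emeasurable_funM => //.
  - apply: emeasurable_funD; apply: emeasurable_funM => //.
    exact/measurable_EFinP.
  - move=> t _; rewrite -!EFinM -EFinD lee_fin.
    have [r0|r0] := eqVneq (rho t) 0%R; first by rewrite r0 !mulr0 addr0.
    have {}r0 : (0 < rho t)%R by rewrite lt_neqAle eq_sym r0 rho0.
    rewrite !mulrA -mulrDl ler_pM2r// [leLHS]mulrC.
    apply: le_trans (young_mean (X0 _) c0 p1) _; rewrite lerD2r.
    by rewrite mulrAC ler_pM2r ?invr_gt0// XPsi.
rewrite ge0_integralD//; last 4 first.
- by move=> t _; rewrite mule_ge0// lee_fin divr_ge0// ltW.
- by apply: emeasurable_funM.
- by move=> t _; rewrite -EFinM lee_fin !mulr_ge0 ?powR_ge0.
- by apply: emeasurable_funM => //; exact/measurable_EFinP.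
rewrite !ge0_integralZl//;  last 4 first.
- exact/measurable_EFinP.
- by move=> t _; rewrite lee_fin.
- by rewrite lee_fin mulr_ge0 ?powR_ge0.
- by rewrite lee_fin divr_ge0// ltW.
apply: leeD => //; apply: lee_pmul => //; first by rewrite lee_fin mulr_ge0 ?powR_ge0.
by apply: integral_ge0 => t _; rewrite lee_fin.
Qed.

(** Jensen's inequality for the measure rho dnu of mass at most A; the factor 2^p comes from
    [HX]. *)
Let jensen z : ((H z) `^ p)%:E <= ((2 * A) `^ p * K / A)%:E * J z.
Proof.
have C0 : (0 < (2 * A) `^ p * K / A)%R.
  apply: divr_gt0 => //; apply: mulr_gt0 => //; apply: powR_gt0; exact: mulr_gt0.
have [->|Joo] := eqVneq (J z) +oo; first by rewrite gt0_muley ?leey// lte_fin.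
have Jfin : J z \is a fin_num by rewrite ge0_fin_numE// lt_neqAle Joo leey.
set I := \int[nu]_t (X (z, t) * rho t)%:E.
have I0 : 0 <= I by apply: integral_ge0 => t _; rewrite lee_fin mulr_ge0.
have Ifin : I \is a fin_num.
  (* The parameter 1 only serves to show that I is finite, so that I / A becomes a real number to
     insert next. *)
  rewrite ge0_fin_numE//; have := @young_int z 1 ler01.
  rewrite powR1 mul1e => /le_lt_trans; apply.
  by rewrite -(fineK Jfin) -!EFinM -EFinD ltry.
set i := fine I; have i0 : (0 <= i)%R by exact: fine_ge0.
set j := fine (J z).
have Ei : I = i%:E by rewrite fineK.
have Ej : J z = j%:E by rewrite fineK.
have m0 : (0 <= i / A)%R by rewrite divr_ge0// ltW.
have := young_int z m0; rewrite -/I Ei Ej -!EFinM -EFinD lee_fin => Y.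
have {}Y : (A * (i / A) `^ p <= K * j)%R.
  have e1 : ((i / A) `^ (p - 1) * i = A * (i / A) `^ p)%R.
    rewrite -(mulr_powRB1 m0 p0); field; exact: lt0r_neq0.
  rewrite e1 in Y.
  have : (A * (i / A) `^ p / p <= K * j / p)%R.
    move: Y; rewrite [leRHS]addrC -lerBlDl; congr (_ <= _)%R; field; exact: lt0r_neq0.
  by rewrite ler_pM2r// invr_gt0.
rewrite lee_fin.
have Hi : (H z <= 2 * A * (i / A))%R.
  have := HX z; rewrite -/I Ei -EFinM lee_fin; congr (_ <= _)%R; field; exact: lt0r_neq0.
have A2 : (0 <= 2 * A)%R by rewrite mulr_ge0// ltW.
have HH : (H z `^ p <= (2 * A * (i / A)) `^ p)%R.
  by apply: (ge0_ler_powR (ltW p0)) => //; rewrite nnegrE// mulr_ge0.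
apply: le_trans HH _; rewrite (powRM _ A2 m0).
have -> : ((2 * A) `^ p * K / A * j = (2 * A) `^ p * (K * j / A))%R by ring.
by rewrite ler_wpM2l ?powR_ge0// ler_pdivlMr// mulrC.
Qed.

(** After [jensen], Tonelli's theorem exchanges the integrals and [Psi1] bounds each slice. Asking
    for a majorant [Psi] of X^p, in place of the norm of each slice, lets one statement serve finite
    and infinite q. *)
Lemma minkowski_bound : \int[m]_z ((H z) `^ p)%:E <= ((2 * A) `^ p * K)%:E.
Proof.
have c0 : (0 <= (2 * A) `^ p * K / A)%R.
  by rewrite divr_ge0// ?mulr_ge0 ?powR_ge0// ltW.
apply: (@le_trans _ _ (\int[m]_z (((2 * A) `^ p * K / A)%:E * J z))).
  apply: ge0_le_integral => //.
  - by move=> z _; rewrite lee_fin powR_ge0.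
  - by apply/measurable_EFinP; apply: (measurableT_comp (measurable_powR _)).
  - exact: emeasurable_funM.
rewrite ge0_integralZl//.
rewrite [in leRHS](_ : (2 * A) `^ p * K = (2 * A) `^ p * K / A * A)%R; last first.
  by rewrite divfK// gt_eqF.
rewrite [leRHS]EFinM; apply: lee_pmul => //; first by apply: integral_ge0.
rewrite /J (fubini_tonelli (fun q : T1 * T2 => (Psi q * rho q.2)%:E))//=; last first.
  by move=> [z t]; exact: Pr0.
apply: le_trans rhoA; apply: ge0_le_integral => //.
- by move=> t _; apply: integral_ge0 => z _; exact: Pr0.
- apply: (measurable_fun_fubini_tonelli_G (fun q : T1 * T2 => (Psi q * rho q.2)%:E)) => //.
  by move=> [z t]; exact: Pr0.
- exact/measurable_EFinP.
- move=> t _.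
  under eq_integral => z _ do rewrite EFinM.
  rewrite ge0_integralZr//; last 3 first.
  + by apply/measurable_EFinP; apply: (measurableT_comp mPsi); exact: pair2_measurable.
  + by move=> z _; rewrite lee_fin.
  + by rewrite lee_fin.
  have [r0|r0] := eqVneq (rho t) 0%R; first by rewrite r0 mule0.
  have {}r0 : (0 < rho t)%R by rewrite lt_neqAle eq_sym r0 rho0.
  rewrite -[leRHS]mul1e; apply: lee_pmul => //.
  + by apply: integral_ge0 => z _; rewrite lee_fin.
  + by rewrite lee_fin.
  + exact: Psi1.
Qed.

End minkowski.

(** * Growth of the power series with coefficients (n + 1)^(c - 1) *)

Section power_series_lower_bound.
Variable R : realType.
Implicit Types (x c : R).

Lemma powR_anti (a b r : R) : 0 < a -> a <= b -> r <= 0 -> b `^ r <= a `^ r.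
Proof.
move=> a0 ab r0; have b0 : 0 < b by exact: lt_le_trans ab.
rewrite -[r]opprK !(powRN _ (- r)) lef_pV2 ?posrE ?powR_gt0//.
by apply: ge0_ler_powR; rewrite ?nnegrE ?oppr_ge0// ltW.
Qed.

Lemma powRV (a r : R) : 0 <= a -> a^-1 `^ r = a `^ (- r).
Proof. by move=> a0; rewrite -powR_inv1// -powRrM mulN1r. Qed.

(** Both factors decrease in n, as c <= 1 and x <= 1, so each of the N + 1 terms is at least the
    last one. *)
Lemma partial_sum_ge c x N : 0 < c -> c <= 1 -> 0 <= x <= 1 ->
  N.+1%:R `^ c * x ^+ N.+1 <= \sum_(0 <= n < N.+1) n.+1%:R `^ (c - 1) * x ^+ n.+1.
Proof.
move=> c0 c1 /andP[x0 x1].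
have H n : (n < N.+1)%N -> N.+1%:R `^ (c - 1) * x ^+ N.+1 <= n.+1%:R `^ (c - 1) * x ^+ n.+1.
  move=> nN; apply: ler_pM; rewrite ?powR_ge0 ?exprn_ge0//.
    by apply: powR_anti; rewrite ?ltr0n ?ler_nat// subr_le0.
  by rewrite ler_wiXn2l.
apply: (@le_trans _ _ (\sum_(0 <= n < N.+1) N.+1%:R `^ (c - 1) * x ^+ N.+1)).
  rewrite sumr_const_nat subn0 -[leRHS]mulr_natl mulrA.
  by rewrite mulr_powRB1.
by rewrite big_nat [leRHS]big_nat; apply: ler_sum => n /andP[_ nN]; exact: H.
Qed.

Lemma partial_sum_ge1 c x N : 0 < c -> c <= 1 -> 1 <= x ->
  N.+1%:R `^ c <= \sum_(0 <= n < N.+1) n.+1%:R `^ (c - 1) * x ^+ n.+1.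
Proof.
move=> c0 c1 x1; have := @partial_sum_ge c 1 N c0 c1; rewrite ler01 lexx expr1n mulr1 => /(_ isT).
move=> /le_trans; apply; apply: ler_sum => n _; rewrite expr1n ler_wpM2l ?powR_ge0//.
exact: exprn_ege1.
Qed.

Lemma bernoulli_ineq x N : 0 <= x <= 1 -> 1 - N%:R * (1 - x) <= x ^+ N.
Proof.
move=> /andP[x0 x1]; elim: N => [|N IH]; first by rewrite mul0r subr0 expr0.
rewrite exprS; apply: le_trans (ler_wpM2l x0 IH).
have N0 : (0 : R) <= N%:R by [].
rewrite -natr1; have : 0 <= N%:R * (1 - x) * (1 - x) by rewrite !mulr_ge0// subr_ge0.
lra.
Qed.

(** About 1 / (2 (1 - x)) terms are taken: few enough that Bernoulli's inequality keeps the last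
    power of x above 1/2, and enough that their number to the power c is comparable with (1 -
    x)^(-c). *)
Lemma series_lower c x : 0 < c <= 1 -> 2^-1 <= x < 1 ->
  exists N, (1 - x) `^ (- c) <= 8 * \sum_(0 <= n < N) n.+1%:R `^ (c - 1) * x ^+ n.+1.
Proof.
move=> /andP[c0 c1] /andP[x2 x1].
have y0 : 0 < 1 - x by rewrite subr_gt0.
(* [x >= 1/2] gives v >= 1, so rounding v down to N + 1 loses at most a factor 2 and 2 v <= 4 (N +
   1). The 8 is this 4 times the 2 lost to the last power of x. *)
set v := (2 * (1 - x))^-1.
have v1 : 1 <= v by rewrite /v invf_ge1 ?mulr_gt0//; lra.
have v0 : 0 <= v by apply: le_trans v1.
have /andP[n1 n2] := truncn_itv v0.
set N := Num.truncn v in n1 n2.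
have N0 : (0 < N)%N by rewrite -(ltr_nat R); move: n2; rewrite -natr1 => ?; lra.
case: N N0 n1 n2 => // N _ n1 n2; exists N.+1.
have x01 : 0 <= x <= 1 by apply/andP; split; lra.
have A := @partial_sum_ge c x N c0 c1 x01.
have B := bernoulli_ineq N.+1 x01.
have C : 2^-1 <= x ^+ N.+1.
  apply: le_trans B; have : N.+1%:R * (1 - x) <= 2^-1.
    by rewrite -ler_pdivlMr// -invfM.
  lra.
have E : (1 - x) `^ (- c) <= 4 * N.+1%:R `^ c.
  have -> : (1 - x) `^ (- c) = (2 * v) `^ c.
    by rewrite /v invfM mulrA mulfV// mul1r powRV// ltW.
  have : 2 * v <= 4 * N.+1%:R.
    move: n2; rewrite -[N.+2%:R]natr1.
    have : (1 : R) <= N.+1%:R by rewrite ler1n.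
    lra.
  move=> h; apply: (@le_trans _ _ ((4 * N.+1%:R) `^ c)).
    by apply: ge0_ler_powR; rewrite ?nnegrE ?mulr_ge0// ltW.
  rewrite powRM// ler_wpM2r ?powR_ge0//.
  by apply: ler1_powR => //; rewrite ler1n.
apply: le_trans E _; apply: (@le_trans _ _ (8 * (N.+1%:R `^ c * x ^+ N.+1))); last by rewrite ler_pM2l.
have : N.+1%:R `^ c * 2^-1 <= N.+1%:R `^ c * x ^+ N.+1 by rewrite ler_wpM2l ?powR_ge0.
lra.
Qed.

End power_series_lower_bound.

(** * Consequences of the summability of the moments *)

Section moments.
Variable R : realType.
Local Notation MR := (measurableTypeR R).
Variable mu : {measure set MR -> \bar R}.
Local Notation D0 := (`]0%R, +oo[%classic : set MR).
Local Notation D1 := (`]1%R, +oo[%classic : set MR).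
Local Notation D01 := (`]0%R, 1%R]%classic : set MR).
Variables (c e : R).
Hypotheses (c01 : 0 < c <= 1) (e0 : e <= 0).
Hypothesis int_e : (\int[mu]_(t in `[1%R, +oo[) (((t : R) `^ e))%:E < +oo)%E.
Hypothesis sum_mu : (\sum_(0 <= n <oo)
   (hausdorff_moment mu n * ((n.+1%:R : R) `^ (c - 1))%:E) < +oo)%E.

Let mD0 : measurable D0. Proof. exact: measurable_itv. Qed.
Let mD1 : measurable D1. Proof. exact: measurable_itv. Qed.
Let mD01 : measurable D01. Proof. exact: measurable_itv. Qed.

Let minvX n : measurable_fun [set: MR] (fun t : MR => (((t : R) ^+ n.+1)^-1)%:E).
Proof.
apply/measurable_EFinP; apply: (measurableT_comp (@measurable_inv_fun R)).
exact: exprn_measurable.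
Qed.

Let u n (t : MR) : \bar R := ((((t : R) ^+ n.+1)^-1) * n.+1%:R `^ (c - 1))%:E.

Let mu_ n (D : set MR) : measurable_fun D (u n).
Proof.
apply: measurable_funTS; apply/measurable_EFinP; apply: measurable_funM => //.
by apply/measurable_EFinP; exact: minvX.
Qed.

Let u0 n t : D0 t -> (0 <= u n t)%E.
Proof.
rewrite /= in_itv/= andbT => t0.
by rewrite lee_fin mulr_ge0 ?powR_ge0// invr_ge0 exprn_ge0// ltW.
Qed.

Let int_u n : (\int[mu]_(t in D0) u n t =
   hausdorff_moment mu n * ((n.+1%:R : R) `^ (c - 1))%:E)%E.
Proof.
rewrite /hausdorff_moment -ge0_integralZr//.
- exact: measurable_funTS.
- move=> t; rewrite /= in_itv/= andbT => t0.
  by rewrite lee_fin invr_ge0 exprn_ge0// ltW.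
Qed.

Let S t := (\sum_(0 <= n <oo) u n t)%E.

Let S_int : (\int[mu]_(t in D0) S t < +oo)%E.
Proof.
rewrite /S (integral_nneseries mu mD0 (fun n => @mu_ n D0) (fun n t => @u0 n t)).
by rewrite (eq_eseriesr (fun n _ => int_u n)).
Qed.

Let S_ge t N : D0 t ->
  ((\sum_(0 <= n < N) n.+1%:R `^ (c - 1) * (t : R)^-1 ^+ n.+1)%:E <= S t)%E.
Proof.
move=> t0; apply: le_trans (nneseries_lim_ge (u_ := u ^~ t) N _); last by move=> n _ _; exact: u0.
rewrite -sumEFin lee_sum// => n _.
by rewrite /u lee_fin mulrC exprVn.
Qed.

Let mS (D : set MR) : measurable D -> D `<=` D0 -> measurable_fun D S.
Proof.
move=> mD DD0; apply: ge0_emeasurable_sum => //.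
by move=> n t Dt _; exact/u0/DD0.
Qed.

(** On ]0, 1] the series [S] exceeds (N + 1)^c for every N, so its finite integral bounds (N + 1)^c
    mu(]0, 1]) for every N. *)
Lemma moments_null : mu D01 = 0%E.
Proof.
case/andP: c01 => c0 c1.
apply/eqP; rewrite eq_le measure_ge0 andbT.
have fin : (\int[mu]_(t in D01) S t < +oo)%E.
  apply: le_lt_trans S_int; apply: ge0_subset_integral => //.
  - exact: mS.
  - by move=> t t0; apply: nneseries_ge0 => n _ _; exact: u0.
  - by apply: subset_itvl; rewrite bnd_simp.
have sub t : D01 t -> D0 t by rewrite /= !in_itv/= andbT => /andP[].
have ge N : ((N.+1%:R `^ c)%:E * mu D01 <= \int[mu]_(t in D01) S t)%E.
  rewrite -integral_cst//; apply: ge0_le_integral => //.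
  - by move=> t _; rewrite lee_fin powR_ge0.
  - by apply: mS.
  - move=> t Dt; apply: le_trans (S_ge N.+1 (sub _ Dt)); rewrite lee_fin.
    apply: partial_sum_ge1 => //.
    move: Dt; rewrite /= in_itv/= => /andP[t0 t1].
    by rewrite invf_ge1.
set I := (\int[mu]_(t in D01) S t)%E in fin ge.
have I0 : (0 <= I)%E by apply: le_trans (ge 0); rewrite mule_ge0.
have Ifin : I \is a fin_num by rewrite ge0_fin_numE.
rewrite leNgt; apply/negP => m0.
have mfin : mu D01 \is a fin_num.
  rewrite ge0_fin_numE//; apply: le_lt_trans fin; apply: le_trans (ge 0).
  by rewrite powR1 mul1e.
move: m0 ge; rewrite -(fineK mfin) -(fineK Ifin) lte_fin; set m := fine _; set i := fine _ => m0 ge.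
have {}ge N : N.+1%:R `^ c <= i / m.
  by have := ge N; rewrite -EFinM lee_fin ler_pdivlMr.
(* Chosen so that (N + 1)^c exceeds i / m. *)
pose N := Num.truncn ((i / m) `^ c^-1).
have := ge N; apply/negP; rewrite -ltNge.
have im0 : 0 <= i / m by apply: le_trans (ge 0); rewrite powR_ge0.
have -> : i / m = ((i / m) `^ c^-1) `^ c by rewrite -powRrM mulVf ?gt_eqF// powRr1.
apply: gt0_ltr_powR => //; rewrite ?nnegrE ?powR_ge0//.
exact: truncnS_gt.
Qed.

(** The term n = 0 of the series is 1 / t itself, its weight being 1. *)
Lemma moments_inv : (\int[mu]_(t in D1) ((t : R)^-1)%:E < +oo)%E.
Proof.
apply: (@le_lt_trans _ _ (\int[mu]_(t in D0) u 0 t)%E).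
  have -> : (\int[mu]_(t in D1) ((t : R)^-1)%:E = \int[mu]_(t in D1) u 0 t)%E.
    by apply: eq_integral => t _; rewrite /u powR1 mulr1 expr1.
  apply: ge0_subset_integral => //; try by move=> t; exact: u0.
  by apply: subset_itvr; rewrite bnd_simp ler01.
apply: le_lt_trans S_int; apply: ge0_le_integral => //.
- by move=> t; exact: u0.
- exact: mS.
- move=> t t0; apply: le_trans (S_ge 1 t0).
  by rewrite big_nat1 /u exprVn lee_fin mulrC.
Qed.

(** For e = 2/q - 1, the factor t^e is t^(2/q), by which dilation multiplies an L^q norm on the
    plane, times the 1 / t of the integrand. The second factor is, up to a constant, the L^(1/c)
    norm of exp(-(alpha / 2)(1 - t^-2)|z|^2). *)
Definition dilation_weight (t : R) : R := t `^ e * (1 - t ^- 2) `^ (- c).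

Lemma measurable_dilation_weight : measurable_fun [set: MR] (dilation_weight : MR -> MR).
Proof.
apply: measurable_funM; first exact: measurable_powR.
apply: (measurableT_comp (measurable_powR _)); apply: measurable_funB => //.
by apply/measurable_EFinP; exact: minvX.
Qed.

Lemma moments_weight : (\int[mu]_(t in D1) (dilation_weight t)%:E < +oo)%E.
Proof.
have c0 : 0 < c by case/andP: c01.
have sub t : D1 t -> D0 t by rewrite /= !in_itv/= !andbT; exact: lt_trans.
have S0 t : D1 t -> (0 <= S t)%E.
  by move=> /sub t0; apply: nneseries_ge0 => n _ _; exact: u0.
have mSD1 : measurable_fun D1 S by exact: mS.
have me : measurable_fun D1 (fun t : MR => ((t : R) `^ e)%:E).
  by apply/measurable_EFinP; apply: measurable_funTS; exact: measurable_powR.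
(* For t <= 2, [series_lower] at x = 1 / t gives the term 8 S, because 1 - 1 / t <= 1 - t^-2 and t^e
   <= 1. For t > 2 the second factor of the weight is at most (1/2)^(-c) <= 2. *)
apply: (@le_lt_trans _ _ (\int[mu]_(t in D1) (8%:E * S t + 2%:E * ((t : R) `^ e)%:E))%E).
  apply: ge0_le_integral => //.
  - by move=> t _; rewrite lee_fin mulr_ge0 ?powR_ge0.
  - by apply/measurable_EFinP; apply: measurable_funTS; exact: measurable_dilation_weight.
  - by apply: emeasurable_funD; apply: emeasurable_funM.
  - move=> t Dt; have t1 : 1 < (t : R) by move: Dt; rewrite /= in_itv/= andbT.
    have t0 : 0 < (t : R) by apply: lt_trans t1.
    rewrite /dilation_weight; have [t2|t2] := leP (t : R) 2.
      have x12 : 2^-1 <= (t : R)^-1 < 1 by rewrite lef_pV2 ?posrE// t2/= invf_lt1.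
      have [N HN] := series_lower c01 x12.
      apply: (@le_trans _ _ (8%:E * S t)%E); last first.
        by rewrite leeDl// mule_ge0// lee_fin powR_ge0.
      apply: le_trans (_ : ((1 - (t : R)^-1) `^ (- c))%:E <= _)%E; last first.
        apply: (@le_trans _ _ (8%:E * (\sum_(0 <= n < N) n.+1%:R `^ (c - 1) * (t : R)^-1 ^+ n.+1)%:E)%E).
          by rewrite -EFinM lee_fin.
        by rewrite lee_pmul2l// S_ge//; exact: sub.
      rewrite lee_fin -[leRHS]mul1r; apply: ler_pM; rewrite ?powR_ge0//.
        by rewrite -(powRr0 (t : R)); apply: ler_powR => //; exact: ltW.
      apply: powR_anti; rewrite ?subr_gt0 ?invf_lt1 ?oppr_le0 ?(ltW c0)//.
      rewrite lerD2l lerN2 -exprVn expr2 ler_piMr ?invr_ge0 ?(ltW t0)//.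
      by rewrite invf_le1// ltW.
    apply: (@le_trans _ _ (2%:E * ((t : R) `^ e)%:E)%E); last first.
      by rewrite leeDr// mule_ge0// S0.
    rewrite -EFinM lee_fin [leRHS]mulrC ler_wpM2l ?powR_ge0//.
    have h : (2^-1 : R) <= 1 - t ^- 2.
      have : (t : R) ^- 2 <= 2^-1; last by lra.
      rewrite lef_pV2 ?posrE ?exprn_gt0//.
      by apply: le_trans (ltW t2) _; rewrite expr2 ler_peMr// ltW.
    apply: (@le_trans _ _ (2^-1 `^ (- c))).
      by apply: powR_anti => //; rewrite oppr_le0 ltW.
    rewrite powRV// opprK.
    by apply: ler1_powR => //; [rewrite ler1n|case/andP: c01].
rewrite ge0_integralD//; last 4 first.
- by move=> t Dt; rewrite mule_ge0// S0.
- by apply: emeasurable_funM.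
- by move=> t Dt; rewrite mule_ge0// lee_fin powR_ge0.
- by apply: emeasurable_funM.
rewrite !ge0_integralZl//; last 1 first.
- by move=> t _; rewrite lee_fin powR_ge0.
apply: lte_add_pinfty; apply: lte_mul_pinfty => //.
- apply: le_lt_trans S_int; apply: ge0_subset_integral => //.
  + exact: mS.
  + by move=> t t0; apply: nneseries_ge0 => n _ _; exact: u0.
- apply: le_lt_trans int_e; apply: ge0_subset_integral => //.
  + by apply/measurable_EFinP; apply: measurable_funTS; exact: measurable_powR.
  + by move=> t _; rewrite lee_fin powR_ge0.
  + by apply: subset_itvr; rewrite bnd_simp.
Qed.

End moments.

(** * Minkowski's inequality applied to the dilations *)

Section weight_bound.
Variable R : realType.
Local Notation MR := (measurableTypeR R).
Variable mu : {measure set MR -> \bar R}.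
Local Notation D0 := (`]0%R, +oo[%classic : set MR).
Local Notation D1 := (`]1%R, +oo[%classic : set MR).
Local Notation D01 := (`]0%R, 1%R]%classic : set MR).
Local Notation leb := (@lebesgue_measure R).

Let mD1 : measurable D1. Proof. exact: measurable_itv. Qed.

Lemma integral_mrestr (g : MR -> \bar R) :
  (forall t, ~ D1 t -> g t = 0%E) ->
  (\int[mrestr mu mD1]_t g t = \int[mu]_(t in D1) g t)%E.
Proof.
move=> g0; have -> : g = g \_ D1.
  apply/funext => t; rewrite patchE; case: ifPn => // /negP tD.
  by apply: g0 => Dt; apply: tD; rewrite inE.
rewrite -integral_mkcond -integral_mkcondr setIid.
apply: eq_measure_integral => A mA AD.
by rewrite /= /mrestr setIidl.
Qed.

Hypothesis mu01 : mu D01 = 0%E.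
Hypothesis mu_inv : (\int[mu]_(t in D1) ((t : R)^-1)%:E < +oo)%E.

(** Since 1 / t >= 1 / (n + 1) on ]1, n + 1], the finite integral of 1 / t bounds the measure of
    these intervals. This is what admits Tonelli's theorem in [minkowski_bound]. *)
Lemma sigma_finite_restr : sigma_finite [set: MR] (mrestr mu mD1).
Proof.
exists (fun n : nat => `]-oo, n.+1%:R]%classic).
  apply/seteqP; split => // x _; exists (Num.truncn x) => //=.
  by rewrite in_itv/= ltW// truncnS_gt.
move=> n; split; first exact: measurable_itv.
rewrite /mrestr.
have -> : (`]-oo, n.+1%:R] `&` D1 = `]1%R, n.+1%:R]%classic :> set MR).
  apply/seteqP; split => x /=; rewrite !in_itv/= ?andbT; first by move=> [-> ->].
  by move=> /andP[-> ->].
have mE : measurable (`]1%R, n.+1%:R]%classic : set MR) by exact: measurable_itv.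
have H : ((n.+1%:R^-1)%:E * mu `]1%R, n.+1%:R]%classic <= \int[mu]_(t in D1) ((t : R)^-1)%:E)%E.
  rewrite -integral_cst//.
  apply: (@le_trans _ _ (\int[mu]_(t in `]1%R, n.+1%:R]%classic) ((t : R)^-1)%:E)%E).
    apply: ge0_le_integral => //.
    - by move=> t _; rewrite lee_fin invr_ge0.
    - exact: measurable_inv.
    - move=> t /=; rewrite in_itv/= => /andP[t1 tn].
      have t0 : 0 < (t : R) by exact: lt_trans t1.
      by rewrite lee_fin lef_pV2 ?posrE.
  apply: ge0_subset_integral => //.
  - exact: measurable_inv.
  - by move=> t; rewrite /= in_itv/= andbT => t1; rewrite lee_fin invr_ge0 ltW// (lt_trans _ t1).
  - by apply: subset_itvl; rewrite bnd_simp.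
have := le_lt_trans H mu_inv; rewrite !ltey; apply: contra => /eqP ->.
by rewrite gt0_muley// lte_fin invr_gt0.
Qed.

Variables (alpha p c e kappa K : R) (f : R[i] -> R[i]) (Psi : (MR * MR) * MR -> R).
Hypotheses (p1 : 1 <= p) (K0 : 0 < K) (kappa0 : 0 < kappa).
Hypothesis ef : entire f.
Hypothesis mPsi : measurable_fun [set: (MR * MR) * MR] (Psi : _ -> MR).
Hypothesis Psi0 : forall z, 0 <= Psi z.
Hypothesis int_weight : (\int[mu]_(t in D1) (dilation_weight c e t)%:E < +oo)%E.

Let w (z : MR * MR) : R := expR (- (alpha / 2 * modulus (z.1 +i* z.2) ^+ 2)).
Let h (z : MR * MR) (t : R) : R := modulus (f ((z.1 +i* z.2) / t%:C) / t%:C).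

Hypothesis XPsi : forall z t, 1 < t ->
  (h z t * w z / (kappa * dilation_weight c e t)) `^ p <= K * Psi (z, t).
Hypothesis Psi1 : forall t : R, 1 < t ->
  (\int[leb \x leb]_z (Psi (z, t))%:E <= 1)%E.

(** The added 1 keeps A positive when mu vanishes on ]1, oo[. *)
Let A := kappa * fine (\int[mu]_(t in D1) (dilation_weight c e t)%:E)%E + 1.

Let rho (t : MR) : R := kappa * dilation_weight c e t * \1_D1 t.

Lemma dilation_weight_ge0 t : 0 <= dilation_weight c e t.
Proof. by rewrite mulr_ge0 ?powR_ge0. Qed.

Lemma dilation_weight_gt0 t : 1 < t -> 0 < dilation_weight c e t.
Proof.
move=> t1; have t0 : 0 < t by apply: lt_trans t1.
apply: mulr_gt0; apply: powR_gt0 => //.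
by rewrite subr_gt0 invf_lt1 ?exprn_gt0// exprn_egt1.
Qed.

Let rho0 t : 0 <= rho t.
Proof. by apply: mulr_ge0 => //; apply: mulr_ge0; [exact: ltW|exact: dilation_weight_ge0]. Qed.

Let rho_gt0 t : 0 < rho t -> 1 < (t : R).
Proof.
rewrite /rho indicE; case: (boolP (t \in D1)) => [|_]; last by rewrite mulr0 ltxx.
by rewrite inE /= in_itv/= andbT.
Qed.

Let rho_D1 (t : MR) : 1 < (t : R) -> rho t = kappa * dilation_weight c e t.
Proof. by move=> t1; rewrite /rho indicE mem_set ?mulr1//= in_itv/= t1. Qed.

Let mrho : measurable_fun [set: MR] (rho : MR -> MR).
Proof.
apply: measurable_funM; last exact: measurable_indic.
by apply: measurable_funM => //; exact: measurable_dilation_weight.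
Qed.

Let mw : measurable_fun [set: MR * MR] (w : _ -> MR).
Proof. by apply/measurable_EFinP; exact: measurable_gauss2. Qed.

Let X (q : (MR * MR) * MR) : R := h q.1 q.2 * w q.1 / rho q.2.

Let mh : measurable_fun [set: (MR * MR) * MR] (fun q : (MR * MR) * MR => h q.1 q.2 : MR).
Proof.
have [mr mi] := measurable_scale_comp (entire_ccont ef).
exact: (measurable_modulus mr mi).
Qed.

Let mX : measurable_fun [set: (MR * MR) * MR] (X : _ -> MR).
Proof.
apply: measurable_funM.
  by apply: measurable_funM => //; apply: (measurableT_comp mw); exact: measurable_fst.
apply: (measurableT_comp (@measurable_inv_fun R)).
by apply: (measurableT_comp mrho); exact: measurable_snd.
Qed.

Let w0 z : 0 < w z. Proof. exact: expR_gt0. Qed.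
Let h0 z t : 0 <= h z t. Proof. exact: modulus_ge0. Qed.

(** [minkowski_bound] with the dilation weight as density rho and with X the integrand divided by
    rho. Off ]1, oo[ the density is 0, so the product X rho vanishes there whatever the default
    value of the quotient. *)
Lemma hausdorff_weight_bound :
  (area_integral (fun z => ((fock_weight alpha (hausdorff mu f) z) `^ p)%:E)
   <= ((2 * A) `^ p * K)%:E)%E.
Proof.
have [nu nuE] := sigma_finite_pack sigma_finite_restr.
have int_nu (g : MR -> \bar R) : (forall t, ~ D1 t -> g t = 0%E) ->
    (\int[nu]_t g t = \int[mu]_(t in D1) g t)%E.
  move=> g0; rewrite -(integral_mrestr g0).
  by apply: eq_measure_integral => B _ _; exact: nuE.
have ehf := hausdorff_entire mu01 mu_inv ef.
have cf := entire_ccont ef.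
have rhoN t : ~ D1 t -> rho t = 0.
  by move=> tD; rewrite /rho indicE memNset ?mulr0.
have wint0 : (0 <= \int[mu]_(t in D1) (dilation_weight c e t)%:E)%E.
  by apply: integral_ge0 => t _; rewrite lee_fin dilation_weight_ge0.
have [m12 m12E] := sigma_finite_pack (@sigma_finite_prod R).
have i12 (g : MR * MR -> \bar R) : (\int[leb \x leb]_z g z = \int[m12]_z g z)%E.
  by apply: eq_measure_integral => B _ _; symmetry; exact: m12E.
rewrite /area_integral i12; apply: (@minkowski_bound _ _ _ _ R m12 nu p A K X Psi rho
  (fun z => fock_weight alpha (hausdorff mu f) (z.1 +i* z.2))) => //.
- by rewrite /A ltr_wpDl// mulr_ge0 ?fine_ge0// ltW.
- have [mr mi] := measurable_ccont (entire_ccont ehf).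
  apply: measurable_funM; first exact: (measurable_modulus mr mi).
  exact: mw.
- by move=> z; rewrite /X mulr_ge0 ?invr_ge0// mulr_ge0// ltW.
- by move=> z; rewrite mulr_ge0 ?modulus_ge0// expR_ge0.
- rewrite int_nu => [|t /rhoN -> //].
  rewrite (eq_integral (fun t : MR => kappa%:E * (dilation_weight c e t)%:E)%E); last first.
    by move=> t /set_mem; rewrite /= in_itv/= andbT => /rho_D1 ->; rewrite EFinM.
  rewrite ge0_integralZl//; last 3 first.
  + by apply/measurable_EFinP; apply: measurable_funTS; exact: measurable_dilation_weight.
  + by move=> t _; rewrite lee_fin dilation_weight_ge0.
  + by rewrite lee_fin ltW.
  rewrite -(@fineK _ (\int[mu]_(t in D1) _)%E) ?ge0_fin_numE//.
  by rewrite -EFinM lee_fin /A lerDl.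
- move=> z t /[dup] r0 /rho_gt0 t1.
  by rewrite /X /= (rho_D1 t1); exact: XPsi.
- by move=> t /rho_gt0 t1; rewrite -i12; exact: Psi1.
- move=> z; set zz := z.1 +i* z.2.
  rewrite int_nu; last by move=> t /rhoN ->; rewrite mulr0.
  rewrite (eq_integral (fun t : MR => (h z t)%:E * (w z)%:E)%E); last first.
    move=> t /set_mem; rewrite /= in_itv/= andbT => t1.
    rewrite /X /= -EFinM divfK// (rho_D1 t1) gt_eqF// mulr_gt0//.
    exact: dilation_weight_gt0.
  have mhz : measurable_fun D1 (fun t : MR => (h z t)%:E).
    apply/measurable_EFinP; apply: measurable_funTS.
    exact: (measurableT_comp mh (pair1_measurable z)).
  rewrite ge0_integralZr//; last 2 first.
    by move=> t _; rewrite lee_fin.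
    by rewrite lee_fin ltW.
  rewrite muleA /fock_weight EFinM; apply: lee_pmul.
  + by rewrite lee_fin modulus_ge0.
  + by rewrite lee_fin expR_ge0.
  + rewrite hausdorffE//.
    apply: le_modulus_cintegral => //.
    exact: cintegrable_integrand1.
  + by [].
Qed.

End weight_bound.

(** * The operator bound for finite and for infinite q *)

Section norm_bounds.
Variable R : realType.
Local Notation MR := (measurableTypeR R).
Local Notation leb := (@lebesgue_measure R).
Local Notation D1 := (`]1%R, +oo[%classic : set MR).
Variable alpha : R.
Hypothesis alpha0 : 0 < alpha.

Lemma fock_weight_ge0 (f : R[i] -> R[i]) z : 0 <= fock_weight alpha f z.
Proof. by rewrite mulr_ge0 ?modulus_ge0// expR_ge0. Qed.

Lemma measurable_fock_weight (f : R[i] -> R[i]) : ccont f ->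
  measurable_fun [set: MR * MR] (fun z : MR * MR => fock_weight alpha f (z.1 +i* z.2) : MR).
Proof.
move=> cf; have [mr mi] := measurable_ccont cf.
apply: measurable_funM; first exact: (measurable_modulus mr mi).
by apply/measurable_EFinP; exact: measurable_gauss2.
Qed.

Lemma area_ge0 (g : R[i] -> \bar R) : (forall z, 0 <= g z)%E -> (0 <= area_integral g)%E.
Proof. by move=> g0; apply: integral_ge0 => z _; exact: g0. Qed.

(** What remains of the weight at z after the weight at z / t is split off, raised to the power s;
    [g s t] is its area integral. *)
Let gs (s t : R) (z : R[i]) := expR (- (s * (alpha / 2) * (1 - t ^- 2) * modulus z ^+ 2)).
Let kap (s : R) := 2 * pi / (alpha * s).
Let g (s t : R) := kap s / (1 - t ^- 2).

Let kap0 s : 0 < s -> 0 < kap s.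
Proof. by move=> s0; rewrite divr_gt0 ?mulr_gt0// pi_gt0. Qed.

Let gap0 (t : R) : 1 < t -> 0 < 1 - t ^- 2.
Proof.
move=> t1; have t0 : 0 < t by apply: lt_trans t1.
by rewrite subr_gt0 invf_lt1 ?exprn_gt0// exprn_egt1.
Qed.

Let area_gs s t : 0 < s -> 1 < t -> area_integral (fun z => (gs s t z)%:E) = (g s t)%:E.
Proof.
move=> s0 t1; have u0 := gap0 t1.
rewrite /gs area_gauss; last by rewrite !mulr_gt0// invr_gt0.
congr EFin; rewrite /g /kap; move: u0; set u := 1 - _ => u0; field.
by rewrite !gt_eqF.
Qed.

Let measurable_gs s : measurable_fun [set: (MR * MR) * MR]
  (fun q : (MR * MR) * MR => gs s q.2 (q.1.1 +i* q.1.2) : MR).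
Proof.
apply: measurableT_comp; first exact: measurable_expR.
apply: measurable_funN; apply: measurable_funM.
  apply: measurable_funM => //; apply: measurable_funB => //.
  apply: (measurableT_comp (@measurable_inv_fun R)).
  by apply: measurable_funX; exact: measurable_snd.
apply: measurable_funX.
have [mr mi] := measurable_ccont (@ccont_id R).
exact: (measurableT_comp (measurable_modulus mr mi) (@measurable_fst _ _ (MR * MR)%type MR)).
Qed.

(** The absolute value keeps the normalizing factor of the Gaussian nonnegative for every t, as
    required of [Psi]; for t > 1 it changes nothing. *)
Let measurable_gap s : measurable_fun [set: (MR * MR) * MR]
  (fun q : (MR * MR) * MR => `|1 - (q.2 : R) ^- 2| / kap s : MR).
Proof.
have m : measurable_fun [set: (MR * MR) * MR] (fun q : (MR * MR) * MR => 1 - (q.2 : R) ^- 2 : MR).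
  apply: measurable_funB => //; apply: (measurableT_comp (@measurable_inv_fun R)).
  by apply: measurable_funX; exact: measurable_snd.
by apply: measurable_funM => //; exact: (measurableT_comp (@normr_measurable R setT) m).
Qed.

(** Rests on |z|^2 = |z / t|^2 + (1 - t^-2) |z|^2. *)
Let weight_split (f : R[i] -> R[i]) z (t : R) : 1 < t ->
  modulus (f (z / t%:C)) * expR (- (alpha / 2 * modulus z ^+ 2)) =
  fock_weight alpha f (z / t%:C) * gs 1 t z.
Proof.
move=> t1; have t0 : 0 < t by apply: lt_trans t1.
rewrite /fock_weight /gs -[RHS]mulrA -expRD; congr (_ * expR _).
rewrite modulusM modulusV modulus_real gtr0_norm//; field; exact: lt0r_neq0.
Qed.

Let gs_powR s t z : gs 1 t z `^ s = gs s t z.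
Proof.
rewrite /powR gt_eqF ?expR_gt0// expRK /gs mul1r; congr expR; ring.
Qed.

Variables (mu : {measure set MR -> \bar R}) (p c e : R).
Hypotheses (p1 : 1 <= p) (c01 : 0 < c <= 1) (e0 : e <= 0).
Hypothesis int_e : (\int[mu]_(t in `[1%R, +oo[) (((t : R) `^ e))%:E < +oo)%E.
Hypothesis sum_mu : (\sum_(0 <= n <oo)
   (hausdorff_moment mu n * ((n.+1%:R : R) `^ (c - 1))%:E) < +oo)%E.

Let c0 : 0 < c. Proof. by case/andP: c01. Qed.
Let p0 : 0 < p. Proof. exact: lt_le_trans p1. Qed.
Let s := c^-1.
Let s0 : 0 < s. Proof. by rewrite invr_gt0. Qed.
Let kappa := kap s `^ c.
Let kappa0 : 0 < kappa. Proof. by rewrite powR_gt0// kap0. Qed.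

Let A := kappa * fine (\int[mu]_(t in D1) (dilation_weight c e t)%:E)%E + 1.

Let mu01 := moments_null c01 sum_mu.
Let mu_inv := moments_inv sum_mu.
Let mu_w := moments_weight c01 e0 int_e sum_mu.

(** The weight is distributed: t^(1 + e) goes to the dilated function, and g^c, which is the L^s
    norm of the Gaussian, to the Gaussian. *)
Let hw_split (f : R[i] -> R[i]) (z : MR * MR) (t : R) : 1 < t ->
  modulus (f ((z.1 +i* z.2) / t%:C) / t%:C) * expR (- (alpha / 2 * modulus (z.1 +i* z.2) ^+ 2))
   / (kappa * dilation_weight c e t) =
  fock_weight alpha f ((z.1 +i* z.2) / t%:C) / t `^ (1 + e) * (gs 1 t (z.1 +i* z.2) / g s t `^ c).
Proof.
move=> t1; have t0 : 0 < t by apply: lt_trans t1.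
have u0 := gap0 t1.
rewrite modulusM modulusV modulus_real gtr0_norm// [X in X / (_ * _) = _]mulrAC weight_split//.
rewrite /g powRM ?invr_ge0 ?(ltW u0) ?(ltW (kap0 s0))// powRV ?(ltW u0)//.
rewrite /dilation_weight powRD; last by rewrite (gt_eqF t0) implybT.
rewrite powRr1 ?(ltW t0)// -/kappa; field.
by rewrite (gt_eqF kappa0) (gt_eqF t0) !gt_eqF ?powR_gt0.
Qed.

Lemma cintegrable_of_sum (f : R[i] -> R[i]) z : entire f ->
  cintegrable mu `]0, +oo[ (hausdorff_integrand f z).
Proof. by move=> /entire_ccont cf; exact: (cintegrable_integrand mu01 mu_inv). Qed.

Lemma entire_of_sum (f : R[i] -> R[i]) : entire f -> entire (hausdorff mu f).
Proof. exact: (hausdorff_entire mu01 mu_inv). Qed.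

Let A0 : 0 < A.
Proof.
rewrite /A ltr_wpDl// mulr_ge0 ?(ltW kappa0)// fine_ge0//.
by apply: integral_ge0 => t _; rewrite lee_fin dilation_weight_ge0.
Qed.

(** Here s = p. The bound on f contributes b^p, and the p-th power of the Gaussian divided by its
    area integral serves as [Psi]. *)
Lemma norm_bound_oo (f : R[i] -> R[i]) (b : R) : entire f -> c = p^-1 -> e = - 1 -> 0 < b ->
  (forall z, fock_weight alpha f z <= b) ->
  (area_integral (fun z => ((fock_weight alpha (hausdorff mu f) z) `^ p)%:E)
   <= ((2 * A) `^ p * b `^ p)%:E)%E.
Proof.
move=> ef cp e1 b0 fb.
have sp : s = p by rewrite /s cp invrK.
pose Psi (q : (MR * MR) * MR) : R := gs s q.2 (q.1.1 +i* q.1.2) * (`|1 - (q.2 : R) ^- 2| / kap s).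
apply: (@hausdorff_weight_bound R mu mu01 mu_inv alpha p c e kappa (b `^ p) f Psi) => //.
- exact: powR_gt0.
- apply: measurable_funM; [exact: measurable_gs|exact: measurable_gap].
- by move=> q; rewrite !mulr_ge0 ?expR_ge0// invr_ge0 ltW// kap0.
- move=> z t t1; have u0 := gap0 t1; rewrite hw_split// e1 subrr powRr0 divr1.
  have gp : 0 < g s t by rewrite divr_gt0// kap0.
  rewrite powRM ?fock_weight_ge0 ?divr_ge0 ?powR_ge0 ?expR_ge0//.
  apply: ler_pM; rewrite ?powR_ge0//.
    by apply: ge0_ler_powR; rewrite ?nnegrE ?fock_weight_ge0 ?(ltW b0) ?(ltW p0).
  rewrite powRM ?expR_ge0 ?invr_ge0 ?powR_ge0// -sp gs_powR powRV ?powR_ge0//.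
  rewrite -powRrM /s mulrN mulfV ?gt_eqF// -/s powR_inv1 ?(ltW gp)//.
  by rewrite /Psi /= ger0_norm ?(ltW u0)// /g invf_div.
- move=> t t1; have u0 := gap0 t1; have k0 := kap0 s0.
  have u : 0 <= `|1 - t ^- 2| / kap s by rewrite divr_ge0// ltW.
  rewrite /Psi /=.
  rewrite (eq_integral (fun z : MR * MR => (gs s t (z.1 +i* z.2))%:E * (`|1 - t ^- 2| / kap s)%:E)%E); last first.
    by move=> z _; rewrite EFinM.
  rewrite ge0_integralZr//; last 2 first.
    + apply/measurable_EFinP; exact: (measurableT_comp (measurable_gs s) (pair2_measurable t)).
    + by move=> z _; rewrite lee_fin expR_ge0.
  have := area_gs s0 t1; rewrite /area_integral => ->.
  rewrite -EFinM lee_fin ger0_norm ?(ltW u0)// /g.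
  by rewrite -invf_div mulVf// gt_eqF// divr_gt0.
Qed.

(** Hoelder's inequality enters pointwise: Young's inequality majorizes the p-th power by a convex
    combination, with weights p / r and p / s, of two densities of integral at most 1, one a dilated
    r-th power of the weight of f and one Gaussian. *)
Lemma norm_bound_fin (f : R[i] -> R[i]) (b r : R) : entire f -> 0 < r ->
  c = p^-1 - r^-1 -> e = 2 / r - 1 -> 0 < b ->
  (area_integral (fun z => ((fock_weight alpha f z) `^ r)%:E) <= (b `^ r)%:E)%E ->
  (area_integral (fun z => ((fock_weight alpha (hausdorff mu f) z) `^ p)%:E)
   <= ((2 * A) `^ p * b `^ p)%:E)%E.
Proof.
move=> ef r0 cE eE b0 fb; have cf := entire_ccont ef.
have prs : p / r + p / s = 1.
  by rewrite /s invrK cE mulrBr mulfV ?gt_eqF// addrC subrK.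
pose dil (q : (MR * MR) * MR) : MR * MR := (q.1.1 * (q.2 : R)^-1, q.1.2 * (q.2 : R)^-1).
have mdil : measurable_fun [set: (MR * MR) * MR] dil.
  have mv : measurable_fun [set: (MR * MR) * MR] (fun q : (MR * MR) * MR => (q.2 : R)^-1 : MR).
    by apply: (measurableT_comp (@measurable_inv_fun R)); exact: measurable_snd.
  apply: measurable_fun_pair; apply: measurable_funM => //.
    by apply: measurableT_comp; [exact: measurable_fst|exact: measurable_fst].
  by apply: measurableT_comp; [exact: measurable_snd|exact: measurable_fst].
pose P (z : MR * MR) : R := fock_weight alpha f (z.1 +i* z.2) `^ r.
have mP : measurable_fun [set: MR * MR] (P : _ -> MR).
  by apply: (measurableT_comp (measurable_powR r)); exact: measurable_fock_weight.
have P0 z : 0 <= P z by exact: powR_ge0.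
pose P1 (q : (MR * MR) * MR) : R := P (dil q) * ((p / r) * (b `^ r)^-1 * ((q.2 : R) ^+ 2)^-1).
pose P2 (q : (MR * MR) * MR) : R := gs s q.2 (q.1.1 +i* q.1.2) * (`|1 - (q.2 : R) ^- 2| / kap s) * (p / s).
have k0 := kap0 s0.
have P10 q : 0 <= P1 q.
  by rewrite !mulr_ge0// ?invr_ge0 ?powR_ge0 ?sqr_ge0// ltW.
have P20 q : 0 <= P2 q.
  by rewrite !mulr_ge0 ?expR_ge0// ?invr_ge0 ltW.
have mP1 : measurable_fun [set: (MR * MR) * MR] (P1 : _ -> MR).
  apply: measurable_funM; first exact: (measurableT_comp mP mdil).
  apply: measurable_funM => //; apply: (measurableT_comp (@measurable_inv_fun R)).
  by apply: measurable_funX; exact: measurable_snd.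
have mP2 : measurable_fun [set: (MR * MR) * MR] (P2 : _ -> MR).
  apply: measurable_funM => //.
  apply: measurable_funM; [exact: measurable_gs|exact: measurable_gap].
apply: (@hausdorff_weight_bound R mu mu01 mu_inv alpha p c e kappa (b `^ p) f
  (fun q => P1 q + P2 q)) => //.
- exact: powR_gt0.
- exact: measurable_funD.
- by move=> q; rewrite addr_ge0.
- move=> z t t1; have u0 := gap0 t1; rewrite hw_split//.
  have t0 : 0 < t by apply: lt_trans t1.
  have gp : 0 < g s t by rewrite divr_gt0.
  have -> : 1 + e = 2 / r by rewrite eE addrC subrK.
  set Phi := fock_weight alpha f _.
  have Phi0 : 0 <= Phi by exact: fock_weight_ge0.
  have tr0 : 0 < t `^ (2 / r) by rewrite powR_gt0.
  (* Dividing by t^(2/r) offsets the factor t^2 of a dilated area integral, so that a^r has integral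
     at most 1. *)
  pose a := Phi / (b * t `^ (2 / r)).
  have a0 : 0 <= a by rewrite divr_ge0// mulr_ge0// ltW.
  set b' := gs 1 t _ / _.
  have b'0 : 0 <= b' by rewrite divr_ge0 ?powR_ge0 ?expR_ge0.
  have -> : Phi / t `^ (2 / r) * b' = b * (a * b').
    by rewrite /a; field; rewrite !gt_eqF.
  have -> : (b * (a * b')) `^ p = b `^ p * (a * b') `^ p.
    exact: (powRM _ (ltW b0) (mulr_ge0 a0 b'0)).
  apply: ler_wpM2l; first exact: powR_ge0.
  apply: le_trans (young3 a0 b'0 p0 r0 s0 prs) _.
  rewrite le_eqVlt; apply/orP; left; apply/eqP; congr (_ + _).
    have m1 : 0 <= b * t `^ (2 / r) by exact: (mulr_ge0 (ltW b0) (ltW tr0)).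
    rewrite /a (powRM _ Phi0) ?invr_ge0// powRV// powRN (powRM _ (ltW b0) (ltW tr0)).
    rewrite -powRrM divfK ?gt_eqF// powR_mulrn ?(ltW t0)//.
    rewrite /P1 /P /dil /= /Phi.
    have -> : z.1 * t^-1 +i* (z.2 * t^-1) = (z.1 +i* z.2) / t%:C.
      by rewrite -fmorphV; apply: complexP => /=; ring.
    by rewrite invfM; ring.
  rewrite /b' powRM ?expR_ge0 ?invr_ge0 ?powR_ge0// gs_powR powRV ?powR_ge0//.
  rewrite -powRrM /s mulrN mulfV ?gt_eqF// -/s powR_inv1 ?(ltW gp)//.
  by rewrite /P2 /= ger0_norm ?(ltW u0)// /g invf_div; ring.
- move=> t t1; have u0 := gap0 t1.
  have t0 : 0 < t by apply: lt_trans t1.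
  have u : 0 <= `|1 - t ^- 2| / kap s by rewrite divr_ge0// ltW.
  have mP1t : measurable_fun [set: MR * MR] (fun z => (P1 (z, t))%:E).
    by apply/measurable_EFinP; exact: (measurableT_comp mP1 (pair2_measurable t)).
  have mP2t : measurable_fun [set: MR * MR] (fun z => (P2 (z, t))%:E).
    by apply/measurable_EFinP; exact: (measurableT_comp mP2 (pair2_measurable t)).
  rewrite (eq_integral (fun z : MR * MR => (P1 (z, t))%:E + (P2 (z, t))%:E)%E); last first.
    by move=> z _; rewrite EFinD.
  rewrite ge0_integralD//; last 2 first.
    + by move=> z _; rewrite lee_fin.
    + by move=> z _; rewrite lee_fin.
  have -> : (1 = (p / r)%:E + (p / s)%:E :> \bar R)%E by rewrite -EFinD prs.
  apply: leeD.
    pose v := (p / r) * (b `^ r)^-1 * (t ^+ 2)^-1.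
    have v0 : 0 <= v by rewrite !mulr_ge0// ?invr_ge0 ?powR_ge0 ?sqr_ge0// ltW.
    rewrite (eq_integral (fun z : MR * MR => (P (z.1 / t, z.2 / t))%:E * v%:E)%E); last first.
      by move=> z _; rewrite -EFinM.
    rewrite ge0_integralZr//; last 2 first.
      + by apply/measurable_EFinP; exact: (measurableT_comp mP (measurableT_comp mdil (pair2_measurable t))).
      + by move=> z _; rewrite lee_fin.
    have mPE : measurable_fun [set: MR * MR] (fun z => (P z)%:E) by exact/measurable_EFinP.
    have PE0 z : (0 <= (P z)%:E)%E by rewrite lee_fin.
    rewrite (area_scale t0 mPE PE0).
    apply: (@le_trans _ _ ((t ^+ 2)%:E * (b `^ r)%:E * v%:E)%E).
      apply: lee_wpmul2r; first by rewrite lee_fin.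
      by apply: lee_wpmul2l; [rewrite lee_fin sqr_ge0|exact: fb].
    rewrite -!EFinM lee_fin /v le_eqVlt; apply/orP; left; apply/eqP.
    by field; rewrite !gt_eqF ?powR_gt0.
  rewrite (eq_integral (fun z : MR * MR => (gs s t (z.1 +i* z.2))%:E * (`|1 - t ^- 2| / kap s * (p / s))%:E)%E); last first.
    by move=> z _; rewrite -EFinM mulrA.
  rewrite ge0_integralZr//; last 3 first.
    + apply/measurable_EFinP; exact: (measurableT_comp (measurable_gs s) (pair2_measurable t)).
    + by move=> z _; rewrite lee_fin expR_ge0.
    + by rewrite lee_fin mulr_ge0// divr_ge0// ltW.
  have := area_gs s0 t1; rewrite /area_integral => ->.
  rewrite -EFinM lee_fin ger0_norm ?(ltW u0)// /g.
  by rewrite mulrA -invf_div mulVf ?mul1r// gt_eqF// divr_gt0.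
Qed.

End norm_bounds.

(** * From area integrals to Fock norms *)

Section fock_norm.
Variable R : realType.
Local Notation MR := (measurableTypeR R).
Variable alpha : R.
Hypothesis alpha0 : 0 < alpha.

Definition fock_cst (r : R) : R := alpha * r / (2 * pi).

Lemma fock_cst_gt0 r : 0 < r -> 0 < fock_cst r.
Proof. by move=> r0; rewrite divr_gt0 ?mulr_gt0// pi_gt0. Qed.

Lemma area_fock_ge0 (f : R[i] -> R[i]) (r : R) :
  (0 <= area_integral (fun z => ((fock_weight alpha f z) `^ r)%:E))%E.
Proof. by apply: area_ge0 => z; rewrite lee_fin powR_ge0. Qed.

Lemma area_le_fock_norm (f : R[i] -> R[i]) (r b : R) : 0 < r -> 0 <= b ->
  (fock_norm alpha r%:E f <= b%:E)%E ->
  (area_integral (fun z => ((fock_weight alpha f z) `^ r)%:E)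
    <= ((fock_cst r `^ (- r^-1) * b) `^ r)%:E)%E.
Proof.
move=> r0 b0 H; have k0 := fock_cst_gt0 r0.
set I := area_integral _; have I0 : (0 <= I)%E := area_fock_ge0 f r.
have kI0 : (0 <= (fock_cst r)%:E * I)%E by rewrite mule_ge0// lee_fin ltW.
have : ((fock_cst r)%:E * I <= (b `^ r)%:E)%E.
  have -> : ((fock_cst r)%:E * I = (((fock_cst r)%:E * I) `^ r^-1) `^ r)%E.
    by rewrite -poweRrM mulVf ?gt_eqF// poweRe1.
  rewrite -poweR_EFin; apply: gt0_ler_poweR.
  - exact: ltW.
  - by rewrite in_itv/= poweR_ge0 leey.
  - by rewrite in_itv/= lee_fin b0 leey.
  - exact: H.
move=> H2; rewrite powRM ?powR_ge0// -powRrM mulNr mulVf ?gt_eqF// powR_inv1 ?(ltW k0)//.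
rewrite EFinM.
have -> : I = ((fock_cst r)^-1%:E * ((fock_cst r)%:E * I))%E.
  by rewrite muleA -EFinM mulVf ?mul1e// gt_eqF.
by apply: lee_wpmul2l => //; rewrite lee_fin invr_ge0 ltW.
Qed.

Lemma fock_norm_le_area (f : R[i] -> R[i]) (r b : R) : 0 < r -> 0 <= b ->
  (area_integral (fun z => ((fock_weight alpha f z) `^ r)%:E) <= (b `^ r)%:E)%E ->
  (fock_norm alpha r%:E f <= (fock_cst r `^ r^-1 * b)%:E)%E.
Proof.
move=> r0 b0 H; have k0 := fock_cst_gt0 r0.
have I0 := area_fock_ge0 f r.
rewrite /fock_norm -/(fock_cst r) (_ : fock_cst r `^ r^-1 * b = (fock_cst r * b `^ r) `^ r^-1); last first.
  by rewrite powRM ?powR_ge0 ?(ltW k0)// -powRrM mulfV ?gt_eqF// powRr1.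
rewrite -poweR_EFin; apply: gt0_ler_poweR.
- by rewrite invr_ge0 ltW.
- by rewrite in_itv/= leey mule_ge0// lee_fin ltW.
- by rewrite in_itv/= leey lee_fin mulr_ge0 ?powR_ge0 ?ltW.
- by rewrite [leRHS]EFinM; apply: lee_wpmul2l => //; rewrite lee_fin ltW.
Qed.

Lemma fock_norm_ge0 (f : R[i] -> R[i]) (q : \bar R) : (0 <= fock_norm alpha q f)%E.
Proof.
case: q => [r| |] //=; first exact: poweR_ge0.
apply: le_trans (_ : ((fock_weight alpha f 0)%:E <= _)%E).
  by rewrite lee_fin fock_weight_ge0.
by apply: ereal_sup_ubound; exists 0.
Qed.

Lemma fock_weight_le_norm (f : R[i] -> R[i]) (b : R) z :
  (fock_norm alpha +oo f <= b%:E)%E -> fock_weight alpha f z <= b.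
Proof.
move=> H; rewrite -lee_fin; apply: le_trans H.
by apply: ereal_sup_ubound; exists z.
Qed.

Lemma bounded_of_area_bound (q : \bar R) (p M : R) (mu : {measure set MR -> \bar R}) :
  0 < p -> 0 < M ->
  (forall f, entire f -> entire (hausdorff mu f)) ->
  (forall f z, entire f -> cintegrable mu `]0, +oo[ (hausdorff_integrand f z)) ->
  (forall f (b : R), entire f -> 0 < b -> (fock_norm alpha q f <= b%:E)%E ->
     (area_integral (fun z => ((fock_weight alpha (hausdorff mu f) z) `^ p)%:E)
      <= ((M * b) `^ p)%:E)%E) ->
  hausdorff_bounded alpha mu q p%:E.
Proof.
move=> p0 M0 He Hi HM.
pose C := fock_cst p `^ p^-1 * M.
have C0 : 0 < C by rewrite mulr_gt0// powR_gt0// fock_cst_gt0.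
have key f : fock alpha q f ->
    (fock_norm alpha p%:E (hausdorff mu f) <= C%:E * fock_norm alpha q f)%E.
  move=> [ef fq].
  have ffin : fock_norm alpha q f \is a fin_num by rewrite ge0_fin_numE// fock_norm_ge0.
  set n := fine (fock_norm alpha q f).
  have nE : fock_norm alpha q f = n%:E by rewrite fineK.
  have n0 : 0 <= n by rewrite fine_ge0// fock_norm_ge0.
  (* The area bound asks for a positive b; b = n + d / C is positive even for n = 0, and C b = C n +
     d. *)
  apply/lee_addgt0Pr => d d0.
  have b0 : 0 < n + d / C by rewrite ltr_wpDl// divr_gt0.
  have nb : (fock_norm alpha q f <= (n + d / C)%:E)%E.
    by rewrite nE lee_fin lerDl divr_ge0// ltW.
  have := HM f _ ef b0 nb => /(fock_norm_le_area p0 (mulr_ge0 (ltW M0) (ltW b0))).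
  move=> /le_trans; apply; rewrite nE -EFinM -EFinD lee_fin mulrA -/C mulrDr.
  by rewrite lerD2l mulrCA mulfV ?mulr1// gt_eqF.
split.
  move=> f ff; have [ef fq] := ff; split; first by move=> z; exact: Hi.
  split; first exact: He.
  apply: le_lt_trans (key f ff) _; apply: lte_mul_pinfty => //.
  by rewrite lee_fin ltW.
by exists C; split.
Qed.

End fock_norm.

Section part_one.
Variable R : realType.
Local Notation MR := (measurableTypeR R).

Lemma exponent_gap_bounds (p : R) (q : \bar R) : 1 <= p -> (2%:E <= q)%E -> (p%:E < q)%E ->
  0 < exponent_gap p q <= 1 /\ two_over q - 1 <= 0.
Proof.
move=> p1; have p0 : 0 < p by exact: lt_le_trans p1.
case: q => [r| |]//=; rewrite ?lee_fin ?lte_fin => r2 pr.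
  have r0 : 0 < r by exact: lt_le_trans r2.
  split; last by rewrite subr_le0 ler_pdivrMr// mul1r.
  rewrite divr_gt0 ?mulr_gt0 ?subr_gt0//= ler_pdivrMr ?mulr_gt0// mul1r.
  by apply: (@le_trans _ _ r); [lra|rewrite ler_peMl// ltW].
by split; [rewrite invr_gt0 p0/= invf_le1|lra].
Qed.

Lemma hausdorff_bounded_of_sum (alpha p : R) (q : \bar R) (mu : {measure set MR -> \bar R}) :
  0 < alpha -> 1 <= p -> (2%:E <= q)%E -> (p%:E < q)%E ->
  (\int[mu]_(t in `[1%R, +oo[) (((t : R) `^ (two_over q - 1))%:E) < +oo)%E ->
  (\sum_(0 <= n <oo)
      (hausdorff_moment mu n * ((n.+1%:R : R) `^ (exponent_gap p q - 1))%:E)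
      < +oo)%E ->
  hausdorff_bounded alpha mu q p%:E.
Proof.
move=> a0 p1 q2 pq Hi Hs; have p0 : 0 < p by exact: lt_le_trans p1.
have [c01 e0] := exponent_gap_bounds p1 q2 pq.
have He : forall f, entire f -> entire (hausdorff mu f) := entire_of_sum c01 Hs.
have Hc f z : entire f -> cintegrable mu `]0, +oo[ (hausdorff_integrand f z).
  by move=> ef; apply: (cintegrable_of_sum c01 Hs).
case: q q2 pq Hi Hs c01 e0 => [r| |]// q2 pq Hi Hs c01 e0.
  have r0 : 0 < r by rewrite lee_fin in q2; exact: lt_le_trans q2.
  have cE : exponent_gap p r%:E = p^-1 - r^-1.
    by rewrite /exponent_gap; field; rewrite !gt_eqF.
  have H f (b : R) (ef : entire f) (b0 : 0 < b) := norm_bound_fin a0 p1 c01 e0 Hi Hs ef r0 cE (erefl _) b0.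
  set A := (X in (2 * X) `^ p) in H.
  have A0 : 0 < A.
    rewrite /A ltr_wpDl// mulr_ge0 ?powR_ge0// fine_ge0// integral_ge0// => t _.
    by rewrite lee_fin dilation_weight_ge0.
  apply: (@bounded_of_area_bound R alpha a0 _ p (2 * A * fock_cst alpha r `^ (- r^-1)) mu p0 _ He Hc).
    by rewrite !mulr_gt0// powR_gt0// fock_cst_gt0.
  move=> f b ef b0 /(area_le_fock_norm a0 r0 (ltW b0)) fb.
  have b'0 : 0 < fock_cst alpha r `^ (- r^-1) * b by rewrite mulr_gt0// powR_gt0// fock_cst_gt0.
  apply: le_trans (H f _ ef b'0 fb) _.
  have A2 : 0 <= 2 * A by rewrite mulr_ge0// ltW.
  by rewrite -(powRM _ A2 (ltW b'0)) mulrA.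
have H f (b : R) (ef : entire f) (b0 : 0 < b) := norm_bound_oo a0 p1 c01 e0 Hi Hs ef (erefl _) (sub0r _) b0.
set A := (X in (2 * X) `^ p) in H.
have A0 : 0 < A.
  rewrite /A ltr_wpDl// mulr_ge0 ?powR_ge0// fine_ge0// integral_ge0// => t _.
  by rewrite lee_fin dilation_weight_ge0.
apply: (@bounded_of_area_bound R alpha a0 _ p (2 * A) mu p0 _ He Hc).
  by rewrite mulr_gt0.
move=> f b ef b0 fb.
apply: le_trans (H f b ef b0 _) _; first by move=> z; exact: fock_weight_le_norm.
have A2 : 0 <= 2 * A by rewrite mulr_ge0// ltW.
by rewrite -(powRM _ A2 (ltW b0)).
Qed.

End part_one.

(** * Orthogonality of monomials *)

Section rotation.
Variable R : realType.
Local Notation MR := (measurableTypeR R).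
Local Notation leb := (@lebesgue_measure R).
Local Notation leb2 := (leb \x leb)%E.

Lemma lebesgue_shift (c : R) (G : MR -> \bar R) :
  measurable_fun [set: MR] G -> (forall x, (0 <= G x)%E) ->
  (\int[leb]_x G ((x : R) + c)%R = \int[leb]_x G x)%E.
Proof.
move=> mG G0.
pose phi0 : MR -> MR := fun x => (x : R) + c.
have mphi : measurable_fun [set: MR] phi0 by exact: measurable_funD.
pose pf : {measure set MR -> \bar R} := measure_function_pushforward__canonical__measure_function_Measure leb mphi.
have nuE A : measurable A -> leb A = pf A.
  apply: lebesgue_measure_unique => X [[a b] _ <-].
  rewrite /pf /= /pushforward /=.
  have -> : phi0 @^-1` `]a, b] = `]a - c, b - c]%classic.
    by apply/seteqP; split => x /=; rewrite !in_itv/= ltrBlDr lerBrDr.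
  rewrite !lebesgue_measure_itv/= !lte_fin ltrD2r.
  by case: ifPn => // ab; rewrite -!EFinB; congr EFin; ring.
have -> : (\int[leb]_x G x = \int[pf]_x G x)%E.
  by apply: eq_measure_integral => A mA _; exact: nuE.
by rewrite ge0_integral_pushforward// preimage_setT.
Qed.

Let measurable_add_scaled (a : R) : measurable_fun [set: MR * MR]
  (fun p : MR * MR => (p.1 : R) + a * (p.2 : R) : MR).
Proof.
apply: measurable_funD; first exact: measurable_fst.
by apply: measurable_funM => //; exact: measurable_snd.
Qed.

Let measurable_add_scaled' (a : R) : measurable_fun [set: MR * MR]
  (fun p : MR * MR => (p.2 : R) + a * (p.1 : R) : MR).
Proof.
apply: measurable_funD; first exact: measurable_snd.
by apply: measurable_funM => //; exact: measurable_fst.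
Qed.

Definition shear1 (a : R) (p : MR * MR) : MR * MR := ((p.1 : R) + a * (p.2 : R), p.2).
Definition shear2 (a : R) (p : MR * MR) : MR * MR := (p.1, (p.2 : R) + a * (p.1 : R)).

Lemma measurable_shear1 a : measurable_fun [set: MR * MR] (shear1 a).
Proof. by apply: measurable_fun_pair => //; exact: measurable_snd. Qed.

Lemma measurable_shear2 a : measurable_fun [set: MR * MR] (shear2 a).
Proof. by apply: measurable_fun_pair => //; exact: measurable_fst. Qed.

Lemma area_shear1 a (G : MR * MR -> \bar R) :
  measurable_fun [set: MR * MR] G -> (forall x, (0 <= G x)%E) ->
  (\int[leb2]_p G (shear1 a p) = \int[leb2]_p G p)%E.
Proof.
move=> mG G0; rewrite [LHS]fubini_tonelli2//; last first.
  exact: (measurableT_comp mG (measurable_shear1 a)).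
rewrite [RHS](fubini_tonelli2 _ mG G0) /fubini_G; apply: eq_integral => y _.
rewrite -(@lebesgue_shift (a * y) (fun x => G (x, y)))//.
by apply: (measurableT_comp mG); exact: pair2_measurable.
Qed.

Lemma area_shear2 a (G : MR * MR -> \bar R) :
  measurable_fun [set: MR * MR] G -> (forall x, (0 <= G x)%E) ->
  (\int[leb2]_p G (shear2 a p) = \int[leb2]_p G p)%E.
Proof.
move=> mG G0; rewrite [LHS]fubini_tonelli1//; last first.
  exact: (measurableT_comp mG (measurable_shear2 a)).
rewrite [RHS](fubini_tonelli1 _ mG G0) /fubini_F; apply: eq_integral => x _.
rewrite -(@lebesgue_shift (a * x) (fun y => G (x, y)))//.
by apply: (measurableT_comp mG); exact: pair1_measurable.
Qed.

Definition rot (u : R[i]) (p : MR * MR) : MR * MR :=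
  (complex.Re (u * ((p.1 : R) +i* (p.2 : R))), complex.Im (u * ((p.1 : R) +i* (p.2 : R)))).

(** A rotation by theta is a product of three shears with parameters -tan(theta/2), sin(theta),
    -tan(theta/2), and shears preserve area by Tonelli's theorem and translation invariance. The
    half-turn is excluded because its tangent is infinite. *)
Lemma rot_shear (u : R[i]) : modulus u = 1 -> complex.Re u != -1 ->
  rot u = shear1 (- complex.Im u / (1 + complex.Re u)) \o
    (shear2 (complex.Im u) \o shear1 (- complex.Im u / (1 + complex.Re u))).
Proof.
move=> u1; have cs := sqr_modulus u; move: cs; rewrite u1 expr1n.
case: u u1 => c s _ /= cs cN1; apply/funext => -[x y]; rewrite /rot /shear1 /shear2 /=.
have c1 : 1 + c != 0 by apply: contra cN1; rewrite addrC addr_eq0.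
set a := - s / (1 + c).
have s2 : s ^+ 2 = (1 - c) * (1 + c) by rewrite -subr_sqr expr1n {1}cs; ring.
have E1 : s * a = c - 1.
  have -> : s * a = - s ^+ 2 / (1 + c) by rewrite /a; ring.
  by rewrite s2; field.
have E2 : a * (1 + c) = - s by rewrite /a divfK.
congr pair.
  have -> : x + a * y + a * (y + s * (x + a * y)) =
     x * (1 + s * a) + y * (a * (1 + c) + a * (1 + s * a - c)) by ring.
  by rewrite E2 E1; ring.
have -> : y + s * (x + a * y) = y * (1 + s * a) + s * x by ring.
by rewrite E1; ring.
Qed.

Lemma area_rot_ge0 u (G : MR * MR -> \bar R) : modulus u = 1 -> complex.Re u != -1 ->
  measurable_fun [set: MR * MR] G -> (forall x, (0 <= G x)%E) ->
  (\int[leb2]_p G (rot u p) = \int[leb2]_p G p)%E.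
Proof.
move=> u1 uN1 mG G0; rewrite (rot_shear u1 uN1) /=.
set a := _ / _; set b := complex.Im u.
rewrite (@area_shear1 a (fun p => G (shear1 a (shear2 b p))))//; last first.
  apply: (measurableT_comp mG); apply: (measurableT_comp (@measurable_shear1 a)).
  exact: measurable_shear2.
rewrite (@area_shear2 b (fun p => G (shear1 a p)))//; last first.
  by apply: (measurableT_comp mG); exact: measurable_shear1.
exact: area_shear1.
Qed.

Lemma area_rot u (G : MR * MR -> \bar R) : modulus u = 1 -> complex.Re u != -1 ->
  measurable_fun [set: MR * MR] G ->
  (\int[leb2]_p G (rot u p) = \int[leb2]_p G p)%E.
Proof.
move=> u1 uN1 mG; rewrite integralE [RHS]integralE; congr (_ - _)%E.
- rewrite -(area_rot_ge0 u1 uN1 (measurable_funepos mG) (funepos_ge0 G)).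
  by apply: eq_integral => p _; rewrite !funeposE.
- rewrite -(area_rot_ge0 u1 uN1 (measurable_funeneg mG) (funeneg_ge0 G)).
  by apply: eq_integral => p _; rewrite !funenegE.
Qed.

Lemma complex_eta (z : R[i]) : complex.Re z +i* complex.Im z = z.
Proof. by case: z. Qed.

Lemma area_rotate u (F : R[i] -> R) : modulus u = 1 -> complex.Re u != -1 ->
  measurable_fun [set: MR * MR] (fun p : MR * MR => F ((p.1 : R) +i* (p.2 : R)) : MR) ->
  area_integral (fun z => (F (u * z))%:E) = area_integral (fun z => (F z)%:E).
Proof.
move=> u1 uN1 mF; rewrite /area_integral.
rewrite -(@area_rot u (fun p => (F (p.1 +i* p.2))%:E) u1 uN1); last exact/measurable_EFinP.
by apply: eq_integral => p _; rewrite /rot /= complex_eta.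
Qed.

Lemma cexp_expn (z : R[i]) n : cexp z ^+ n = cexp (z *+ n).
Proof. by elim: n => [|n IH]; rewrite ?expr0 ?mulr0n ?cexp0// exprS mulrS cexpD IH. Qed.

(** The angle pi / (2 n) lies in [0, pi / 2], away from the half-turn. The target is ['i] and not -1
    because for n = 1 the root of -1 would be the excluded rotation. *)
Lemma root_of_i n : (0 < n)%N -> exists u : R[i],
  [/\ modulus u = 1, complex.Re u != -1 & u ^+ n = 'i].
Proof.
move=> n0; pose th : R := (pi / 2) / n%:R.
exists (cexp (0 +i* th)); split.
- by rewrite modulus_cexp /= expR0.
- rewrite /cexp /= expR0 mul1r gt_eqF//.
  apply: (@lt_le_trans _ _ 0); first by rewrite ltrN10.
  apply: cos_ge0_pihalf; apply/andP; split.
    rewrite (@le_trans _ _ 0)// ?oppr_le0 ?divr_ge0 ?pi_ge0// /th divr_ge0// divr_ge0// pi_ge0.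
  by rewrite /th ler_pdivrMr ?ltr0n// ler_peMr ?divr_ge0 ?pi_ge0// ler1n.
- rewrite cexp_expn.
  have -> : (0 +i* th) *+ n = 0 +i* (pi / 2) :> R[i].
    have E (m : nat) : (0 +i* th) *+ m = 0 +i* (th *+ m) :> R[i].
      by elim: m => [|m IH]; rewrite ?mulr0n// mulrS IH mulrS; apply: complexP => /=; rewrite ?addr0.
    by rewrite E /th -[_ *+ n]mulr_natr divfK// pnatr_eq0 -lt0n.
  by rewrite /cexp /= expR0 cos_pihalf sin_pihalf mulr0 mulr1.
Qed.

End rotation.

(** * A uniform bound for sums of shifted Gaussians *)

Section gauss_sum.
Variable R : realType.

(** Two geometric series of ratio exp(-1/2), one for the integers on each side of x. *)
Definition gauss_sum_bound : R := 2 / (1 - expR (- 2^-1)).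

Let r : R := expR (- 2^-1).
Let r0 : 0 < r. Proof. exact: expR_gt0. Qed.
Let r1 : r < 1. Proof. by rewrite expR_lt1 oppr_lt0 invr_gt0. Qed.

Lemma gauss_sum_bound_gt0 : 0 < gauss_sum_bound.
Proof. by rewrite divr_gt0// subr_gt0. Qed.

Let geo n : \sum_(0 <= i < n) r ^+ i <= (1 - r)^-1.
Proof.
have := @geometric_le_lim R n 1 r ler01 r0; rewrite gtr0_norm// => /(_ r1).
rewrite mul1r seriesEnat /=; apply: le_trans.
by rewrite le_eqVlt; apply/orP; left; apply/eqP; apply: eq_bigr => i _; rewrite mul1r.
Qed.

Let term_le (y : R) (i : nat) : i%:R <= `|y| -> expR (- (y ^+ 2 / 2)) <= r ^+ i.
Proof.
move=> iy; rewrite /r -expRM_natl ler_expR mulrN lerN2 ler_wpM2r//.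
rewrite -real_normK ?num_real//; apply: (@le_trans _ _ (i%:R ^+ 2)).
  by rewrite -natrX ler_nat; case: i {iy} => // i; rewrite expnS leq_pmulr.
by rewrite lerXn2r ?nnegrE.
Qed.

(** As j <= x < j + 1, both k = j - i and k = j + 1 + i are at distance at least i from x; then y^2
    >= i^2 >= i compares each term with [r ^+ i]. *)
Lemma gauss_sum (x : R) K : 0 <= x ->
  \sum_(0 <= k < K) expR (- ((x - k%:R) ^+ 2 / 2)) <= gauss_sum_bound.
Proof.
move=> x0; have /andP[j1 j2] := truncn_itv x0; set j := Num.truncn x in j1 j2.
apply: (@le_trans _ _ (\sum_(0 <= k < j.+1 + K) expR (- ((x - k%:R) ^+ 2 / 2)))).
  rewrite [leRHS](big_cat_nat (n:=K)) ?leq_addl//= lerDl.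
  by apply: sumr_ge0 => k _; exact: expR_ge0.
rewrite (big_cat_nat (n:=j.+1)) ?leq_addr//=.
have -> : gauss_sum_bound = (1 - r)^-1 + (1 - r)^-1.
  by rewrite /gauss_sum_bound -/r mulrDl mul1r.
apply: lerD.
  apply: le_trans (geo j.+1); rewrite big_nat_rev /= add0n.
  rewrite big_nat [leRHS]big_nat; apply: ler_sum => k /andP[_ kj].
  rewrite subSS; apply: term_le.
  rewrite natrB; last by rewrite -ltnS.
  have : x - (j%:R - k%:R) <= `|x - (j%:R - k%:R)| := ler_norm _.
  apply: le_trans; lra.
apply: le_trans (geo K); rewrite -{1}[j.+1]add0n big_addn addKn.
apply: ler_sum => k _; apply: term_le.
rewrite distrC natrD; apply: le_trans (ler_norm _).
rewrite -/j in j2; lra.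
Qed.

End gauss_sum.

(** * Peaked monomials and the decay of the moments *)

Section test_functions.
Variable R : realType.
Local Notation MR := (measurableTypeR R).
Local Notation leb := (@lebesgue_measure R).
Local Notation leb2 := (leb \x leb)%E.
Variable alpha : R.
Hypothesis alpha0 : 0 < alpha.

Let sa := Num.sqrt alpha.
Let sa0 : 0 < sa. Proof. by rewrite sqrtr_gt0. Qed.

(* The maximum of r^n exp(- alpha r^2 / 2) for n = k^2. *)
Definition peak (k : nat) : R := (k%:R / sa) ^+ (k ^ 2) * expR (- (k%:R ^+ 2 / 2)).

Lemma peak_gt0 k : 0 < peak k.
Proof.
rewrite mulr_gt0 ?expR_gt0//; case: k => [|k]; first by rewrite expr0.
by rewrite exprn_gt0// divr_gt0// ltr0n.
Qed.

Let peak0 : peak 0 = 1.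
Proof. by rewrite /peak (_ : (0 ^ 2)%N = 0%N)// expr0 mul1r expr2 mul0r mul0r oppr0 expR0. Qed.

Definition peak_monomial (k : nat) (z : R[i]) : R[i] := ((peak k)^-1)%:C * z ^+ (k ^ 2).
Local Notation E := peak_monomial.
Local Notation W := (fock_weight alpha).

Lemma entire_peak_monomial k : entire (E k).
Proof. exact: (entireM (@entire_cst R ((peak k)^-1)%:C) (@entireX R (k ^ 2))). Qed.

Let WE k z : W (E k) z = (peak k)^-1 * modulus z ^+ (k ^ 2) * expR (- ((sa * modulus z) ^+ 2 / 2)).
Proof.
rewrite /fock_weight /E modulusM modulus_real modulusX.
rewrite (ger0_norm (ltW _)) ?invr_gt0 ?peak_gt0//; congr (_ * expR (- _)).
by rewrite exprMn sqr_sqrtr ?(ltW alpha0)//; ring.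
Qed.

(** With x = sqrt(alpha) |z| the left side is (x/k)^(k^2) exp((k^2 - x^2)/2), and bounding x/k by
    exp(x/k - 1) completes the square. The case k = 0 has no quotient and is an equality. *)
Lemma peak_monomial_le k z :
  W (E k) z <= expR (- ((sa * modulus z - k%:R) ^+ 2 / 2)).
Proof.
rewrite WE; set x := sa * modulus z.
have -> : modulus z = x / sa by rewrite /x mulrAC mulfV ?mul1r// gt_eqF.
have x0 : 0 <= x by rewrite mulr_ge0 ?modulus_ge0// ltW.
case: k => [|k]; first by rewrite peak0 invr1 mul1r (_ : (0 ^ 2)%N = 0%N)// expr0 mul1r subr0.
rewrite /peak; set n := k.+1; have n0 : (0 : R) < n%:R by rewrite ltr0n.
have -> : (((n%:R / sa) ^+ (n ^ 2) * expR (- (n%:R ^+ 2 / 2)))^-1 * (x / sa) ^+ (n ^ 2)) * expR (- (x ^+ 2 / 2)) =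
    (x / n%:R) ^+ (n ^ 2) * expR (n%:R ^+ 2 / 2 - x ^+ 2 / 2).
  rewrite expRD invfM -expRN opprK !expr_div_n.
  field; rewrite ?gt_eqF ?exprn_gt0//.
have H : (x / n%:R) ^+ (n ^ 2) <= expR (n%:R * x - n%:R ^+ 2).
  have -> : n%:R * x - n%:R ^+ 2 = (n ^ 2)%:R * (x / n%:R - 1).
    by rewrite natrX; field; exact: lt0r_neq0.
  rewrite expRM_natl lerXn2r ?nnegrE ?expR_ge0 ?divr_ge0 ?(ltW n0)//.
  by have := expR_ge1Dx (x / n%:R - 1); rewrite addrC subrK.
apply: le_trans (ler_wpM2r (expR_ge0 _) H) _.
by rewrite -expRD ler_expR le_eqVlt; apply/orP; left; apply/eqP; field.
Qed.

(** Uses the opposite inequality x/k >= exp(1 - k/x), for x = sqrt(alpha) |z|. The exponent that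
    results is at least -3/2 as long as x - k lies in [0, 1]. *)
Lemma peak_monomial_ge k z : k%:R <= sa * modulus z < k.+1%:R ->
  expR (- (3 / 2)) <= W (E k) z.
Proof.
rewrite WE; set x := sa * modulus z => /andP[kx xk].
have -> : modulus z = x / sa by rewrite /x mulrAC mulfV ?mul1r// gt_eqF.
have x0 : 0 <= x by apply: le_trans kx.
case: k kx xk => [|k] kx xk.
  rewrite peak0 invr1 mul1r (_ : (0 ^ 2)%N = 0%N)// expr0 mul1r ler_expR lerN2.
  have : x ^+ 2 <= 1 by rewrite expr_le1// ltW.
  lra.
rewrite /peak; set n := k.+1; have n0 : (0 : R) < n%:R by rewrite ltr0n.
have xp : 0 < x by exact: lt_le_trans kx.
have -> : (((n%:R / sa) ^+ (n ^ 2) * expR (- (n%:R ^+ 2 / 2)))^-1 * (x / sa) ^+ (n ^ 2)) * expR (- (x ^+ 2 / 2)) =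
    (x / n%:R) ^+ (n ^ 2) * expR (n%:R ^+ 2 / 2 - x ^+ 2 / 2).
  rewrite expRD invfM -expRN opprK !expr_div_n.
  field; rewrite ?gt_eqF ?exprn_gt0//.
have H : expR ((n ^ 2)%:R * (1 - n%:R / x)) <= (x / n%:R) ^+ (n ^ 2).
  rewrite expRM_natl lerXn2r ?nnegrE ?expR_ge0 ?divr_ge0 ?(ltW n0)//.
  rewrite -[leRHS]invf_div -[leLHS]invrK lef_pV2 ?posrE ?invr_gt0 ?expR_gt0 ?divr_gt0//.
  rewrite -expRN opprB; have := expR_ge1Dx (n%:R / x - 1); by rewrite addrC subrK.
apply: le_trans (ler_wpM2r (expR_ge0 _) H); rewrite -expRD ler_expR natrX.
have xn : x <= n%:R + 1 by rewrite natr1 ltW.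
move: kx xn n0 xp; rewrite -/n; move: (n%:R : R) => y kx xn n0 xp {H xk}.
rewrite -(ler_pM2r xp).
have -> : (y ^+ 2 * (1 - y / x) + (y ^+ 2 / 2 - x ^+ 2 / 2)) * x =
   y ^+ 2 * (x - y) + (y ^+ 2 / 2 - x ^+ 2 / 2) * x.
  by field; rewrite gt_eqF.
set d := x - y; have xE : x = y + d by rewrite /d; ring.
have d0 : 0 <= d by rewrite subr_ge0.
have d1 : d <= 1 by rewrite /d; lra.
rewrite xE -subr_ge0.
(* Both summands on the right are visibly nonnegative for 0 <= d <= 1. *)
have -> : y ^+ 2 * d + (y ^+ 2 / 2 - (y + d) ^+ 2 / 2) * (y + d) - - (3 / 2) * (y + d) =
  3 / 2 * (y * (1 - d ^+ 2)) + d * (3 - d ^+ 2) / 2 by field.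
have d2 : d ^+ 2 <= 1 by rewrite expr_le1.
apply: addr_ge0; first by rewrite !mulr_ge0 ?(ltW n0)// subr_ge0.
by rewrite divr_ge0// mulr_ge0//; lra.
Qed.

Lemma peak_monomial_le1 k z : W (E k) z <= 1.
Proof.
apply: le_trans (peak_monomial_le k z) _.
by rewrite -expR0 ler_expR oppr_le0 divr_ge0 ?sqr_ge0.
Qed.

(** Half of the Gaussian decay is given up so that the difference of exponents becomes a square; the
    result is an integrable majorant. *)
Lemma peak_monomial_gauss k z :
  W (E k) z <= expR (k%:R ^+ 2 / 2) * expR (- (alpha / 4 * modulus z ^+ 2)).
Proof.
apply: le_trans (peak_monomial_le k z) _; rewrite -expRD ler_expR.
set x := sa * modulus z.
have -> : alpha / 4 * modulus z ^+ 2 = x ^+ 2 / 4.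
  by rewrite /x exprMn sqr_sqrtr ?(ltW alpha0)//; ring.
rewrite -subr_ge0.
have -> : k%:R ^+ 2 / 2 - x ^+ 2 / 4 - - ((x - k%:R) ^+ 2 / 2) = (x / 2 - k%:R) ^+ 2 by field.
exact: sqr_ge0.
Qed.

Lemma peak_monomial_sum_le K z :
  \sum_(0 <= k < K) W (E k) z <= gauss_sum_bound R.
Proof.
have x0 : 0 <= sa * modulus z by rewrite mulr_ge0 ?modulus_ge0// ltW.
apply: le_trans (gauss_sum K x0).
by apply: ler_sum => k _; exact: peak_monomial_le.
Qed.

End test_functions.

(** * The Fock inner product and rotations *)

Section fock_pairing.
Variable R : realType.
Local Notation MR := (measurableTypeR R).
Local Notation leb := (@lebesgue_measure R).
Local Notation leb2 := (leb \x leb)%E.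
Variable alpha : R.
Local Notation W := (fock_weight alpha).
Implicit Types f g : R[i] -> R[i].

Let wt (z : R[i]) : R := expR (- (alpha / 2 * modulus z ^+ 2)).

(* The real and imaginary parts of the integrand of the Fock inner product. *)
Definition fock_pair f g z : R :=
  (complex.Re (f z) * complex.Re (g z) + complex.Im (f z) * complex.Im (g z)) * wt z ^+ 2.
Definition fock_cross f g z : R :=
  (complex.Im (f z) * complex.Re (g z) - complex.Re (f z) * complex.Im (g z)) * wt z ^+ 2.

Lemma fock_pairE f g z : fock_pair f g z = complex.Re (f z * (g z)^*) * wt z ^+ 2.
Proof. by rewrite /fock_pair ReM; case: (g z) => a b /=; rewrite mulrN opprK. Qed.

Lemma fock_crossE f g z : fock_cross f g z = complex.Im (f z * (g z)^*) * wt z ^+ 2.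
Proof. by rewrite /fock_cross ImM; case: (g z) => a b /=; rewrite mulrN addrC. Qed.

Lemma fock_pairC f g z : fock_pair f g z = fock_pair g f z.
Proof. by rewrite /fock_pair; congr (_ * _); ring. Qed.

Lemma fock_pair_diag f z : fock_pair f f z = W f z ^+ 2.
Proof. by rewrite /fock_pair /fock_weight -/(wt z) exprMn sqr_modulus; congr (_ * _); rewrite !expr2. Qed.

Let weightM f g z : W f z * W g z = modulus (f z * (g z)^*) * wt z ^+ 2.
Proof. by rewrite modulusM modulus_conj /fock_weight -/(wt z); ring. Qed.

Lemma fock_pair_le f g z : `|fock_pair f g z| <= W f z * W g z.
Proof.
rewrite weightM fock_pairE normrM (ger0_norm (sqr_ge0 _)).
by rewrite ler_wpM2r ?sqr_ge0 ?normr_Re_le.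
Qed.

Lemma fock_cross_le f g z : `|fock_cross f g z| <= W f z * W g z.
Proof.
rewrite weightM fock_crossE normrM (ger0_norm (sqr_ge0 _)).
by rewrite ler_wpM2r ?sqr_ge0 ?normr_Im_le.
Qed.

Let measurable_wt2 : measurable_fun [set: MR * MR] (fun p : MR * MR => wt ((p.1 : R) +i* (p.2 : R)) ^+ 2 : MR).
Proof. by apply: measurable_funX; apply/measurable_EFinP; exact: measurable_gauss2. Qed.

Lemma measurable_fock_pair f g : ccont f -> ccont g ->
  measurable_fun [set: MR * MR] (fun p : MR * MR => fock_pair f g ((p.1 : R) +i* (p.2 : R)) : MR).
Proof.
move=> /measurable_ccont[fr fi] /measurable_ccont[gr gi].
apply: measurable_funM => //; apply: measurable_funD; exact: measurable_funM.
Qed.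

Lemma measurable_fock_cross f g : ccont f -> ccont g ->
  measurable_fun [set: MR * MR] (fun p : MR * MR => fock_cross f g ((p.1 : R) +i* (p.2 : R)) : MR).
Proof.
move=> /measurable_ccont[fr fi] /measurable_ccont[gr gi].
apply: measurable_funM => //; apply: measurable_funB; exact: measurable_funM.
Qed.

Let wt_rot u z : modulus u = 1 -> wt (u * z) = wt z.
Proof. by move=> u1; rewrite /wt modulusM u1 mul1r. Qed.

Let conjM (a b : R[i]) : (a * b)^* = a^* * b^*.
Proof. by case: a b => a b [c d]; apply: complexP => /=; ring. Qed.

(* Rotating by u multiplies f conj(g) by 'i, so its integral A satisfies A = 'i A. *)
Lemma fock_pair_orthogonal f g (u U V : R[i]) : ccont f -> ccont g ->
  modulus u = 1 -> complex.Re u != -1 ->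
  (forall z, f (u * z) = U * f z) -> (forall z, g (u * z) = V * g z) -> U * V^* = 'i ->
  leb2.-integrable [set: MR * MR] (fun p : MR * MR => (W f ((p.1 : R) +i* (p.2 : R)) * W g ((p.1 : R) +i* (p.2 : R)))%:E) ->
  area_integral (fun z => (fock_pair f g z)%:E) = 0%E.
Proof.
move=> cf cg u1 uN1 fU gV UV ip.
have prod z : f (u * z) * (g (u * z))^* = 'i * (f z * (g z)^*).
  by rewrite fU gV conjM mulrACA UV.
have E1 z : fock_pair f g (u * z) = - fock_cross f g z.
  by rewrite fock_pairE fock_crossE prod (wt_rot _ u1) ReM /= mul0r mul1r sub0r mulNr.
have E2 z : fock_cross f g (u * z) = fock_pair f g z.
  by rewrite fock_pairE fock_crossE prod (wt_rot _ u1) ImM /= mul0r mul1r add0r.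
have mp := measurable_fock_pair cf cg; have mc := measurable_fock_cross cf cg.
have A1 := area_rotate u1 uN1 mc.
have A2 := area_rotate u1 uN1 mp.
have dom (F : R[i] -> R) :
    measurable_fun [set: MR * MR] (fun p : MR * MR => F ((p.1 : R) +i* (p.2 : R)) : MR) ->
    (forall z, `|F z| <= W f z * W g z) ->
    leb2.-integrable [set: MR * MR] (fun p : MR * MR => (F ((p.1 : R) +i* (p.2 : R)))%:E).
  move=> mF FW; apply: (le_integrable measurableT _ _ ip); first exact/measurable_EFinP.
  by move=> p _; rewrite 2!abse_EFin lee_fin; apply: le_trans (FW _) _; exact: ler_norm.
have pI := dom _ mp (fock_pair_le f g).
have cI := dom _ mc (fock_cross_le f g).
have fin : area_integral (fun z => (fock_pair f g z)%:E) \is a fin_num.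
  exact: integrable_fin_num.
have A3 : area_integral (fun z => (fock_cross f g z)%:E) = area_integral (fun z => (fock_pair f g z)%:E).
  by rewrite -A1; congr area_integral; apply/funext => z; rewrite E2.
have A4 : area_integral (fun z => (fock_pair f g z)%:E) = (- area_integral (fun z => (fock_cross f g z)%:E))%E.
  rewrite -A2 /area_integral -integralN; last exact: integrable_add_def.
  by apply: eq_integral => z _; rewrite E1 EFinN.
move: A4; rewrite A3 -(fineK fin) -EFinN => -[]; set a := fine _ => H.
by congr EFin; lra.
Qed.

End fock_pairing.

(** * Orthogonality of the peaked monomials and energies of their sums *)

Section peak_sums.
Variable R : realType.
Local Notation MR := (measurableTypeR R).
Local Notation leb := (@lebesgue_measure R).
Local Notation leb2 := (leb \x leb)%E.
Variable alpha : R.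
Hypothesis alpha0 : 0 < alpha.
Local Notation W := (fock_weight alpha).
Local Notation E := (peak_monomial alpha).

Let ccE k : ccont (E k). Proof. exact: (entire_ccont (@entire_peak_monomial R alpha k)). Qed.

Lemma integrable_peak_weight j k :
  leb2.-integrable [set: MR * MR] (fun p : MR * MR =>
    (W (E j) ((p.1 : R) +i* (p.2 : R)) * W (E k) ((p.1 : R) +i* (p.2 : R)))%:E).
Proof.
pose c : R := expR (k%:R ^+ 2 / 2).
have gI : leb2.-integrable [set: MR * MR] (fun p : MR * MR =>
    (c%:E * (expR (- (alpha / 4 * modulus ((p.1 : R) +i* (p.2 : R)) ^+ 2)))%:E)%E).
  apply: integrableZl => //; apply/integrableP; split; first exact: measurable_gauss2.
  rewrite (eq_integral (fun p : MR * MR => (expR (- (alpha / 4 * modulus ((p.1 : R) +i* (p.2 : R)) ^+ 2)))%:E)); last first.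
    by move=> p _; rewrite gee0_abs// lee_fin expR_ge0.
  have a4 : 0 < alpha / 4 by rewrite divr_gt0.
  have := area_gauss a4; rewrite /area_integral => ->.
  exact: ltry.
apply: le_integrable gI => //.
  apply/measurable_EFinP; apply: measurable_funM; exact: measurable_fock_weight.
move=> p _; rewrite -EFinM lee_fin (ger0_norm (mulr_ge0 (fock_weight_ge0 _ _ _) (fock_weight_ge0 _ _ _))).
rewrite (ger0_norm (mulr_ge0 (expR_ge0 _) (expR_ge0 _))).
rewrite -[leRHS]mul1r; apply: ler_pM; rewrite ?fock_weight_ge0//.
  exact: peak_monomial_le1.
exact: peak_monomial_gauss.
Qed.

Lemma integrable_peak_pair j k :
  leb2.-integrable [set: MR * MR] (fun p : MR * MR =>
    (fock_pair alpha (E j) (E k) ((p.1 : R) +i* (p.2 : R)))%:E).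
Proof.
apply: le_integrable (integrable_peak_weight j k) => //.
  by apply/measurable_EFinP; exact: measurable_fock_pair.
by move=> p _; rewrite lee_fin (le_trans (fock_pair_le _ _ _ _))// ler_norm.
Qed.

(** For k < j take u with u^(j^2 - k^2) = ['i]. Since |u| = 1, rotation by u multiplies E_j
    conj(E_k) by u^(j^2) conj(u)^(k^2) = ['i]. *)
Lemma peak_pair_orthogonal j k : j != k ->
  area_integral (fun z => (fock_pair alpha (E j) (E k) z)%:E) = 0%E.
Proof.
wlog kj : j k / (k < j)%N.
  move=> H jk; case: (ltngtP k j) => [kj|jk'|ejk]; [exact: H| |by rewrite ejk eqxx in jk].
  rewrite -[RHS](H k j jk') 1?eq_sym//; congr area_integral; apply/funext => z.
  by rewrite fock_pairC.
move=> _.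
have n0 : (0 < j ^ 2 - k ^ 2)%N by rewrite subn_gt0 ltn_sqr.
have [u [u1 uN1 uI]] := root_of_i R n0.
have EU l z : E l (u * z) = u ^+ (l ^ 2) * E l z.
  by rewrite /peak_monomial exprMn mulrCA.
apply: (@fock_pair_orthogonal R alpha (E j) (E k) u (u ^+ (j ^ 2)) (u ^+ (k ^ 2))) => //.
  have cu : u * u^* = 1.
    have := sqr_modulus u; rewrite u1 expr1n; case: (u) => a b /= ab.
    by apply: complexP => /=; [rewrite ab|]; ring.
  have conjX (a : R[i]) n : (a ^+ n)^* = a^* ^+ n.
    elim: n => [|n IH]; first by rewrite !expr0; apply: complexP; rewrite //= oppr0.
    rewrite !exprS -IH; case: (a) (a ^+ n) => x y [v w]; apply: complexP => /=; ring.
  rewrite conjX -(@subnK (k ^ 2) (j ^ 2)); last by rewrite leq_sqr ltnW.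
  by rewrite exprD uI -mulrA -exprMn cu expr1n mulr1.
exact: integrable_peak_weight.
Qed.

Definition peak_energy k : R :=
  fine (area_integral (fun z => (fock_pair alpha (E k) (E k) z)%:E)).

Lemma peak_pairE j k : area_integral (fun z => (fock_pair alpha (E j) (E k) z)%:E) =
  (if j == k then peak_energy k else 0)%:E.
Proof.
case: eqVneq => [->|jk]; last exact: peak_pair_orthogonal.
by rewrite fineK//; exact: (integrable_fin_num measurableT (integrable_peak_pair k k)).
Qed.

Lemma peak_energy_ge0 k : 0 <= peak_energy k.
Proof.
apply: fine_ge0; apply: area_ge0 => z.
by rewrite fock_pair_diag lee_fin sqr_ge0.
Qed.

(** Real coefficients cover both f, where all are 1, and its image, where they are moments; they
    pass through the real part taken in [fock_pair]. *)
Definition peak_sum (a : nat -> R) K (z : R[i]) : R[i] :=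
  \sum_(0 <= k < K) (a k)%:C * E k z.

Lemma entire_peak_sum a K : entire (peak_sum a K).
Proof.
apply: (entire_sum (F := fun k z => (a k)%:C * E k z)) => k.
exact: (entireM (@entire_cst R (a k)%:C) (@entire_peak_monomial R alpha k)).
Qed.

Lemma fock_pair_suml a K g z :
  fock_pair alpha (peak_sum a K) g z = \sum_(0 <= k < K) a k * fock_pair alpha (E k) g z.
Proof.
have Rs : complex.Re (peak_sum a K z) = \sum_(0 <= k < K) a k * complex.Re (E k z).
  rewrite /peak_sum; elim: K => [|K IH]; first by rewrite !big_geq.
  by rewrite !big_nat_recr//= ReD IH ReM /= mul0r subr0.
have Is : complex.Im (peak_sum a K z) = \sum_(0 <= k < K) a k * complex.Im (E k z).
  rewrite /peak_sum; elim: K {Rs} => [|K IH]; first by rewrite !big_geq.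
  by rewrite !big_nat_recr//= ImD IH ImM /= mul0r addr0.
rewrite /fock_pair Rs Is !mulr_suml -big_split /= mulr_suml.
by apply: eq_bigr => k _; ring.
Qed.

Lemma fock_pair_sum a b K z :
  fock_pair alpha (peak_sum a K) (peak_sum b K) z =
  \sum_(0 <= j < K) \sum_(0 <= k < K) a j * b k * fock_pair alpha (E j) (E k) z.
Proof.
rewrite fock_pair_suml; apply: eq_bigr => j _.
rewrite fock_pairC fock_pair_suml mulr_sumr; apply: eq_bigr => k _.
by rewrite fock_pairC mulrA.
Qed.

Lemma area_pair_sum a b K :
  area_integral (fun z => (fock_pair alpha (peak_sum a K) (peak_sum b K) z)%:E) =
  (\sum_(0 <= k < K) a k * b k * peak_energy k)%:E.
Proof.
rewrite /area_integral.
under eq_integral => p _ do rewrite fock_pair_sum -sumEFin.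
under eq_integral => p _ do under eq_bigr => j _ do rewrite -sumEFin.
have I1 j k : leb2.-integrable [set: MR * MR] (fun p : MR * MR =>
    (a j * b k * fock_pair alpha (E j) (E k) ((p.1 : R) +i* (p.2 : R)))%:E).
  by under eq_fun do rewrite EFinM; apply: integrableZl => //; exact: integrable_peak_pair.
rewrite integral_sum//; last by move=> j; apply: integrable_sum => // k _; exact: I1.
under eq_bigr => j _ do rewrite integral_sum//.
rewrite -sumEFin; apply: congr_big_nat => // j /andP[_ jK].
have I2 k : (\int[leb2]_p (a j * b k * fock_pair alpha (E j) (E k) ((p.1 : R) +i* (p.2 : R)))%:E)%E =
   (a j * b k * (if j == k then peak_energy k else 0))%:E.
  under eq_integral do rewrite EFinM.
  rewrite integralZl//; last exact: integrable_peak_pair.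
  by have := peak_pairE j k; rewrite /area_integral => ->.
under eq_bigr => k _ do rewrite I2.
rewrite sumEFin; congr EFin; rewrite big_mkord (bigD1 (Ordinal jK)) //= eqxx big1 ?addr0//.
move=> k kj; rewrite ifF ?mulr0//; apply/negbTE; rewrite eq_sym; exact: kj.
Qed.

End peak_sums.

Section peak_estimates.
Variable R : realType.
Local Notation MR := (measurableTypeR R).
Local Notation leb := (@lebesgue_measure R).
Local Notation leb2 := (leb \x leb)%E.
Variable alpha : R.
Hypothesis alpha0 : 0 < alpha.
Local Notation W := (fock_weight alpha).
Local Notation E := (peak_monomial alpha).
Local Notation C0 := (gauss_sum_bound R).

Definition flat_sum K := peak_sum alpha (fun=> 1) K.

Lemma flat_sum_weight_le K z : W (flat_sum K) z <= C0.
Proof.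
apply: le_trans (peak_monomial_sum_le alpha0 K z).
rewrite /fock_weight /flat_sum /peak_sum -mulr_suml ler_wpM2r ?expR_ge0//.
elim: K => [|K IH]; first by rewrite !big_geq// modulus0.
by rewrite !big_nat_recr//= mul1r (le_trans (ler_modulusD _ _))// lerD2r.
Qed.

Definition total_energy K : R := \sum_(0 <= k < K) peak_energy alpha k.

Lemma total_energy_ge0 K : 0 <= total_energy K.
Proof. by apply: sumr_ge0 => k _; exact: peak_energy_ge0. Qed.

Lemma area_flat_sum K :
  area_integral (fun z => (W (flat_sum K) z ^+ 2)%:E) = (total_energy K)%:E.
Proof.
rewrite -[RHS](_ : (\sum_(0 <= k < K) 1 * 1 * peak_energy alpha k)%:E = _); last first.
  by congr EFin; apply: eq_bigr => k _; rewrite !mul1r.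
rewrite -(area_pair_sum alpha0 (fun=> 1) (fun=> 1)).
by congr area_integral; apply/funext => z; rewrite fock_pair_diag.
Qed.

(** The integral is restricted to a square inside the disc, whose measure is that of a product set.
    At each of its points the single term with index the integer part of sqrt(alpha) |z| already
    contributes exp(-3). *)
Lemma total_energy_ge K : expR (- 3) / (4 * alpha) * K%:R ^+ 2 <= total_energy K.
Proof.
(* For coordinates below h, |z| <= |x| + |y| < K / sqrt(alpha); the area of the square is K^2 / (4
   alpha). *)
pose h : R := K%:R / (2 * Num.sqrt alpha).
have sa0 : 0 < Num.sqrt alpha by rewrite sqrtr_gt0.
have h0 : 0 <= h by rewrite divr_ge0// mulr_ge0// ltW.
pose I : set MR := `[0, h[%classic.
have mI : measurable I by exact: measurable_itv.
have lI : leb I = h%:E.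
  rewrite /I lebesgue_measure_itv/= lte_fin; case: ltP => h0'; first by rewrite oppr0 adde0.
  by congr EFin; apply/eqP; rewrite eq_le h0 h0'.
have mII : measurable (I `*` I) by exact: measurableX.
have lII : leb2 (I `*` I) = (h * h)%:E by rewrite product_measure1E//= lI.
have pE k : measurable_fun [set: MR * MR] (fun p : MR * MR =>
   (fock_pair alpha (E k) (E k) ((p.1 : R) +i* (p.2 : R)))%:E).
  exact: measurable_int (integrable_peak_pair alpha0 k k).
have p0 k z : (0 <= (fock_pair alpha (E k) (E k) z)%:E)%E by rewrite fock_pair_diag lee_fin sqr_ge0.
have -> : expR (- 3) / (4 * alpha) * K%:R ^+ 2 = expR (- 3) * (h * h).
  rewrite /h -[in LHS](@sqr_sqrtr _ alpha) ?(ltW alpha0)//; field; exact: lt0r_neq0.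
rewrite -lee_fin EFinM -lII -(@integral_cst _ _ _ leb2 (I `*` I))//.
have -> : (total_energy K)%:E = (\int[leb2]_(p in [set: MR * MR])
   \sum_(0 <= k < K) (fock_pair alpha (E k) (E k) ((p.1 : R) +i* (p.2 : R)))%:E)%E.
  rewrite ge0_integral_sum// -sumEFin; apply: eq_bigr => k _.
  by have := peak_pairE alpha0 k k; rewrite eqxx /area_integral => ->.
have ms : measurable_fun [set: MR * MR] (fun p : MR * MR =>
   (\sum_(0 <= k < K) (fock_pair alpha (E k) (E k) ((p.1 : R) +i* (p.2 : R)))%:E)%E).
  by apply: emeasurable_sum.
have s0 (p : MR * MR) : (0 <= (\sum_(0 <= k < K) (fock_pair alpha (E k) (E k) ((p.1 : R) +i* (p.2 : R)))%:E))%E.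
  by apply: sume_ge0 => k _; exact: p0.
apply: (@le_trans _ _ (\int[leb2]_(p in I `*` I)
   \sum_(0 <= k < K) (fock_pair alpha (E k) (E k) ((p.1 : R) +i* (p.2 : R)))%:E)%E); last first.
  exact: ge0_subset_integral.
apply: ge0_le_integral => //.
- by move=> p _; rewrite lee_fin expR_ge0.
- exact: measurable_funS ms.
move=> [x y] []; rewrite /I /= !in_itv/= => /andP[x0 xh] /andP[y0 yh].
set z := x +i* y; pose v := Num.sqrt alpha * modulus z.
have v0 : 0 <= v by rewrite mulr_ge0 ?modulus_ge0// ltW.
have vK : v < K%:R.
  have -> : K%:R = Num.sqrt alpha * (h + h).
    by rewrite /h; field; exact: lt0r_neq0.
  rewrite ltr_pM2l// (le_lt_trans (modulus_le_ReIm _))//= !ger0_norm//.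
  exact: ltrD.
have /andP[j1 j2] := truncn_itv v0; set j := Num.truncn v in j1 j2.
have jK : (j < K)%N by rewrite -(ltr_nat R) (le_lt_trans j1).
rewrite sumEFin lee_fin big_mkord (bigD1 (Ordinal jK))//= -[leLHS]addr0 lerD//.
  rewrite fock_pair_diag (_ : -3 = 2%:R * (- (3 / 2))); last by field.
  rewrite expRM_natl lerXn2r ?nnegrE ?expR_ge0 ?fock_weight_ge0//.
  by apply: peak_monomial_ge => //; rewrite j1.
by apply: sumr_ge0 => k _; rewrite fock_pair_diag sqr_ge0.
Qed.

(** For finite q >= 2, W <= C gives W^q <= C^(q - 2) W^2, whence the power S^(1/q) with B
    independent of f. At q = +oo the exponent is 0 and S^0 = 1, even for S = 0, so B = C works. *)
Lemma fock_norm_le_energy (q : \bar R) (C : R) : (2%:E <= q)%E -> 0 < C ->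
  exists2 B : R, 0 < B & forall f S, ccont f -> 0 <= S -> (forall z, W f z <= C) ->
    area_integral (fun z => (W f z ^+ 2)%:E) = S%:E ->
    (fock_norm alpha q f <= (B * S `^ (two_over q / 2))%:E)%E.
Proof.
case: q => [r| |]//; last first.
  move=> _ C0; exists C => // f S _ _ fC _; rewrite /= mul0r powRr0 mulr1.
  by apply: ge_ereal_sup => _ [z _ <-]; rewrite lee_fin.
rewrite lee_fin => r2 C1; have r0 : 0 < r by apply: lt_le_trans r2.
exists (fock_cst alpha r `^ r^-1 * (C `^ (r - 2)) `^ r^-1).
  by rewrite mulr_gt0// !powR_gt0// fock_cst_gt0.
move=> f S cf S0 fC SE.
have b0 : 0 <= (C `^ (r - 2)) `^ r^-1 * S `^ r^-1 by rewrite mulr_ge0 ?powR_ge0.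
have -> : two_over r%:E / 2 = r^-1 by rewrite /two_over; field; exact: lt0r_neq0.
rewrite -mulrA; apply: fock_norm_le_area => //.
rewrite -powRM ?powR_ge0// -powRrM mulVf ?gt_eqF// powRr1 ?mulr_ge0 ?powR_ge0// EFinM -SE.
rewrite /area_integral -ge0_integralZl//.
- apply: ge0_le_integral => //.
  + by move=> p _; rewrite lee_fin powR_ge0.
  + apply/measurable_EFinP; apply: (measurableT_comp (measurable_powR r)).
    exact: measurable_fock_weight.
  + apply: measurable_funeM; apply/measurable_EFinP; apply: measurable_funX.
    exact: measurable_fock_weight.
  + move=> p _; set w := W f _; have w0 : 0 <= w by exact: fock_weight_ge0.
    rewrite -EFinM lee_fin; have [->|wp] := eqVneq w 0.
      by rewrite powR0 ?gt_eqF// expr0n mulr0.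
    have -> : w `^ r = w `^ (r - 2) * w `^ 2 by rewrite -powRD ?wp ?implybT// subrK.
    rewrite (powR_mulrn 2 w0) ler_wpM2r ?sqr_ge0//.
    by apply: ge0_ler_powR; rewrite ?nnegrE ?subr_ge0 ?(ltW C1)//; exact: fC.
- apply/measurable_EFinP; apply: measurable_funX; exact: measurable_fock_weight.
- by move=> p _; rewrite lee_fin sqr_ge0.
- by rewrite lee_fin powR_ge0.
Qed.

End peak_estimates.

(** * Action of a bounded operator on the test functions *)

Section bounded_moments.
Variable R : realType.
Local Notation MR := (measurableTypeR R).
Local Notation leb := (@lebesgue_measure R).
Local Notation leb2 := (leb \x leb)%E.
Local Notation D0 := (`]0%R, +oo[%classic : set MR).
Variables (alpha p : R) (q : \bar R) (mu : {measure set MR -> \bar R}).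
Hypotheses (alpha0 : 0 < alpha) (p1 : 1 <= p) (p2 : p <= 2) (q2 : (2%:E <= q)%E) (pq : (p%:E < q)%E).
Hypothesis bounded : hausdorff_bounded alpha mu q p%:E.
Local Notation W := (fock_weight alpha).
Local Notation E := (peak_monomial alpha).

Let mD0 : measurable D0. Proof. exact: measurable_itv. Qed.

Let fock_of_energy f S (C : R) : entire f -> 0 < C -> 0 <= S -> (forall z, W f z <= C) ->
  area_integral (fun z => (W f z ^+ 2)%:E) = S%:E -> fock alpha q f.
Proof.
move=> ef C0 S0 fC SE; split=> //; have [B _ HB] := fock_norm_le_energy alpha0 q2 C0.
by apply: le_lt_trans (HB f S (entire_ccont ef) S0 fC SE) _; exact: ltry.
Qed.

Lemma fock_peak k : fock alpha q (E k).
Proof.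
apply: (fock_of_energy (S := peak_energy alpha k) (C := 1)) => //.
- exact: (@entire_peak_monomial R alpha k).
- exact: peak_energy_ge0.
- by move=> z; exact: peak_monomial_le1.
have := peak_pairE alpha0 k k; rewrite eqxx => <-.
by congr area_integral; apply/funext => z; rewrite fock_pair_diag.
Qed.

Lemma fock_flat_sum K : fock alpha q (flat_sum alpha K).
Proof.
apply: (fock_of_energy (S := total_energy alpha K) (C := gauss_sum_bound R)).
- exact: (@entire_peak_sum R alpha (fun=> 1) K).
- exact: gauss_sum_bound_gt0.
- exact: total_energy_ge0.
- by move=> z; exact: flat_sum_weight_le.
- exact: area_flat_sum.
Qed.

Let peak_integrand k z (t : MR) :
  hausdorff_integrand (E k) z t = E k z * (((t : R) ^+ (k ^ 2).+1)^-1)%:C.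
Proof.
rewrite /hausdorff_integrand /peak_monomial exprMn exprVn -mulrA -!mulrA; congr (_ * (_ * _)).
by rewrite -!rmorphXn -!fmorphV -rmorphM exprSr invfM.
Qed.

(** Well-definedness on E_k at the point z = 1 is exactly finiteness of mu_(k^2). The other indices
    are reached later, by monotonicity. *)
Let integrable_inv k : mu.-integrable D0 (fun t => (((t : R) ^+ (k ^ 2).+1)^-1)%:E).
Proof.
have [/(_ 1)[+ _] _] := bounded.1 _ (fock_peak k).
move=> /(integrableZl mD0 (peak alpha k)); apply: eq_integrable => // t _ /=.
rewrite peak_integrand /peak_monomial expr1n mulr1 -rmorphM /= -EFinM mulrA.
by rewrite mulfV ?mul1r// gt_eqF// peak_gt0.
Qed.

Definition square_moment k : R := fine (hausdorff_moment mu (k ^ 2)).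

Lemma hausdorff_moment_square k : hausdorff_moment mu (k ^ 2) = (square_moment k)%:E.
Proof. by rewrite fineK//; exact: (integrable_fin_num mD0 (integrable_inv k)). Qed.

Lemma hausdorff_peak k z : hausdorff mu (E k) z = (square_moment k)%:C * E k z.
Proof.
rewrite /hausdorff (_ : hausdorff_integrand (E k) z =
   (fun t => E k z * (((t : R) ^+ (k ^ 2).+1)^-1)%:C)); last first.
  by apply/funext => t; exact: peak_integrand.
rewrite (cintegralZ mD0).
  rewrite mulrC; congr (_ * _); apply: complexP => //=.
  by rewrite Rintegral_cst// mul0r.
split => /=; first exact: integrable_inv.
exact: integrable0.
Qed.

Lemma hausdorff_flat_sum K z :
  hausdorff mu (flat_sum alpha K) z = peak_sum alpha square_moment K z.
Proof.
rewrite /peak_sum; elim: K => [|K IH].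
  rewrite big_geq// /hausdorff; apply: complexP => /=.
    under eq_Rintegral => t _ do rewrite /hausdorff_integrand /flat_sum /peak_sum big_geq// mul0r.
    by rewrite Rintegral_cst// mul0r.
  under eq_Rintegral => t _ do rewrite /hausdorff_integrand /flat_sum /peak_sum big_geq// mul0r.
  by rewrite Rintegral_cst// mul0r.
rewrite big_nat_recr//= -IH -hausdorff_peak /hausdorff -(cintegralD mD0).
- apply: eq_cintegral => t _.
  by rewrite /hausdorff_integrand /flat_sum /peak_sum big_nat_recr//= mulrDl mul1r.
- exact: (bounded.1 _ (fock_flat_sum K)).1.
- exact: (bounded.1 _ (fock_peak K)).1.
Qed.

End bounded_moments.

(** * The energy inequality *)

Section moment_decay.
Variable R : realType.
Local Notation MR := (measurableTypeR R).
Local Notation leb := (@lebesgue_measure R).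
Local Notation leb2 := (leb \x leb)%E.
Variables (alpha p : R) (q : \bar R) (mu : {measure set MR -> \bar R}).
Hypotheses (alpha0 : 0 < alpha) (p1 : 1 <= p) (p2 : p <= 2) (q2 : (2%:E <= q)%E) (pq : (p%:E < q)%E).
Hypothesis bounded : hausdorff_bounded alpha mu q p%:E.
Local Notation W := (fock_weight alpha).
Local Notation C0 := (gauss_sum_bound R).

Let p0 : 0 < p. Proof. exact: lt_le_trans p1. Qed.

(* Compare G with e F: where G > e F, use G^(1-p) <= (e F)^(1-p) and 1 <= p <= 2. *)
Lemma mul_le_square_powR (F G C e : R) : 0 <= F <= C -> 0 <= G -> 0 < e ->
  G * F <= e * F ^+ 2 + e `^ (1 - p) * C `^ (2 - p) * G `^ p.
Proof.
move=> /andP[F0 FC] G0 e0; have [GF|GF] := leP G (e * F).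
  rewrite -[leLHS]addr0 lerD ?mulr_ge0 ?powR_ge0//.
  by rewrite expr2 mulrA ler_wpM2r.
rewrite -[leLHS]add0r lerD ?mulr_ge0 ?sqr_ge0 ?(ltW e0)//.
have [->|F_neq0] := eqVneq F 0; first by rewrite mulr0 !mulr_ge0 ?powR_ge0.
have Fp : 0 < F by rewrite lt_neqAle eq_sym F_neq0.
have eF : 0 < e * F by rewrite mulr_gt0.
have Gp : 0 < G by exact: lt_trans GF.
have GE : G = G `^ (1 - p) * G `^ p.
  by rewrite -powRD ?(gt_eqF Gp) ?implybT// subrK (powRr1 G0).
have FE : F `^ (1 - p) * F = F `^ (2 - p).
  rewrite -[X in _ * X](powRr1 F0) -powRD ?F_neq0 ?implybT//; congr powR; ring.
have H1 : G `^ (1 - p) <= e `^ (1 - p) * F `^ (1 - p).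
  rewrite -(powRM _ (ltW e0) F0); apply: powR_anti => //; first exact: ltW.
  by rewrite subr_le0.
rewrite [X in X * F]GE mulrAC ler_wpM2r ?powR_ge0//.
apply: le_trans (ler_wpM2r F0 H1) _; rewrite -mulrA FE ler_wpM2l ?powR_ge0//.
by apply: ge0_ler_powR; rewrite ?nnegrE ?subr_ge0// (le_trans F0).
Qed.

Lemma area_pair_le (f g : R[i] -> R[i]) (C e S T : R) : ccont f -> ccont g ->
  (forall z, W f z <= C) -> 0 < e ->
  area_integral (fun z => (W f z ^+ 2)%:E) = S%:E ->
  (area_integral (fun z => (W g z `^ p)%:E) <= T%:E)%E ->
  (area_integral (fun z => (fock_pair alpha g f z)%:E) <=
    (e * S + e `^ (1 - p) * C `^ (2 - p) * T)%:E)%E.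
Proof.
move=> cf cg fC e0 SE TE.
have mf := measurable_fock_weight alpha cf; have mg := measurable_fock_weight alpha cg.
set k := e `^ (1 - p) * C `^ (2 - p); have k0 : 0 <= k by rewrite mulr_ge0 ?powR_ge0.
have m1 : measurable_fun [set: MR * MR] (fun p : MR * MR => (W f ((p.1 : R) +i* (p.2 : R)) ^+ 2)%:E).
  by apply/measurable_EFinP; exact: measurable_funX.
have m2 : measurable_fun [set: MR * MR] (fun z : MR * MR => (W g ((z.1 : R) +i* (z.2 : R)) `^ p)%:E).
  by apply/measurable_EFinP; exact: (measurableT_comp (measurable_powR p)).
have mp : measurable_fun [set: MR * MR] (fun p : MR * MR => (fock_pair alpha g f ((p.1 : R) +i* (p.2 : R)))%:E).
  by apply/measurable_EFinP; exact: measurable_fock_pair.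
apply: le_trans (lee_abs _) _; apply: le_trans (le_abse_integral _ measurableT mp) _.
apply: (@le_trans _ _ (\int[leb2]_(z in [set: MR * MR])
  (e%:E * (W f ((z.1 : R) +i* (z.2 : R)) ^+ 2)%:E + k%:E * (W g ((z.1 : R) +i* (z.2 : R)) `^ p)%:E))%E).
  apply: ge0_le_integral => //.
  - exact: measurableT_comp.
  - by apply: emeasurable_funD; exact: measurable_funeM.
  - move=> z _; rewrite -!EFinM -EFinD abse_EFin lee_fin.
    apply: le_trans (fock_pair_le _ _ _ _) _; apply: mul_le_square_powR => //.
    + by rewrite fock_weight_ge0 fC.
    + exact: fock_weight_ge0.
rewrite ge0_integralD//; last 4 first.
- by move=> z _; rewrite -EFinM lee_fin mulr_ge0 ?sqr_ge0// ltW.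
- exact: measurable_funeM.
- by move=> z _; rewrite -EFinM lee_fin mulr_ge0 ?powR_ge0.
- exact: measurable_funeM.
rewrite !ge0_integralZl//; last 3 first.
- by move=> z _; rewrite lee_fin powR_ge0.
- by move=> z _; rewrite lee_fin sqr_ge0.
- by rewrite lee_fin ltW.
rewrite EFinD !EFinM; apply: leeD.
  by have := SE; rewrite /area_integral => ->.
by apply: lee_wpmul2l => //; rewrite lee_fin.
Qed.

(** The parameter e = m / 2 in [area_pair_le] leaves half of m S to be absorbed. [C1] collects the
    operator norm and the constants of the two norm comparisons, and S^(p/q) is the p-th power of
    the bound S^(1/q) on the norm of f. *)
Lemma square_moment_energy : exists2 C1 : R, 0 < C1 & forall K (m : R), 0 < m ->
  (forall k, (k < K)%N -> m <= square_moment mu k) ->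
  m * total_energy alpha K <= m / 2 * total_energy alpha K +
    (m / 2) `^ (1 - p) * C0 `^ (2 - p) * (C1 * total_energy alpha K `^ (two_over q / 2 * p)).
Proof.
have [M [M0 HM]] := bounded.2.
have [B B0 HB] := fock_norm_le_energy alpha0 q2 (gauss_sum_bound_gt0 R).
have c0 := fock_cst_gt0 alpha0 p0.
pose C1 := fock_cst alpha p `^ (- p^-1) * (M * B).
exists (C1 `^ p); first by rewrite powR_gt0// !mulr_gt0// powR_gt0.
move=> K m m0 mK; set S := total_energy alpha K.
have S0 : 0 <= S := total_energy_ge0 alpha K.
have cf : ccont (flat_sum alpha K) := entire_ccont (@entire_peak_sum R alpha (fun=> 1) K).
have fC z : W (flat_sum alpha K) z <= C0 := flat_sum_weight_le alpha0 K z.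
have SE : area_integral (fun z => (W (flat_sum alpha K) z ^+ 2)%:E) = S%:E := area_flat_sum alpha0 K.
have ff := fock_flat_sum alpha0 q2 K.
have nHf : (fock_norm alpha p%:E (hausdorff mu (flat_sum alpha K)) <=
    (M * (B * S `^ (two_over q / 2)))%:E)%E.
  apply: le_trans (HM _ ff) _; rewrite EFinM; apply: lee_wpmul2l; first by rewrite lee_fin ltW.
  exact: HB.
have MB0 : 0 <= M * (B * S `^ (two_over q / 2)).
  by rewrite !mulr_ge0 ?powR_ge0// ltW.
have := area_le_fock_norm alpha0 p0 MB0 nHf.
have -> : hausdorff mu (flat_sum alpha K) = peak_sum alpha (square_moment mu) K.
  by apply/funext => z; apply: hausdorff_flat_sum bounded _ _.
set g := peak_sum _ _ _ => TE.
have cg : ccont g := entire_ccont (@entire_peak_sum R alpha (square_moment mu) K).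
have h0 : 0 < m / 2 by rewrite divr_gt0.
have := area_pair_le cf cg fC h0 SE TE.
rewrite (area_pair_sum alpha0 _ (fun=> 1)) lee_fin => H.
apply: (@le_trans _ _ (\sum_(0 <= k < K) square_moment mu k * 1 * peak_energy alpha k)).
  rewrite /S /total_energy mulr_sumr big_nat [leRHS]big_nat; apply: ler_sum => k kK.
  by rewrite mulr1 ler_wpM2r ?peak_energy_ge0// mK.
apply: le_trans H _; rewrite lerD2l ler_wpM2l ?mulr_ge0 ?powR_ge0//.
rewrite le_eqVlt; apply/orP; left; apply/eqP.
have C10 : 0 <= C1 by rewrite /C1 !mulr_ge0 ?powR_ge0// ltW.
rewrite (powRrM S (two_over q / 2) p) -(powRM _ C10 (powR_ge0 _ _)).
by rewrite /C1 !mulrA.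
Qed.

End moment_decay.

(** * Decay and summability of the moments *)

Section part_two.
Variable R : realType.
Local Notation MR := (measurableTypeR R).
Local Notation D0 := (`]0%R, +oo[%classic : set MR).
Variables (alpha p : R) (q : \bar R) (mu : {measure set MR -> \bar R}).
Hypotheses (alpha0 : 0 < alpha) (p1 : 1 <= p) (p2 : p <= 2) (q2 : (2%:E <= q)%E) (pq : (p%:E < q)%E).
Hypothesis bounded : hausdorff_bounded alpha mu q p%:E.
Local Notation s := (gap_exponent p q).

Let p0 : 0 < p. Proof. exact: lt_le_trans p1. Qed.
(** This is 1 - p / q, the power of S that survives when S is divided by S^(p/q); it is positive
    because p < q, and s = p / w. *)
Let w := 1 - two_over q / 2 * p.

Let w0 : 0 < w.
Proof.
rewrite /w; case: q q2 pq => [r| |]//=; last by rewrite !mul0r subr0.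
rewrite lee_fin lte_fin => r2 pr; have r0 : 0 < r by exact: lt_le_trans r2.
rewrite subr_gt0 (_ : 2 / r / 2 * p = p / r); last by field; exact: lt0r_neq0.
by rewrite ltr_pdivrMr// mul1r.
Qed.

Let sE : s = p * w^-1.
Proof.
rewrite /w; case: q q2 pq => [r| |]//=; last by rewrite !mul0r subr0 invr1 mulr1.
rewrite lee_fin lte_fin => r2 pr; have r0 : 0 < r by exact: lt_le_trans r2.
rewrite (_ : 2 / r / 2 * p = p / r); last by field; exact: lt0r_neq0.
rewrite (_ : 1 - p / r = (r - p) / r); last by field; exact: lt0r_neq0.
by rewrite invf_div mulrA.
Qed.

Lemma gap_exponent_gt0 : 0 < s.
Proof. by rewrite sE mulr_gt0 ?invr_gt0. Qed.

Lemma square_moment_decay : exists2 C : R, 0 < C & forall K (m : R), 0 < m ->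
  (forall k, (k < K)%N -> m <= square_moment mu k) -> m `^ s * K%:R ^+ 2 <= C.
Proof.
have [C1 C10 H] := square_moment_energy alpha0 p1 p2 q2 bounded.
pose c1 : R := gauss_sum_bound R `^ (2 - p) * C1.
have c10 : 0 < c1 by rewrite mulr_gt0// powR_gt0// gauss_sum_bound_gt0.
pose a : R := expR (- 3) / (4 * alpha).
have a0 : 0 < a by rewrite divr_gt0 ?expR_gt0// mulr_gt0.
exists (2 `^ s * c1 `^ w^-1 / a); first by rewrite divr_gt0// mulr_gt0// powR_gt0.
move=> [|K] m m0 mK; first by rewrite expr0n/= mulr0 ltW// divr_gt0// mulr_gt0// powR_gt0.
have := H _ _ m0 mK; set S := total_energy alpha K.+1.
have SK : a * K.+1%:R ^+ 2 <= S := total_energy_ge alpha0 K.+1.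
have S0 : 0 < S by apply: lt_le_trans SK; rewrite mulr_gt0// exprn_gt0// ltr0n.
pose h := m / 2; have h0 : 0 < h by rewrite divr_gt0.
have mE : m = 2 * h by rewrite /h; field.
have -> : two_over q / 2 * p = 1 - w by rewrite /w; ring.
rewrite -/h => H1.
(* One h S is absorbed here. Multiplying by h^(p - 1) S^(w - 1) then isolates h^p S^w, and raising
   to the power 1 / w gives h^s S. *)
have H2 : h * S <= h `^ (1 - p) * c1 * S `^ (1 - w).
  have mS : m * S = h * S + h * S by rewrite {1}mE; ring.
  by move: H1; rewrite mS lerD2l /c1 !mulrA.
have H3 : h `^ p * S `^ w <= c1.
  have k0 : 0 <= h `^ (p - 1) * S `^ (w - 1) by rewrite mulr_ge0 ?powR_ge0.
  have := ler_wpM2r k0 H2.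
  have -> : h * S * (h `^ (p - 1) * S `^ (w - 1)) = h `^ p * S `^ w.
    rewrite mulrACA -{1}(powRr1 (ltW h0)) -{1}(powRr1 (ltW S0)).
    by rewrite -!powRD ?(gt_eqF h0) ?(gt_eqF S0) ?implybT//; congr (_ `^ _ * _ `^ _); ring.
  have -> : h `^ (1 - p) * c1 * S `^ (1 - w) * (h `^ (p - 1) * S `^ (w - 1)) =
     c1 * (h `^ (1 - p) * h `^ (p - 1)) * (S `^ (1 - w) * S `^ (w - 1)) by ring.
  rewrite -!powRD ?(gt_eqF h0) ?(gt_eqF S0) ?implybT//.
  rewrite (_ : 1 - p + (p - 1) = 0); last by ring.
  by rewrite (_ : 1 - w + (w - 1) = 0) ?powRr0 ?mulr1//; ring.
have H4 : h `^ s * S <= c1 `^ w^-1.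
  have -> : h `^ s * S = (h `^ p * S `^ w) `^ w^-1.
    rewrite (powRM _ (powR_ge0 _ _) (powR_ge0 _ _)) -!powRrM -sE mulfV ?gt_eqF//.
    by rewrite (powRr1 (ltW S0)).
  apply: ge0_ler_powR => //; rewrite ?nnegrE ?mulr_ge0 ?powR_ge0//; apply: ltW => //.
  by rewrite invr_gt0.
have mp : m `^ s = 2 `^ s * h `^ s by rewrite {1}mE (powRM _ (ler0n R 2) (ltW h0)).
rewrite mp ler_pdivlMr// -!mulrA ler_wpM2l ?powR_ge0//.
apply: le_trans H4; rewrite ler_wpM2l ?powR_ge0//; by move: SK; rewrite expr2 mulrC -mulrA.
Qed.

Let mD0 : measurable D0. Proof. exact: measurable_itv. Qed.
Local Notation D01 := (`]0%R, 1%R[%classic : set MR).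
Let mD01 : measurable D01. Proof. exact: measurable_itv. Qed.

Let inv_pow n (t : MR) : \bar R := (((t : R) ^+ n.+1)^-1)%:E.

Let measurable_inv_pow n (D : set MR) : measurable_fun D (inv_pow n).
Proof.
apply: measurable_funTS; apply/measurable_EFinP.
apply: (measurableT_comp (@measurable_inv_fun R)); exact: exprn_measurable.
Qed.

Let inv_pow_ge0 n t : D0 t -> (0 <= inv_pow n t)%E.
Proof. by rewrite /= in_itv/= andbT => t0; rewrite lee_fin invr_ge0 exprn_ge0// ltW. Qed.

Let le_moment n : (mu D01 <= hausdorff_moment mu n)%E.
Proof.
have sub t : D01 t -> D0 t by rewrite /= !in_itv/= andbT => /andP[].
rewrite -[leLHS]mul1e -(integral_cst mu mD01 1).
apply: (@le_trans _ _ (\int[mu]_(t in D01) inv_pow n t)%E).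
  apply: ge0_le_integral => // t; rewrite /= in_itv/= => /andP[t0 t1].
  by rewrite lee_fin invf_ge1 ?exprn_gt0// exprn_ile1// ltW.
by apply: ge0_subset_integral => //; exact: inv_pow_ge0.
Qed.

Let sm := square_moment mu.
Let smE k : hausdorff_moment mu (k ^ 2) = (sm k)%:E := hausdorff_moment_square alpha0 q2 bounded k.

Let mu01 : mu D01 = 0%E.
Proof.
apply/eqP; rewrite eq_le measure_ge0 andbT leNgt; apply/negP => m0.
have fin : mu D01 \is a fin_num.
  rewrite ge0_fin_numE//; apply: le_lt_trans (le_moment (0 ^ 2)) _.
  by rewrite smE ltry.
move: m0; rewrite -(fineK fin) lte_fin; set m := fine _ => m0.
have [C C0 HC] := square_moment_decay.
have ms k : m <= sm k by rewrite -lee_fin /m (fineK fin) -smE; exact: le_moment.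
have ms0 : 0 < m `^ s by rewrite powR_gt0.
(* K exceeds C / m^s, and K <= K^2 then contradicts the decay estimate. *)
pose K := (Num.truncn (C / m `^ s)).+1.
have := HC K m m0 (fun k _ => ms k); apply/negP; rewrite -ltNge.
have KC : C / m `^ s < K%:R := truncnS_gt _.
rewrite mulrC -ltr_pdivrMr//; apply: lt_le_trans KC _.
by rewrite expr2 ler_peMr ?ler0n// ler1n.
Qed.

(** For t >= 1 the powers t^-(n+1) do not increase with n. At t = 1 they are constant, which is why
    [D01] is open at 1 here. *)
Let moment_anti m n : (m <= n)%N -> (hausdorff_moment mu n <= hausdorff_moment mu m)%E.
Proof.
have tail k : (hausdorff_moment mu k = \int[mu]_(t in D0 `\` D01) inv_pow k t)%E.
  exact: (ge0_negligible_integral mD01 mD0 (@measurable_inv_pow k D0) (@inv_pow_ge0 k) mu01).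
move=> mn; rewrite !tail; apply: ge0_le_integral => //.
- exact: measurableD.
- by move=> t [t0 _]; exact: inv_pow_ge0.
- move=> t [/= t0 t1].
  have t1' : 1 <= (t : R).
    rewrite leNgt; apply/negP => tl; apply: t1; move: t0.
    by rewrite !in_itv/= andbT => ->.
  rewrite lee_fin lef_pV2 ?posrE ?exprn_gt0 ?(lt_le_trans ltr01 t1')//.
  exact: ler_weXn2l.
Qed.

Let square_between n : exists K : nat, (K ^ 2 <= n < K.+1 ^ 2)%N.
Proof.
elim: n => [|n [K /andP[K1 K2]]]; first by exists 0%N.
move: K2; rewrite leq_eqVlt => /orP[/eqP K2|K2].
  by exists K.+1; rewrite K2 leqnn ltn_sqr ltnSn.
by exists K; rewrite K2 ltnW.
Qed.

Let moment_decay : exists2 C : R, 0 < C & forall n,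
  (hausdorff_moment mu n `^ s <= (C / n.+1%:R)%:E)%E.
Proof.
have [C C0 HC] := square_moment_decay; exists C => // n.
have [K /andP[Kn nK]] := square_between n.
have m_ge0 : (0 <= hausdorff_moment mu n)%E by apply: le_trans (le_moment n); exact: measure_ge0.
have fin : hausdorff_moment mu n \is a fin_num.
  by rewrite ge0_fin_numE//; apply: le_lt_trans (moment_anti Kn) _; rewrite smE ltry.
move: m_ge0; rewrite -(fineK fin); set m := fine _; rewrite lee_fin => m_ge0.
rewrite poweR_EFin lee_fin ler_pdivlMr ?ltr0n//.
have [->|m_neq0] := eqVneq m 0; first by rewrite powR0 ?mul0r ?ltW// gt_eqF// gap_exponent_gt0.
have m0 : 0 < m by rewrite lt_neqAle eq_sym m_neq0.
(* The K + 1 indices k = 0, ..., K all satisfy k^2 <= n, so their moments are at least mu_n; and (K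
   + 1)^2 >= n + 1. *)
apply: le_trans (HC K.+1 m m0 _); last first.
  move=> k kK; rewrite -lee_fin /m (fineK fin) -[X in (_ <= X)%E]smE; apply: moment_anti.
  by apply: leq_trans Kn; rewrite leq_sqr -ltnS.
by rewrite ler_wpM2l ?powR_ge0// -natrX ler_nat.
Qed.

(** The terms are (n + 1)^(-3/2). The subtracted 2 / sqrt(N + 1), the tail of the corresponding
    integral, makes the induction close, with equality at N = 0. *)
Let sum_le N : \sum_(0 <= n < N.+1) n.+1%:R^-1 * (n.+1%:R : R) `^ (- 2^-1) <=
   3 - 2 * N.+1%:R `^ (- 2^-1).
Proof.
have E (n : nat) : n.+1%:R `^ (- 2^-1) = (Num.sqrt (n.+1%:R : R))^-1 by rewrite powRN powR12_sqrt.
elim: N => [|N IH]; first by rewrite big_nat1 E sqrtr1 invr1; lra.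
rewrite big_nat_recr//=; apply: le_trans (lerD IH (lexx _)) _; rewrite !E.
set a := Num.sqrt N.+1%:R; set b := Num.sqrt N.+2%:R.
have a0 : 0 < a by rewrite sqrtr_gt0 ltr0n.
have b0 : 0 < b by rewrite sqrtr_gt0 ltr0n.
have ab : a <= b by rewrite ler_sqrt ?ler_nat ?ler0n.
have a2 : a ^+ 2 = N.+1%:R by rewrite sqr_sqrtr ?ler0n.
have b2 : b ^+ 2 = N.+2%:R by rewrite sqr_sqrtr ?ler0n.
have ba : (b - a) * (b + a) = 1 by rewrite -subr_sqr a2 b2 -[N.+2%:R]natr1 addrC addKr.
rewrite -b2 -subr_ge0.
(* The induction step is 1 / b^3 <= 2 / a - 2 / b for consecutive square roots a and b; since (b -
   a)(b + a) = 1 it reduces to 2 b^2 >= a (b + a). *)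
have -> : 3 - 2 / b - (3 - 2 / a + (b ^+ 2)^-1 / b) =
   ((b - a) * (b + a) * 2 * b ^+ 2 - a * (b + a)) / (a * b ^+ 3 * (b + a)).
  by field; rewrite !gt_eqF ?addr_gt0.
have num : 0 <= 2 * b ^+ 2 - a * (b + a).
  have : a * a <= b * b by apply: ler_pM => //; exact: ltW.
  have : a * b <= b * b by rewrite ler_wpM2r// ltW.
  by rewrite expr2 mulrDr; lra.
by rewrite ba mul1r divr_ge0// !mulr_ge0 ?exprn_ge0 ?addr_ge0 ?(ltW a0) ?(ltW b0).
Qed.

Lemma sum_of_hausdorff_bounded : (\sum_(0 <= n <oo)
  (hausdorff_moment mu n `^ s * ((n.+1%:R : R) `^ (- 2^-1))%:E) < +oo)%E.
Proof.
have [C C0 HC] := moment_decay.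
apply: (@le_lt_trans _ _ (C * 3)%:E); last exact: ltry.
apply: lime_le.
  by apply: is_cvg_nneseries => n _ _; rewrite mule_ge0 ?poweR_ge0// lee_fin powR_ge0.
apply: nearW => N; apply: (@le_trans _ _ (\sum_(0 <= n < N) (C * (n.+1%:R^-1 * n.+1%:R `^ (- 2^-1)))%:E)%E).
  apply: lee_sum => n _; rewrite mulrA EFinM; apply: lee_wpmul2r; last exact: HC.
  by rewrite lee_fin powR_ge0.
rewrite sumEFin lee_fin -mulr_sumr ler_pM2l//; case: N => [|N]; first by rewrite big_geq.
by apply: le_trans (sum_le N) _; rewrite gerBl mulr_ge0 ?powR_ge0.
Qed.

End part_two.

Theorem theorem5p3 (R : realType) (alpha p : R) (q : \bar R)
    (mu : {measure set (measurableTypeR R) -> \bar R})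
    (halpha : 0 < alpha) (hp1 : 1 <= p) (hp2 : p <= 2)
    (hq2 : (2%:E <= q)%E) (hpq : (p%:E < q)%E) :
  ((\int[mu]_(t in `[1%R, +oo[) (((t : R) `^ (two_over q - 1))%:E) < +oo)%E ->
   (\sum_(0 <= n <oo)
      (hausdorff_moment mu n * ((n.+1%:R : R) `^ (exponent_gap p q - 1))%:E)
      < +oo)%E ->
   hausdorff_bounded alpha mu q p%:E)
  /\
  (hausdorff_bounded alpha mu q p%:E ->
   (\sum_(0 <= n <oo)
      (hausdorff_moment mu n `^ gap_exponent p q
         * ((n.+1%:R : R) `^ (- 2^-1))%:E)
      < +oo)%E).
Proof.
split; first exact: hausdorff_bounded_of_sum.
by move=> bounded; exact: (sum_of_hausdorff_bounded halpha hp1 hp2 hq2 hpq bounded).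
Qed.
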